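(* The following hold for the generative leap exponent $k^\star$ and information leap exponent $l^\star$ of the law $\mathsf P$ of $(Z,Y)$, $Z\sim N(0,I_r)$, for each of the models below (in each case assumed to have intrinsic dimension $r$): (i) $r$-Gaussian parity, $Y=\mathrm{sign}(Z_1Z_2\cdots Z_r)$: $k^\star=l^\star=r$. (ii) Staircase parity functions, $Y=\sum_{j=1}^r\mathrm{sign}(Z_1Z_2\cdots Z_j)$: $k^\star\le l^\star=1$. (iii) Intersections of half-spaces, $Y=2\prod_{j=1}^M\mathbf 1(v_j^\top Z>\alpha_j)-1$ with $M\ge1$, $v_j\in\mathbb R^r$, $\alpha_j\in\mathbb R$: $k^\star\le2$. (iv) Polynomials, $Y=q(Z)$ with $q:\mathbb R^r\to\mathbb R$ a polynomial: $k^\star\le2$.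
   Context: Fix $r\ge1$. $\gamma_m$ denotes the standard Gaussian measure on $\mathbb R^m$. $\mathsf P$ is a probability measure on $\mathbb R^r\times\mathbb R$; $(Z,Y)\sim\mathsf P$ has $Z\sim\gamma_r$. Intrinsic dimension $r$ means: there is no proper subspace $S\subsetneq\mathbb R^r$ such that $Z_{S^\perp}$ is independent of $(Z_S,Y)$, where $Z_S$ is the orthogonal projection of $Z$ onto $S$. For a subspace $S$ (with $\emptyset$ denoting $\{0\}$) put $\bar Z_S=Z_{S^\perp}$, $\bar Y_S=(Z_S,Y)$. The normalized Hermite tensors on $\mathbb R^m$ are $\mathbf h_k(u)=\frac{(-1)^k}{\sqrt{k!}}\frac{\nabla^{\otimes k}\gamma_m(u)}{\gamma_m(u)}$, where $\gamma_m(u)$ is the Gaussian density (for $S^\perp$, identify $S^\perp$ with $\mathbb R^{\dim S^\perp}$). Define $\zeta_{k,S}=\mathbb E[\mathbf h_k(\bar Z_S)\mid\bar Y_S]$, $\Lambda_k(S)=\mathbb E[\zeta_{k,S}(\bar Y_S)\otimes\zeta_{k,S}(\bar Y_S)]$, $\lambda_k^2(S)=\mathbb E\|\zeta_{k,S}(\bar Y_S)\|_F^2$, $k(S)=\min\{k\ge1:\lambda_k^2(S)>0\}$. The span of a tensor is the column space of its unfolding along the first index into a matrix. The leap decomposition is $S_0=\emptyset$, $k_{i+1}=k(S_i)$, $S_{i+1}=S_i+\mathrm{span}[\Lambda_{k_{i+1}}(S_i)]$, until $S_L=\mathbb R^r$; the generative leap exponent is $k^\star=\max_ik_i$. Information leap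 exponent: define $\tilde\zeta_{k,S}=\mathbb E[Y\mathbf h_k(\bar Z_S)\mid Z_S]$, $\tilde\Lambda_k(S)=\mathbb E[\tilde\zeta_{k,S}(Z_S)\otimes\tilde\zeta_{k,S}(Z_S)]$, $\tilde\lambda_k^2(S)=\mathbb E\|\tilde\zeta_{k,S}(Z_S)\|_F^2$, $l(S)=\min\{k\ge1:\tilde\lambda_k^2(S)>0\}$; $\tilde S_0=\emptyset$, $l_{i+1}=l(\tilde S_i)$, $\tilde S_{i+1}=\tilde S_i+\mathrm{span}[\tilde\Lambda_{l_{i+1}}(\tilde S_i)]$, until $\mathbb R^r$ is reached; $l^\star=\max_il_i$. *)

(* Defs.v *)
From HB Require Import structures.
From mathcomp Require Import all_boot all_order all_algebra.
From mathcomp Require Import all_classical all_reals all_analysis.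
From mathcomp Require mpoly.

Set Implicit Arguments.
Unset Strict Implicit.
Unset Printing Implicit Defensive.

Import Order.TTheory GRing.Theory Num.Theory.
Import numFieldNormedType.Exports.

Local Open Scope classical_set_scope.
Local Open Scope ring_scope.

Definition measure_matrix_display : measure_display -> measure_display.
Proof. exact. Qed.

Section measurable_matrix.
Context {d} {T : measurableType d}.
Variables m n : nat.

Definition matrix_cylinders : set_system 'M[T]_(m, n) :=
  \bigcup_(ij in [set: 'I_m * 'I_n])
    preimage_set_system setT (fun A : 'M[T]_(m, n) => A ij.1 ij.2) measurable.

Let matrix_set0 : <<s matrix_cylinders >> set0.
Proof. exact: sigma_algebra0. Qed.

Let matrix_setC A : <<s matrix_cylinders >> A -> <<s matrix_cylinders >> (~` A).
Proof. exact: sigma_algebraC. Qed.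

Let matrix_bigcup (F : _^nat) : (forall i, <<s matrix_cylinders >> (F i)) ->
  <<s matrix_cylinders >> (\bigcup_i (F i)).
Proof. exact: sigma_algebra_bigcup. Qed.

HB.instance Definition _ := @isMeasurable.Build (measure_matrix_display d)
  'M[T]_(m, n) <<s matrix_cylinders >> matrix_set0 matrix_setC matrix_bigcup.

End measurable_matrix.

(* A subspace of R^n is the row space of a matrix; vectors are row vectors. *)
Section subspaces.
Variable R : realType.

Definition perp m n (S : 'M[R]_(m, n)) : 'M[R]_n := kermx S^T.

Definition oproj n (S : 'M[R]_n) (z : 'rV[R]_n) : 'rV[R]_n :=
  z *m proj_mx S (perp S).

Definition orthonormal_basis m n (A : 'M[R]_(m, n)) :
    pred 'M[R]_(\rank A, n) :=
  [pred U | (U *m U^T == 1%:M) && (U == A)%MS].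
Arguments orthonormal_basis {m n} A.

Lemma row_free_orthonormalize k n (A : 'M[R]_(k, n)) : row_free A ->
  exists U : 'M[R]_(k, n), U *m U^T = 1%:M /\ (U :=: A)%MS.
Proof.
elim: k => [|k IH] in A *.
  by exists A; split => //; rewrite [LHS]flatmx0 [RHS]flatmx0.
rewrite -[k.+1]/(1 + k)%N in A *; rewrite -[A]vsubmxK.
set a := usubmx A; set B := dsubmx A => fA.
have rkB : \rank (col_mx a B) = k.+1 by apply/eqP.
have rD : (\rank a + \rank B >= k.+1)%N.
  by rewrite -rkB -addsmxE mxrank_adds_leqif.
have fB : row_free B.
  rewrite /row_free eqn_leq rank_leq_row /=.
  by move: (rank_leq_row a) rD => h1 h2; rewrite -(leq_add2l 1); apply: (leq_trans h2); rewrite leq_add2r.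
have [V [VV VB]] := IH B fB.
pose b : 'rV[R]_n := a - a *m V^T *m V.
have bV : b *m V^T = 0.
  by rewrite mulmxBl -!mulmxA VV mulmx1 subrr.
have eqAb : (col_mx b V :=: col_mx a B)%MS.
  apply: eqmx_trans (addsmxE _ _) => //.
  apply: eqmx_trans (eqmx_sym (addsmxE _ _)) _.
  apply/eqmxP/andP; split; rewrite addsmx_sub; apply/andP; split.
  - rewrite /b addmx_sub ?addsmxSl// -mulNmx.
    by apply: submx_trans (submxMl _ _) _; rewrite VB addsmxSr.
  - by rewrite VB addsmxSr.
  - rewrite -[X in (X <= _)%MS](subrK (a *m V^T *m V)) -/b.
    by rewrite addmx_sub ?addsmxSl//; apply: submx_trans (submxMl _ _) (addsmxSr _ _).
  - by rewrite -VB addsmxSr.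
have b0 : b != 0.
  apply/eqP => b0; have := rkB; rewrite -eqAb b0.
  rewrite -addsmxE adds0mx => rV.
  by have := rank_leq_row V; rewrite rV ltnn.
pose s := \sum_j b 0 j ^+ 2.
have sE : b *m b^T = s%:M.
  apply/rowP => i; rewrite !ord1 !mxE eqxx mulr1n.
  by apply: eq_bigr => j _; rewrite [b^T _ _]mxE expr2.
have s0 : 0 < s.
  rewrite lt_def sumr_ge0 ?andbT; last by move=> j _; exact: sqr_ge0.
  apply: contra b0; rewrite psumr_eq0; last by move=> j _; exact: sqr_ge0.
  move=> /allP h; apply/eqP/rowP => j; rewrite [RHS]mxE.
  by apply/eqP; rewrite -sqrf_eq0; apply: h; exact: mem_index_enum.
exists (col_mx ((Num.sqrt s)^-1 *: b) V); split.
  rewrite tr_col_mx mul_col_row linearZ /= -scalemxAl -scalemxAr sE.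
  rewrite scalerA -scalemxAl bV scaler0 -scalemxAr.
  rewrite VV -[V *m b^T]trmxK trmx_mul trmxK bV trmx0 scaler0.
  rewrite -invfM -expr2 sqr_sqrtr ?ltW// scale_scalar_mx mulVf ?gt_eqF//.
  by rewrite -scalar_mx_block.
apply: eqmx_trans eqAb.
apply: eqmx_trans (eqmx_sym (addsmxE _ _)) _.
apply: eqmx_trans (addsmxE _ _).
apply: adds_eqmx => //.
by apply: eqmx_scale; rewrite invr_eq0 gt_eqF// sqrtr_gt0.
Qed.

Lemma orthonormal_basis_ex m n (A : 'M[R]_(m, n)) :
  exists U, orthonormal_basis A U.
Proof.
have [U [UU UA]] := row_free_orthonormalize (row_base_free A).
exists U; rewrite /orthonormal_basis /= UU eqxx /=.
by apply/eqmxP; apply: eqmx_trans UA (eq_row_base A).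
Qed.

(* The rows are an orthonormal basis of the row space of [A]: the chosen
   identification of that subspace with R^(dim). *)
Definition frame m n (A : 'M[R]_(m, n)) : 'M[R]_(\rank A, n) :=
  xchoose (orthonormal_basis_ex A).

Lemma frame_orthonormal m n (A : 'M[R]_(m, n)) :
  frame A *m (frame A)^T = 1%:M.
Proof. by have /andP[/eqP] := xchooseP (orthonormal_basis_ex A). Qed.

Lemma eq_frame m n (A : 'M[R]_(m, n)) : (frame A :=: A)%MS.
Proof. by have /andP[_ /eqmxP] := xchooseP (orthonormal_basis_ex A). Qed.

End subspaces.

Section tensors.
Variable R : realType.

Definition tensor k m := k.-tuple 'I_m -> R.

Definition tensor_prod j k m (A : tensor j m) (B : tensor k m) :
    tensor (j + k) m :=
  fun t => A [tuple tnth t (lshift k i) | i < j]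
         * B [tuple tnth t (rshift j i) | i < k].

Definition frobenius2 k m (A : tensor k m) : R := \sum_t A t ^+ 2.

Definition unfolding k m (A : tensor k.+1 m) :
    'M[R]_(m, #|{: k.-tuple 'I_m}|) :=
  \matrix_(i, j) A (cons_tuple i (enum_val j)).

(* A subspace is a row space here, hence the transposition of the unfolding.
   The order-0 case is junk: only levels k >= 1 occur in a leap decomposition. *)
Definition tensor_span k m : tensor k m -> 'M[R]_m :=
  match k with
  | 0 => fun=> 0
  | k'.+1 => fun A => <<(unfolding A)^T>>%MS
  end.

Definition gauss_pdf m (u : 'rV[R]_m) : R := \prod_(i < m) normal_pdf 0 1 (u 0 i).

Definition partial m (i : 'I_m) (f : 'rV[R]_m -> R) : 'rV[R]_m -> R :=
  fun u => 'D_(delta_mx 0 i) f u.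

Definition hermite k m (u : 'rV[R]_m) : tensor k m :=
  fun t => (-1) ^+ k / Num.sqrt (k`!)%:R
           * (foldr (@partial m) (@gauss_pdf m) t u / gauss_pdf u).

End tensors.

Section conditioning.
Context d (T : measurableType d) (R : realType) (P : probability T R).

Definition is_cexp d' (E : measurableType d') (X : T -> R) (W : T -> E)
    (g : E -> R) :=
  [/\ measurable_fun setT g,
      P.-integrable setT (fun t => (g (W t))%:E) &
      forall B, measurable B ->
        (\int[P]_(t in W @^-1` B) (g (W t))%:E
         = \int[P]_(t in W @^-1` B) (X t)%:E)%E].

(* A version of E[X | W] as a function of the value of W; the value is junk
   when no version exists, i.e. when X is not integrable. *)
Definition cexp d' (E : measurableType d') (X : T -> R) (W : T -> E) : E -> R :=
  xget (fun=> 0) [set g | is_cexp X W g].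

Definition independent d1 d2 (E1 : measurableType d1) (E2 : measurableType d2)
    (X1 : T -> E1) (X2 : T -> E2) :=
  forall A B, measurable A -> measurable B ->
    P (X1 @^-1` A `&` X2 @^-1` B) = (P (X1 @^-1` A) * P (X2 @^-1` B))%E.

End conditioning.

(* Independent N(0,1) coordinates; the product rule on boxes determines [mu]. *)
Definition std_gaussian (R : realType) m (mu : set 'rV[R]_m -> \bar R) :=
  forall A : 'I_m -> set (measurableTypeR R), (forall i, measurable (A i)) ->
    mu [set z | forall i, A i (z 0 i)]
    = (\prod_(i < m) fine (normal_prob 0 1 (A i)))%:E.

Section decomposition.
Variables (R : realType) (r : nat).
(* [lam S k] stands for lambda_k^2(S), [spn S k] for span[Lambda_k(S)]. *)
Variables (lam : 'M[R]_r -> nat -> \bar R) (spn : 'M[R]_r -> nat -> 'M[R]_r).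

Definition first_level (S : 'M[R]_r) (k : nat) :=
  [/\ (1 <= k)%N, (0 < lam S k)%E &
      forall j, (1 <= j)%N -> (0 < lam S j)%E -> (k <= j)%N].

Record leap_decomposition (L : nat) (S : nat -> 'M[R]_r) (k : nat -> nat) := {
  leap_start : S 0%N = 0;
  leap_proper : forall i, (i < L)%N -> ~~ row_full (S i);
  leap_level : forall i, (i < L)%N -> first_level (S i) (k i.+1);
  leap_step : forall i, (i < L)%N -> S i.+1 = (S i + spn (S i) (k i.+1))%MS;
  leap_end : row_full (S L) }.

(* [leap_exponent e]: the leap decomposition reaches the whole space and the
   largest of its levels is [e]. Such an [e] is unique, but need not exist for
   an arbitrary [lam]. *)
Definition leap_exponent (e : nat) :=
  exists L S k, leap_decomposition L S k /\ e = \max_(1 <= i < L.+1) k i.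

Lemma leap_exponent_inj e1 e2 : leap_exponent e1 -> leap_exponent e2 -> e1 = e2.
Proof.
move=> [L1 [S1 [k1 [D1 ->]]]] [L2 [S2 [k2 [D2 ->]]]].
have kU S j1 j2 : first_level S j1 -> first_level S j2 -> j1 = j2.
  move=> [p1 q1 m1] [p2 q2 m2].
  by apply/eqP; rewrite eqn_leq m1// m2.
have SE i : (i <= L1)%N -> (i <= L2)%N -> S1 i = S2 i.
  elim: i => [|i IH] h1 h2; first by rewrite (leap_start D1) (leap_start D2).
  have Si := IH (ltnW h1) (ltnW h2).
  rewrite (leap_step D1)// (leap_step D2)// Si; congr (_ + spn _ _)%MS.
  by apply: (kU (S1 i)); [exact: leap_level D1 _ _|rewrite Si; exact: leap_level D2 _ _].
have LE : L1 = L2.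
  case: (ltngtP L1 L2) => // h.
  - by have := leap_proper D2 h; rewrite -SE ?(ltnW h)// (leap_end D1).
  - by have := leap_proper D1 h; rewrite SE ?(ltnW h)// (leap_end D2).
subst L2; apply: eq_big_nat => -[//|i] /andP[_ iL].
apply: (kU (S1 i)); first exact: leap_level D1 _ _.
rewrite (SE i (ltnW iL) (ltnW iL)); exact: leap_level D2 _ _.
Qed.

End decomposition.

Section exponents.
Variables (R : realType) (r : nat).
Notation sample := ('rV[R]_r * measurableTypeR R)%type.
Variable P : probability sample R.
Implicit Types (S : 'M[R]_r) (w : sample).

Definition perp_dim S := \rank (perp S).

(* Z_{S^perp}, read in R^(dim S^perp). *)
Definition Zbar S w : 'rV[R]_(perp_dim S) :=
  oproj (perp S) w.1 *m (frame (perp S))^T.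

Definition Zpar S w : 'rV[R]_r := oproj S w.1.

Definition Ybar S w : sample := (Zpar S w, w.2).

Definition intrinsic_dimension :=
  ~ exists2 S : 'M[R]_r, ~~ row_full S &
      independent P (fun w => oproj (perp S) w.1) (Ybar S).

(* Undoes the identification of S^perp with R^(dim S^perp). *)
Definition in_ambient S (V : 'M[R]_(perp_dim S)) : 'M[R]_r :=
  <<V *m frame (perp S)>>%MS.

Definition zeta k S : sample -> tensor R k (perp_dim S) :=
  fun y t => cexp P (fun w => hermite (Zbar S w) t) (Ybar S) y.

Arguments zeta k S y t : clear implicits.

Definition Lambda k S : tensor R (k + k) (perp_dim S) :=
  fun t => fine 'E_P[fun w =>
    tensor_prod (zeta k S (Ybar S w)) (zeta k S (Ybar S w)) t].

Arguments Lambda k S t : clear implicits.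

Definition lambda2 S k : \bar R :=
  'E_P[fun w => frobenius2 (zeta k S (Ybar S w))].

Definition gen_leap_exponent :=
  leap_exponent lambda2 (fun S k => in_ambient (tensor_span (Lambda k S))).

(* Information-leap versions: Y h_k is conditioned on Z_S only. *)
Definition izeta k S : 'rV[R]_r -> tensor R k (perp_dim S) :=
  fun x t => cexp P (fun w => w.2 * hermite (Zbar S w) t) (Zpar S) x.

Arguments izeta k S x t : clear implicits.

Definition iLambda k S : tensor R (k + k) (perp_dim S) :=
  fun t => fine 'E_P[fun w =>
    tensor_prod (izeta k S (Zpar S w)) (izeta k S (Zpar S w)) t].

Arguments iLambda k S t : clear implicits.

Definition ilambda2 S k : \bar R :=
  'E_P[fun w => frobenius2 (izeta k S (Zpar S w))].

Definition info_leap_exponent :=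
  leap_exponent ilambda2 (fun S k => in_ambient (tensor_span (iLambda k S))).

(* The law of (Z, f(Z)), which determines [f] only almost everywhere. *)
Definition model (f : 'rV[R]_r -> R) := {ae P, forall w, w.2 = f w.1}.

End exponents.

(* Main.v *)
(* For a proper subspace S, the vector U = Z_{S^perp} is standard Gaussian in dimension m and
   independent of Z_S. If lambda_1(S) = 0, then E[U; B] = 0 for every event B of (Z_S, Y); if
   lambda_2(S) = 0, then E[|U|^2 - m; B] = 0. A positive level enlarges S strictly, so an
   exponent is at most K as soon as some level k <= K is positive at every proper S.
   (i) At S = 0, flipping the sign of a coordinate missing from a monomial shows that Y is
   orthogonal to all polynomials of degree < r. Hence zeta_k = T_k Y and tilde zeta_k = T_k with
   T_k = E[Y h_k(Z)], which vanishes for 1 <= k < r, and T_r spans R^r.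
   (ii) Let i be the first index such that e_i is not in S and v the projection of e_i on S^perp.
   By sign flips, E[sign(Z_1...Z_{i-1}) Y <v, Z>] = |v|^2 E|Z_i| > 0, while
   sign(Z_1...Z_{i-1}) is a function of Z_S; so the first level is positive.
   (iii) Suppose that the first two levels vanish at S, and put b_j = <v_j, Z_S> - alpha_j. As the
   first level vanishes, Y = 1 forces all b_j > 0. On the event that all b_j > 0, compare
   E = {b_j + <v_j, U> > 0 for all j} with T = {b_j |U| + sqrt m <v_j, U> > 0 for all j}: the
   product (1_T - 1_E)(|U|^2 - m) is nonnegative and has integral 0 (for E since the second level
   vanishes, for T by Euler's relation, T being a cone in U), so E = T almost surely. Replacing
   U by U/n, which is in E for n large and is in T exactly when U is, all of {b_j > 0 for all j}
   is in T, and Y is a function of Z_S.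
   (iv) If |Z_S|^2 < N and |Y| > C_N with C_N large, then |U|^2 > m; if the second level vanishes,
   this event is null. So the polynomial q is bounded along S^perp, hence constant along it, and
   Y is a function of Z_S.
   In (iii) and (iv) this contradicts the intrinsic dimension. *)
Require Import Defs.
From HB Require Import structures.
From mathcomp Require Import all_boot all_order all_algebra.
From mathcomp Require Import all_classical all_reals all_analysis.
From mathcomp Require Import measurable_realfun.
From mathcomp Require Import ring lra zify.
From mathcomp Require mpoly.
Set Implicit Arguments.
Unset Strict Implicit.
Unset Printing Implicit Defensive.
Import Order.TTheory GRing.Theory Num.Theory.
Import numFieldNormedType.Exports.
Local Open Scope classical_set_scope.
Local Open Scope ring_scope.

(** [std_gaussian] prescribes the law of Z on boxes only, so its rotation invariance has to be
    proved: a matrix with orthonormal rows is reduced to sign changes, plane reflections and the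
    omission of coordinates, and a plane reflection amounts to two affine substitutions. This yields
    the independence of Z_S and U. The other analytic tool is the density of a dilated Gaussian
    vector with respect to the original one. Bounding its exponential from below by the tangent
    gives Euler's relation without differentiating under an integral. In dimension one that relation
    is the recursion for Gaussian moments, from which Stein's identity and the vanishing means of
    the Hermite tensors of positive order follow. The density also shows that null sets stay null
    when U is replaced by U/n in (iii). Vanishing levels are used through integrals over events of
    the conditioning variable, which is why the test functions in (ii) take finitely many values.
    Square integrability of the zeta_k matters because [fine] would read an infinite expectation in
    Lambda_k as 0. *)

(** * Measurable row vectors and equality of laws *)

Section MeasurableMatrices.
Context d (T : measurableType d).

Lemma measurable_mx_coord d' (E : measurableType d') m n (i : 'I_m) (j : 'I_n) :
  measurable_fun setT (fun A : 'M[E]_(m, n) => A i j).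
Proof.
move=> _ B mB; rewrite setTI; apply: sub_sigma_algebra.
by exists (i, j) => //; exists B => //; rewrite setTI.
Qed.

Lemma measurable_fun_mx d' (E : measurableType d') m n (f : T -> 'M[E]_(m, n)) :
  (forall i j, measurable_fun setT (fun t => f t i j)) -> measurable_fun setT f.
Proof.
move=> mf; apply: (@measurability _ _ _ _ _ _ (@matrix_cylinders _ E m n)) => //.
move=> _ [_ [[i j] _ [B mB <-]] <-].
by rewrite setTI => //; exact: mf.
Qed.

(** These are the sets on which [std_gaussian] prescribes the measure; they form the pi-system
    through which laws of row vectors are compared. *)
Definition rbox (E : Type) n (A : 'I_n -> set E) : set 'rV[E]_n :=
  [set z | forall i, A i (z 0 i)].

Lemma measurable_rbox d' (E : measurableType d') n (A : 'I_n -> set E) :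
  (forall i, measurable (A i)) -> measurable (rbox A).
Proof.
move=> mA; have -> : rbox A = \bigcap_(i in [set: 'I_n]) [set z | A i (z 0 i)].
  by apply/seteqP; split=> z h i; [move=> _; exact: h|exact: h].
apply: fin_bigcap_measurable => // i _.
by rewrite -[X in measurable X]setTI; apply: measurable_mx_coord.
Qed.

(** The generating cylinders are not closed under intersection, whereas boxes are. A cylinder is a
    box with all sides but one equal to the whole space. *)
Lemma measurable_rboxE d' (E : measurableType d') n :
  @measurable _ 'rV[E]_n =
  <<s [set B | exists2 A : 'I_n -> set E, (forall i, measurable (A i)) & B = rbox A] >>.
Proof.
apply/seteqP; split.
- apply: smallest_sub; first exact: smallest_sigma_algebra.
  move=> _ [[i j] _ [C mC <-]]; rewrite setTI; apply: sub_sigma_algebra.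
  exists (fun k => if k == j then C else setT).
    by move=> k; case: ifP.
  apply/seteqP; split=> z /=; rewrite (ord1 i).
    by move=> Cz k; case: eqP => // ->.
  by move=> /(_ j); rewrite eqxx.
- apply: smallest_sub; first exact: sigma_algebra_measurable.
  by move=> _ [A mA ->]; exact: measurable_rbox.
Qed.

Lemma rboxI (E : Type) n (A B : 'I_n -> set E) :
  rbox A `&` rbox B = rbox (fun i => A i `&` B i).
Proof.
by apply/seteqP; split=> z /= => [[h1 h2] i|h]; split => // i; have [] := h i.
Qed.

Lemma rboxT (E : Type) n : rbox (fun _ : 'I_n => [set: E]) = setT.
Proof. by apply/seteqP; split. Qed.

End MeasurableMatrices.

Section Laws.
Context (R : realType) d (T : measurableType d) d' (T' : measurableType d').

(** Uniqueness of measures on a pi-system. [P] and [Q] are general measures because restrictions and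
    multiples of a probability are compared in the proof of independence. *)
Lemma eq_law d1 (E : measurableType d1) (G : set (set E))
    (P : {measure set T -> \bar R}) (Q : {measure set T' -> \bar R})
    (X : T -> E) (Y : T' -> E) :
  @measurable _ E = <<s G >> -> setI_closed G -> G setT ->
  measurable_fun setT X -> measurable_fun setT Y -> (P setT < +oo)%E ->
  (forall A, G A -> P (X @^-1` A) = Q (Y @^-1` A)) ->
  forall B, measurable B -> P (X @^-1` B) = Q (Y @^-1` B).
Proof.
move=> EG GI GT mX mY Pfin PQ B mB.
pose X' : {mfun T >-> E} := mfun_Sub (mem_set mX : X \in mfun).
pose Y' : {mfun T' >-> E} := mfun_Sub (mem_set mY : Y \in mfun).
have := @measure_unique _ R E G (fun=> setT) EG GI (fun=> GT) _
  (pushforward P X') (pushforward Q Y'); apply => //.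
by rewrite bigcup_const.
Qed.

Lemma eq_law_rV d1 (E : measurableType d1) n
    (P : {measure set T -> \bar R}) (Q : {measure set T' -> \bar R})
    (X : T -> 'rV[E]_n) (Y : T' -> 'rV[E]_n) :
  measurable_fun setT X -> measurable_fun setT Y -> (P setT < +oo)%E ->
  (forall A : 'I_n -> set E, (forall i, measurable (A i)) ->
     P (X @^-1` rbox A) = Q (Y @^-1` rbox A)) ->
  forall B, measurable B -> P (X @^-1` B) = Q (Y @^-1` B).
Proof.
move=> mX mY Pfin PQ; apply: (eq_law (measurable_rboxE E n)) => //.
- move=> _ _ [A mA ->] [B mB ->]; rewrite rboxI.
  by exists (fun i => A i `&` B i) => // i; exact: measurableI.
- by exists (fun=> setT) => //; rewrite rboxT.
- by move=> _ [A mA ->]; exact: PQ.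
Qed.

Lemma ge0_eq_law_integral d1 (E : measurableType d1)
    (P : {measure set T -> \bar R}) (Q : {measure set T' -> \bar R})
    (X : T -> E) (Y : T' -> E) :
  measurable_fun setT X -> measurable_fun setT Y ->
  (forall B, measurable B -> P (X @^-1` B) = Q (Y @^-1` B)) ->
  forall f : E -> \bar R, measurable_fun setT f -> (forall x, 0 <= f x)%E ->
  (\int[P]_t f (X t) = \int[Q]_t f (Y t))%E.
Proof.
move=> mX mY PQ f mf f0.
pose X' : {mfun T >-> E} := mfun_Sub (mem_set mX : X \in mfun).
pose Y' : {mfun T' >-> E} := mfun_Sub (mem_set mY : Y \in mfun).
have := @ge0_integral_pushforward _ _ T E R X' mX P setT f measurableT mf.
have := @ge0_integral_pushforward _ _ T' E R Y' mY Q setT f measurableT mf.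
rewrite !preimage_setT /= => <- //; move=> <- //.
by apply: eq_measure_integral => A mA _; exact: PQ.
Qed.

Lemma eq_law_integral d1 (E : measurableType d1)
    (P : {measure set T -> \bar R}) (Q : {measure set T' -> \bar R})
    (X : T -> E) (Y : T' -> E) :
  measurable_fun setT X -> measurable_fun setT Y ->
  (forall B, measurable B -> P (X @^-1` B) = Q (Y @^-1` B)) ->
  forall f : E -> \bar R, measurable_fun setT f ->
  (\int[P]_t f (X t) = \int[Q]_t f (Y t))%E.
Proof.
move=> mX mY PQ f mf; rewrite [LHS]integralE [RHS]integralE.
have hE d0 (S : measurableType d0) (M : {measure set S -> \bar R}) (W : S -> E) :
    (\int[M]_x (fun t => f (W t))^\+ x = \int[M]_x f^\+ (W x))%E *
    (\int[M]_x (fun t => f (W t))^\- x = \int[M]_x f^\- (W x))%E.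
  by split; apply: eq_integral => t _; rewrite ?funeposE ?funenegE.
rewrite !hE (ge0_eq_law_integral mX mY PQ (measurable_funepos mf) (funepos_ge0 f)).
by rewrite (ge0_eq_law_integral mX mY PQ (measurable_funeneg mf) (funeneg_ge0 f)).
Qed.

End Laws.

Lemma in_preimage (U V : Type) (f : U -> V) (A : set V) x :
  (x \in f @^-1` A) = (f x \in A).
Proof. by apply/idP/idP => /set_mem/mem_set. Qed.

(** * Gaussian vectors *)

Section NormalDistribution.
Variable R : realType.
Local Notation leb := (@lebesgue_measure R).
Local Notation N01 := (@normal_prob R 0 1).
Local Notation phi := (@normal_pdf R 0 1).

Lemma normal_pdf01E (x : R) :
  phi x = normal_peak 1 * expR (- x ^+ 2 / 2).
Proof. by rewrite normal_pdfE ?oner_neq0// /normal_fun subr0 expr1n. Qed.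

Lemma normal_pdf01_gt0 (x : R) : 0 < phi x.
Proof. by rewrite normal_pdf01E mulr_gt0 ?expR_gt0// normal_peak_gt0 ?oner_neq0. Qed.

(** The change of variables is stated with the Radon-Nikodym derivative; it agrees with the pdf
    almost everywhere, since both have the same integral over every measurable set. *)
Lemma ge0_integral_normal01 (f : R -> \bar R) :
  measurable_fun setT f -> (forall x, 0 <= f x)%E ->
  (\int[N01]_x f x = \int[leb]_x (f x * (phi x)%:E))%E.
Proof.
move=> mf f0.
have dom := @normal_prob_dominates R 0 1.
rewrite -(Radon_Nikodym_SigmaFinite.change_of_variables dom)//.
have mphi : measurable_fun setT (EFin \o phi).
  by apply/measurable_EFinP; exact: measurable_normal_pdf.
have iRN := Radon_Nikodym_SigmaFinite.f_integrable dom.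
apply: ge0_ae_eq_integral => //.
- apply: emeasurable_funM => //; exact: measurable_int iRN.
- by apply: emeasurable_funM.
- move=> x _; apply: mule_ge0 => //; exact: Radon_Nikodym_SigmaFinite.f_ge0.
- by move=> x _; apply: mule_ge0 => //; rewrite lee_fin ltW// normal_pdf01_gt0.
apply: ae_eqe_mul2l; apply: integral_ae_eq => // E _ mE.
by rewrite -Radon_Nikodym_SigmaFinite.f_integral.
Qed.

(** By uniqueness of Lebesgue measure only half-open intervals have to be checked. For [a < 0] the
    preimage is open at the other end, which leaves its length unchanged. *)
Lemma lebesgue_affine (a b : R) (A : set R) : a != 0 -> measurable A ->
  leb A = (`|a|%:E * leb ((fun x => a * x + b)%R @^-1` A))%E.
Proof.
move=> a0 mA.
have mf : measurable_fun setT (fun x : measurableTypeR R => a * x + b : measurableTypeR R).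
  by apply: measurable_funD => //; exact: measurable_funM.
pose F := @mfun_Sub _ _ (measurableTypeR R) (measurableTypeR R) _ (mem_set mf).
have na : (0 <= `|a|) by [].
rewrite (@lebesgue_measure_unique R (mscale (NngNum na) (pushforward leb F)))//.
move=> _ [[l r] /= lr <-]; rewrite /mscale/= /pushforward.
have [apos|aneg] := ltP 0 a.
  rewrite (_ : F @^-1` _ = `](l - b) / a, (r - b) / a]%classic); last first.
    apply/seteqP; split=> x; rewrite /= /F !in_itv/= ltr_pdivrMr// ler_pdivlMr//;
      by rewrite ltrBlDr lerBrDr mulrC.
  rewrite !lebesgue_measure_itv/= !lte_fin ltr_pM2r ?invr_gt0// ltrD2r.
  case: ifPn => // _; last by rewrite mule0.
  by rewrite -!EFinB -EFinM gtr0_norm//; congr EFin; field.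
have {}aneg : a < 0 by rewrite lt_neqAle a0.
rewrite (_ : F @^-1` _ = `[(r - b) / a, (l - b) / a[%classic); last first.
  apply/seteqP; split=> x; rewrite /= /F !in_itv/= ltr_ndivlMr// ler_ndivrMr//;
    by rewrite ltrBlDr lerBrDr mulrC andbC.
rewrite !lebesgue_measure_itv/= !lte_fin ltr_nM2r ?invr_lt0// ltrD2r.
case: ifPn => // _; last by rewrite mule0.
by rewrite -!EFinB -EFinM ltr0_norm//; congr EFin; field.
Qed.

Lemma ge0_integral_affine (a b : R) (f : R -> \bar R) : a != 0 ->
  measurable_fun setT f -> (forall x, 0 <= f x)%E ->
  (\int[leb]_x f x = `|a|%:E * \int[leb]_x f (a * x + b)%R)%E.
Proof.
move=> a0 mf f0.
have mg : measurable_fun setT (fun x : measurableTypeR R => a * x + b : measurableTypeR R).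
  by apply: measurable_funD => //; exact: measurable_funM.
have na : (0 <= `|a|) by [].
have h := @ge0_eq_law_integral R _ (measurableTypeR R) _ (measurableTypeR R) _
  (measurableTypeR R) leb (mscale (NngNum na) leb) id _ (@measurable_id _ _ _) mg.
rewrite h//; last by move=> B mB; rewrite preimage_id [LHS](lebesgue_affine b a0 mB).
rewrite ge0_integral_mscale//.
exact: measurableT_comp.
Qed.

Lemma normal01_sym (A : set R) : measurable A ->
  N01 ((fun x => - x) @^-1` A) = N01 A.
Proof.
move=> mA; rewrite /normal_prob.
rewrite [RHS]integral_mkcond [LHS]integral_mkcond.
rewrite [RHS](@ge0_integral_affine (-1) 0) ?oppr_eq0 ?oner_neq0//; last 2 first.
- apply/(measurable_restrictT _ mA); apply/measurable_EFinP.
  apply: measurable_funTS; exact: measurable_normal_pdf.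
- by move=> x; apply: erestrict_ge0 => y _; rewrite lee_fin ltW// normal_pdf01_gt0.
rewrite normrN1 mul1e; apply: eq_integral => x _; rewrite !patchE.
rewrite mulN1r addr0 in_preimage /=.
by case: ifP => // _; rewrite !normal_pdf01E sqrrN.
Qed.

(* On the standard normal law, a dilation by [s] has this density. *)
Definition dilation_density (s x : R) : R := s^-1 * expR ((1 - s^-2) * x ^+ 2 / 2).

Lemma measurable_dilation_density (s : R) : measurable_fun setT (dilation_density s).
Proof.
apply: measurable_funM => //; apply: measurableT_comp => //.
by apply: measurable_funM => //; exact: measurable_funM.
Qed.

Lemma dilation_density_gt0 (s x : R) : 0 < s -> 0 < dilation_density s x.
Proof. by move=> s0; rewrite mulr_gt0 ?invr_gt0 ?expR_gt0. Qed.

Lemma normal01_dilation (s : R) (f : R -> \bar R) : 0 < s ->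
  measurable_fun setT f -> (forall x, 0 <= f x)%E ->
  (\int[N01]_x f (s * x)%R = \int[N01]_x (f x * (dilation_density s x)%:E))%E.
Proof.
move=> s0 mf f0.
have md : measurable_fun setT (fun x => (dilation_density s x)%:E).
  by apply/measurable_EFinP; exact: measurable_dilation_density.
have mphi : measurable_fun setT (fun x => (phi x)%:E).
  by apply/measurable_EFinP; exact: measurable_normal_pdf.
have d0 x : (0 <= (dilation_density s x)%:E)%E.
  by rewrite lee_fin ltW// dilation_density_gt0.
have phi0 x : (0 <= (phi x)%:E)%E by rewrite lee_fin ltW// normal_pdf01_gt0.
have msf : measurable_fun setT (fun x => f (s * x)).
  by apply: measurableT_comp => //; exact: measurable_funM.
rewrite !ge0_integral_normal01//; last 2 first.
- exact: emeasurable_funM.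
- by move=> x; exact: mule_ge0.
rewrite [RHS](@ge0_integral_affine s 0) ?gt_eqF//; last 2 first.
- by apply: emeasurable_funM => //; exact: emeasurable_funM.
- by move=> x; rewrite !mule_ge0.
have ms : measurable_fun setT (fun x : R => s * x + 0).
  by apply: measurable_funD => //; exact: measurable_funM.
rewrite -ge0_integralZl//=; last 2 first.
- apply: (@measurableT_comp _ _ _ _ _ _ (fun y => f y * (dilation_density s y)%:E * (phi y)%:E)%E) => //.
  by apply: emeasurable_funM => //; exact: emeasurable_funM.
- by move=> x _; rewrite !mule_ge0.
apply: eq_integral => x _; rewrite addr0 gtr0_norm//.
rewrite -muleA [RHS]muleCA; congr (_ * _)%E; rewrite -!EFinM; congr EFin.
rewrite /dilation_density !normal_pdf01E.
have -> : - x ^+ 2 / 2 = (1 - s ^- 2) * (s * x) ^+ 2 / 2 + - (s * x) ^+ 2 / 2.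
  by field; rewrite lt0r_neq0.
by rewrite expRD; field; rewrite lt0r_neq0.
Qed.

Lemma emule_lreg (k : R) (x y : \bar R) : k != 0 -> (k%:E * x = k%:E * y)%E -> x = y.
Proof.
move=> k0 /(congr1 (fun z => k^-1%:E * z)%E).
by rewrite !muleA -!EFinM mulVf// !mul1e.
Qed.

Lemma double_integralZl (k : R) (G : R * R -> \bar R) : 0 <= k ->
  measurable_fun setT G -> (forall x, 0 <= G x)%E ->
  (\int[leb]_x (k%:E * \int[leb]_y G (x, y)) =
   k%:E * \int[leb]_x \int[leb]_y G (x, y))%E.
Proof.
move=> k0 mG G0; apply: ge0_integralZl.
- exact: measurableT.
- exact: (@measurable_fun_fubini_tonelli_F _ _ (measurableTypeR R) (measurableTypeR R) R leb G).
- by move=> x _; apply: integral_ge0 => y _; exact: G0.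
- by rewrite lee_fin.
Qed.

(* Both substitutions are affine in one variable: [u = c x + s y] at fixed [x],
   then [v = (x - c u) / s] at fixed [u]. *)
Lemma normal01_reflection (c s : R) (f : R * R -> \bar R) :
  s != 0 -> c ^+ 2 + s ^+ 2 = 1 ->
  measurable_fun setT f -> (forall x, 0 <= f x)%E ->
  (\int[N01]_x \int[N01]_y f (c * x + s * y, s * x - c * y)%R =
   \int[N01]_x \int[N01]_y f (x, y))%E.
Proof.
move=> s0 cs mf f0.
have phi0 x : (0 <= (phi x)%:E)%E by rewrite lee_fin ltW// normal_pdf01_gt0.
have mphi : measurable_fun setT (fun x => (phi x)%:E).
  by apply/measurable_EFinP; exact: measurable_normal_pdf.
have dbl (g : R * R -> \bar R) : measurable_fun setT g -> (forall x, 0 <= g x)%E ->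
    (\int[N01]_x \int[N01]_y g (x, y) =
     \int[leb]_x \int[leb]_y (g (x, y) * (phi y)%:E * (phi x)%:E))%E.
  move=> mg g0.
  have mgx x : measurable_fun setT (fun y => g (x, y)).
    by apply: measurableT_comp => //; exact: pair1_measurable.
  rewrite ge0_integral_normal01; last 2 first.
  - exact: (@measurable_fun_fubini_tonelli_F _ _ (measurableTypeR R) (measurableTypeR R) R N01 g).
  - by move=> x; exact: integral_ge0.
  apply: eq_integral => x _; rewrite ge0_integral_normal01// -ge0_integralZr//.
  - by apply: emeasurable_funM; [exact: mgx|exact: mphi].
  - by move=> y _; exact: mule_ge0.
have mlin : measurable_fun setT (fun p : R * R => (c * p.1 + s * p.2, s * p.1 - c * p.2)).
  apply: measurable_fun_pair; first by apply: measurable_funD; apply: measurable_funM.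
  by apply: measurable_funB; apply: measurable_funM.
apply: etrans (dbl (fun p => f (c * p.1 + s * p.2, s * p.1 - c * p.2))%R _ _) _ => //.
  exact: measurableT_comp.
apply/esym; apply: etrans (dbl f mf f0) _; rewrite /=.
(* [H] is the integrand in the mixed variables [(x, u)]. Integrating first over [u] or first over
   [x] gives the two sides of the claim, each with the same factor [|s|]. *)
have [H HE] : exists H : R * R -> \bar R, forall p, H p =
    (f (p.2, (p.1 - c * p.2) / s)%R * (phi ((p.2 - c * p.1) / s))%:E * (phi p.1)%:E)%E.
  by eexists.
have H0 p : (0 <= H p)%E by rewrite HE !mule_ge0.
have mH : measurable_fun setT H.
  rewrite (funext HE).
  apply: emeasurable_funM; last exact: (measurableT_comp mphi measurable_fst).
  apply: emeasurable_funM.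
    apply: measurableT_comp => //; apply: measurable_fun_pair => //.
    by apply: measurable_funM => //; apply: measurable_funB => //; exact: measurable_funM.
  apply: (measurableT_comp mphi); apply: measurable_funM => //.
  by apply: measurable_funB => //; exact: measurable_funM.
have mHx x : measurable_fun setT (fun y => H (x, y)).
  by apply: measurableT_comp => //; exact: pair1_measurable.
have mHy y : measurable_fun setT (fun x => H (x, y)).
  by apply: (measurableT_comp mH); exact: pair2_measurable.
have swap := @fubini_tonelli _ _ (measurableTypeR R) (measurableTypeR R) R leb leb H mH H0.
have E1 : (\int[leb]_x \int[leb]_y H (x, y) = `|s|%:E * \int[leb]_x \int[leb]_y
    (f (c * x + s * y, s * x - c * y)%R * (phi y)%:E * (phi x)%:E))%E.
  pose G (p : R * R) :=
    (f (c * p.1 + s * p.2, s * p.1 - c * p.2)%R * (phi p.2)%:E * (phi p.1)%:E)%E.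
  have G0 p : (0 <= G p)%E by rewrite /G !mule_ge0.
  have mG : measurable_fun setT G.
    apply: emeasurable_funM; last exact: (measurableT_comp mphi measurable_fst).
    by apply: emeasurable_funM; [exact: measurableT_comp|exact: (measurableT_comp mphi measurable_snd)].
  apply: etrans (double_integralZl (normr_ge0 s) mG G0).
  apply: eq_integral => x _.
  apply: etrans (ge0_integral_affine (c * x) s0 (mHx x) (fun y => H0 (x, y))) _.
  apply: (congr1 (fun z => `|s|%:E * z)%E).
  apply: eq_integral => y _; rewrite HE/=.
  have -> : s * y + c * x = c * x + s * y by rewrite addrC.
  have -> : (c * x + s * y - c * x) / s = y by field.
  have -> // : (x - c * (c * x + s * y)) / s = s * x - c * y.
  have -> : x - c * (c * x + s * y) = x * (c ^+ 2 + s ^+ 2) - c * (c * x + s * y).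
    by rewrite cs mulr1.
  by field.
have E2 : (\int[leb]_y \int[leb]_x H (x, y) = `|s|%:E * \int[leb]_x \int[leb]_y
    (f (x, y) * (phi y)%:E * (phi x)%:E))%E.
  pose G (p : R * R) := (f (p.1, p.2) * (phi p.2)%:E * (phi p.1)%:E)%E.
  have G0 p : (0 <= G p)%E by rewrite /G !mule_ge0.
  have mG : measurable_fun setT G.
    apply: emeasurable_funM; last exact: (measurableT_comp mphi measurable_fst).
    apply: emeasurable_funM; last exact: (measurableT_comp mphi measurable_snd).
    by apply: measurableT_comp => //; apply: measurable_fun_pair.
  apply: etrans (double_integralZl (normr_ge0 s) mG G0).
  apply: eq_integral => u _.
  apply: etrans (ge0_integral_affine (c * u) s0 (mHy u) (fun y => H0 (y, u))) _.
  apply: (congr1 (fun z => `|s|%:E * z)%E).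
  apply: eq_integral => v _; rewrite HE /G/=.
  have -> : (s * v + c * u - c * u) / s = v by field.
  rewrite -!muleA; congr (_ * _)%E; rewrite -!EFinM; congr EFin.
  rewrite !normal_pdf01E.
  have -> : (u - c * (s * v + c * u)) / s = s * u - c * v.
    have -> : u - c * (s * v + c * u) = u * (c ^+ 2 + s ^+ 2) - c * (s * v + c * u).
      by rewrite cs mulr1.
    by field.
  rewrite mulrACA -expRD [RHS]mulrACA -expRD; congr (_ * expR _).
  have -> : - (s * u - c * v) ^+ 2 / 2 + - (s * v + c * u) ^+ 2 / 2 =
    - ((c ^+ 2 + s ^+ 2) * (u ^+ 2 + v ^+ 2)) / 2 by field.
  by rewrite cs; field.
apply: (@emule_lreg `|s|); first by rewrite normr_eq0.
exact: etrans (esym E2) (etrans (esym swap) E1).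
Qed.

End NormalDistribution.

Section Independence.
Context (R : realType) d (T : measurableType d) (P : probability T R).

Lemma probability_lty (A : set T) : measurable A -> (P A < +oo)%E.
Proof. by move=> mA; rewrite (le_lt_trans (probability_le1 _ mA))// ltry. Qed.

Lemma measurable_preimage d' (E : measurableType d') (X : T -> E) B :
  measurable_fun setT X -> measurable B -> measurable (X @^-1` B).
Proof. by move=> mX mB; rewrite -[X in measurable X]setTI; exact: mX. Qed.

(** With one event fixed, both sides are finite measures in the other: the restriction of [P] to the
    fixed event, and the multiple of [P] by its probability. So [eq_law] extends the product rule,
    first in [A] and then in [B]. *)
Lemma independent_gen d1 d2 (E1 : measurableType d1) (E2 : measurableType d2)
    (G1 : set (set E1)) (G2 : set (set E2)) (X1 : T -> E1) (X2 : T -> E2) :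
  measurable = <<s G1 >> -> measurable = <<s G2 >> ->
  setI_closed G1 -> setI_closed G2 -> G1 setT -> G2 setT ->
  measurable_fun setT X1 -> measurable_fun setT X2 ->
  (forall A B, G1 A -> G2 B ->
    P (X1 @^-1` A `&` X2 @^-1` B) = (P (X1 @^-1` A) * P (X2 @^-1` B))%E) ->
  independent P X1 X2.
Proof.
move=> EG1 EG2 G1I G2I G1T G2T mX1 mX2 PG.
have sc D (mD : measurable D) (A : set T) :
    mscale (NngNum (fine_ge0 (measure_ge0 P D))) P A = (P D * P A)%E.
  by rewrite /mscale/= fineK// ge0_fin_numE// probability_lty.
have mG1 A : G1 A -> measurable A by move=> GA; rewrite EG1; exact: sub_sigma_algebra.
have mG2 A : G2 A -> measurable A by move=> GA; rewrite EG2; exact: sub_sigma_algebra.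
have step1 A B : measurable A -> G2 B ->
    P (X1 @^-1` A `&` X2 @^-1` B) = (P (X1 @^-1` A) * P (X2 @^-1` B))%E.
  move=> mA GB; have mD := measurable_preimage mX2 (mG2 _ GB).
  rewrite muleC -(sc _ mD).
  apply: (eq_law (P := mrestr P mD) EG1) => //.
    by apply: probability_lty; exact: measurableI.
  by move=> A' GA'; apply: etrans (esym (sc _ mD _)); rewrite muleC; exact: PG.
move=> A B mA mB; have mD := measurable_preimage mX1 mA.
rewrite -(sc _ mD) setIC.
apply: (eq_law (P := mrestr P mD) EG2) => //.
  by apply: probability_lty; exact: measurableI.
by move=> B' GB'; apply: etrans (esym (sc _ mD _)); apply: etrans (step1 _ _ mA GB');
  exact: congr1 (setIC _ _).
Qed.

Lemma independent_rV d1 d2 (E1 : measurableType d1) (E2 : measurableType d2) m n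
    (X1 : T -> 'rV[E1]_m) (X2 : T -> 'rV[E2]_n) :
  measurable_fun setT X1 -> measurable_fun setT X2 ->
  (forall A B, (forall i, measurable (A i)) -> (forall i, measurable (B i)) ->
    P (X1 @^-1` rbox A `&` X2 @^-1` rbox B) =
    (P (X1 @^-1` rbox A) * P (X2 @^-1` rbox B))%E) ->
  independent P X1 X2.
Proof.
move=> mX1 mX2 H.
have GI d' (E : measurableType d') k : setI_closed
    [set B | exists2 A : 'I_k -> set E, (forall i, measurable (A i)) & B = rbox A].
  move=> _ _ [A mA ->] [B mB ->]; rewrite rboxI.
  by exists (fun i => A i `&` B i) => // i; exact: measurableI.
have GT d' (E : measurableType d') k :
    [set B | exists2 A : 'I_k -> set E, (forall i, measurable (A i)) & B = rbox A] setT.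
  by exists (fun=> setT) => //; rewrite rboxT.
apply: (independent_gen (measurable_rboxE _ _) (measurable_rboxE _ _)) => //;
  [exact: GI|exact: GI|].
by move=> _ _ [A mA ->] [B mB ->]; exact: H.
Qed.

Lemma independent_comp d1 d2 d3 d4 (E1 : measurableType d1) (E2 : measurableType d2)
    (F1 : measurableType d3) (F2 : measurableType d4)
    (X1 : T -> E1) (X2 : T -> E2) (f : E1 -> F1) (g : E2 -> F2) :
  measurable_fun setT f -> measurable_fun setT g -> independent P X1 X2 ->
  independent P (f \o X1) (g \o X2).
Proof.
by move=> mf mg h A B mA mB; apply: (h (f @^-1` A) (g @^-1` B));
  rewrite -[X in measurable X]setTI; [exact: mf|exact: mg].
Qed.

(** Independence says that [(X1, X2)] has under [P] the same law as [(X1 p.1, X2 p.2)] under the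
    product measure, where Tonelli applies. *)
Lemma ge0_integral_independent d1 d2 (E1 : measurableType d1) (E2 : measurableType d2)
    (X1 : T -> E1) (X2 : T -> E2) (f : E1 * E2 -> \bar R) :
  measurable_fun setT X1 -> measurable_fun setT X2 -> independent P X1 X2 ->
  measurable_fun setT f -> (forall x, 0 <= f x)%E ->
  (\int[P]_t f (X1 t, X2 t) = \int[P]_t \int[P]_s f (X1 t, X2 s))%E.
Proof.
move=> mX1 mX2 ind mf f0.
have mX : measurable_fun setT (fun t => (X1 t, X2 t)) by exact: measurable_fun_pair.
have mY : measurable_fun setT (fun p : T * T => (X1 p.1, X2 p.2)).
  by apply: measurable_fun_pair; apply: measurableT_comp.
rewrite (@ge0_eq_law_integral R _ T _ (T * T)%type _ _ P (P \x P)%E _ _ mX mY)//.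
  rewrite fubini_tonelli1//; exact: (measurableT_comp mf mY).
apply: (eq_law (measurable_prod_measurableType E1 E2)) => //.
- move=> _ _ [A mA [B mB <-]] [A' mA' [B' mB' <-]].
  exists (A `&` A'); first exact: measurableI.
  by exists (B `&` B'); [exact: measurableI|rewrite setXI].
- by exists setT => //; exists setT => //; rewrite setXTT.
- exact: probability_lty.
move=> _ [A mA [B mB <-]].
rewrite (_ : _ @^-1` _ = X1 @^-1` A `&` X2 @^-1` B)//.
rewrite (_ : (fun p => _) @^-1` _ = (X1 @^-1` A) `*` (X2 @^-1` B))//.
apply: etrans (ind _ _ mA mB) _; apply/esym/product_measure1E;
  exact: measurable_preimage.
Qed.

End Independence.

Section GaussianVectors.
Context (R : realType) d (T : measurableType d) (P : probability T R).
Local Notation N01 := (@normal_prob R 0 1).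

Definition gaussian_vec n (X : T -> 'rV[R]_n) :=
  measurable_fun setT X /\ std_gaussian (pushforward P X).

Lemma gaussian_vec_box n (X : T -> 'rV[R]_n) (A : 'I_n -> set R) :
  gaussian_vec X -> (forall i, measurable (A i)) ->
  P (X @^-1` rbox A) = (\prod_(i < n) fine (N01 (A i)))%:E.
Proof. by move=> [_ h] mA; rewrite -h. Qed.

Lemma gaussian_vec_sub n m (X : T -> 'rV[R]_n) (h : 'I_m -> 'I_n) :
  injective h -> gaussian_vec X -> gaussian_vec (fun t => \row_j X t 0 (h j)).
Proof.
move=> hI gX; split.
  apply: measurable_fun_mx => i j; under eq_fun do rewrite mxE.
  exact: (measurableT_comp (measurable_mx_coord _ _) gX.1).
move=> A mA; rewrite /pushforward.
(* The constraint on coordinate [i] of [X]: the side [A j] if [i = h j], and the whole line if [i]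
   is not a value of [h]. *)
pose B i : set R := [set x | forall j, h j = i -> A j x].
have BE j : B (h j) = A j.
  apply/seteqP; split => [x|x Ax k /hI ->//]; exact.
have BT i : (forall j, h j != i) -> B i = setT.
  by move=> hi; apply/seteqP; split => // x _ j /eqP; rewrite (negbTE (hi j)).
have mB i : measurable (B i).
  have [[j <-]|nj] := pselect (exists j, h j = i); first by rewrite BE; exact: mA.
  by rewrite BT// => j; apply/eqP => hj; apply: nj; exists j.
rewrite (_ : _ @^-1` _ = X @^-1` rbox B); last first.
  apply/seteqP; split=> t /= H.
    by move=> i j hj; have := H j; rewrite mxE hj.
  by move=> j; rewrite mxE -BE; exact: H.
rewrite gaussian_vec_box//; congr EFin.
rewrite (bigID [pred i | i \in codom h])/= [X in _ * X]big1 ?mulr1; last first.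
  move=> i hi; rewrite BT ?probability_setT// => j.
  by apply: contra hi => /eqP <-; exact: codom_f.
rewrite (reindex_omap h (fun i => [pick j | h j == i])) /=; last first.
  move=> i /codomP[j ->]; case: pickP => [k /eqP hk/=|/(_ j)]; last by rewrite eqxx.
  by rewrite hk.
apply: eq_big => [j|j _]; last by rewrite BE.
rewrite codom_f/=; case: pickP => [k /eqP/hI ->|/(_ j)]; by rewrite eqxx.
Qed.

Lemma gaussian_vec_lsub n m (X : T -> 'rV[R]_(n + m)) :
  gaussian_vec X -> gaussian_vec (fun t => lsubmx (X t)).
Proof.
move=> /(gaussian_vec_sub (@lshift_inj n m)); congr gaussian_vec.
by apply/funext => t; apply/rowP => j; rewrite !mxE.
Qed.

Lemma gaussian_vec_rsub n m (X : T -> 'rV[R]_(n + m)) :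
  gaussian_vec X -> gaussian_vec (fun t => rsubmx (X t)).
Proof.
move=> /(gaussian_vec_sub (@rshift_inj n m)); congr gaussian_vec.
by apply/funext => t; apply/rowP => j; rewrite !mxE.
Qed.

Lemma gaussian_vec_split n m (X : T -> 'rV[R]_(n + m)) :
  gaussian_vec X -> independent P (fun t => lsubmx (X t)) (fun t => rsubmx (X t)).
Proof.
move=> gX; have gl := gaussian_vec_lsub gX; have gr := gaussian_vec_rsub gX.
apply: independent_rV => [||A B mA mB]; [exact: gl.1|exact: gr.1|].
rewrite !gaussian_vec_box//.
pose C i := match fintype.split i with inl j => A j | inr j => B j end.
rewrite (_ : _ `&` _ = X @^-1` rbox C); last first.
  apply/seteqP; split=> t /= => [[H1 H2] i|H].
    rewrite /C; case: split_ordP => j ->; first by have := H1 j; rewrite mxE.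
    by have := H2 j; rewrite mxE.
  split=> j; rewrite mxE.
    by have := H (lshift m j); rewrite /C (unsplitK (inl j : 'I_n + 'I_m)).
  by have := H (rshift n j); rewrite /C (unsplitK (inr j : 'I_n + 'I_m)).
rewrite gaussian_vec_box//; last by move=> i; rewrite /C; case: fintype.split.
rewrite -EFinM; congr EFin; rewrite big_split_ord/=; congr (_ * _).
  by apply: eq_bigr => j _; rewrite /C (unsplitK (inl j : 'I_n + 'I_m)).
by apply: eq_bigr => j _; rewrite /C (unsplitK (inr j : 'I_n + 'I_m)).
Qed.

Lemma measurable_row_mx n m (X : T -> 'rV[R]_n) (Y : T -> 'rV[R]_m) :
  measurable_fun setT X -> measurable_fun setT Y ->
  measurable_fun setT (fun t => row_mx (X t) (Y t)).
Proof.
move=> mX mY; apply: measurable_fun_mx => i j.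
case: (split_ordP j) => k ->.
  under eq_fun do rewrite row_mxEl; exact: (measurableT_comp (measurable_mx_coord _ _) mX).
under eq_fun do rewrite row_mxEr; exact: (measurableT_comp (measurable_mx_coord _ _) mY).
Qed.

Lemma gaussian_vec_row_mx n m (X : T -> 'rV[R]_n) (Y : T -> 'rV[R]_m) :
  gaussian_vec X -> gaussian_vec Y -> independent P X Y ->
  gaussian_vec (fun t => row_mx (X t) (Y t)).
Proof.
move=> gX gY ind; split; first by apply: measurable_row_mx; [exact: gX.1|exact: gY.1].
move=> A mA; rewrite /pushforward big_split_ord/= EFinM.
rewrite -(gaussian_vec_box (A := fun j => A (lshift m j)) gX); last by move=> j; exact: mA.
rewrite -(gaussian_vec_box (A := fun j => A (rshift n j)) gY); last by move=> j; exact: mA.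
rewrite -ind; [|by apply: measurable_rbox => ?; exact: mA..].
congr (P _); apply/seteqP; split=> t /= => [H|[H1 H2] i].
  by split=> j; [have := H (lshift m j); rewrite row_mxEl|have := H (rshift n j); rewrite row_mxEr].
by case: (split_ordP i) => j ->; [rewrite row_mxEl; exact: H1|rewrite row_mxEr; exact: H2].
Qed.

Lemma gaussian_vec_coord n (X : T -> 'rV[R]_n) i (B : set R) :
  gaussian_vec X -> measurable B -> P ((fun t => X t 0 i) @^-1` B) = N01 B.
Proof.
move=> gX mB.
have := gaussian_vec_box (gaussian_vec_sub (h := fun _ : 'I_1 => i) _ gX) (A := fun=> B).
rewrite big_ord1 fineK ?ge0_fin_numE ?probability_lty//.
move=> <- //; last by move=> j k _; rewrite (ord1 j) (ord1 k).
congr (P _); apply/seteqP; split => t /= H; first by move=> j; rewrite mxE.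
by have := H ord0; rewrite mxE.
Qed.

Lemma ge0_integral_coord n (X : T -> 'rV[R]_n) i (f : R -> \bar R) :
  gaussian_vec X -> measurable_fun setT f -> (forall x, 0 <= f x)%E ->
  (\int[P]_t f (X t 0%R i) = \int[N01]_x f x)%E.
Proof.
move=> gX mf f0.
have mXi : measurable_fun setT (fun t => X t 0 i).
  exact: (measurableT_comp (measurable_mx_coord _ _) gX.1).
apply: (@ge0_eq_law_integral R _ T _ (measurableTypeR R) _ (measurableTypeR R) P N01
  (fun t => X t 0 i) id) => // B mB.
exact: gaussian_vec_coord.
Qed.

End GaussianVectors.

Lemma measurable_mulmx (R : realType) d (T : measurableType d) n p (X : T -> 'rV[R]_n) (A : 'M[R]_(n, p)) :
  measurable_fun setT X -> measurable_fun setT (fun t => X t *m A).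
Proof.
move=> mX; apply: measurable_fun_mx => i j; under eq_fun do rewrite mxE.
apply: measurable_sum => k; apply: measurable_funM => //.
exact: (measurableT_comp (measurable_mx_coord _ _) mX).
Qed.

(** * Rotation invariance of the standard Gaussian law *)

Section Orthonormal.
Context (R : realType) d (T : measurableType d) (P : probability T R).
Local Notation N01 := (@normal_prob R 0 1).

(** A box is not carried to a box by a rotation, so invariance cannot be read off [std_gaussian].
    This property is stable under products and diagonal blocks, which lets it spread from sign
    changes, plane reflections and empty matrices. *)
Definition preserves_gaussian p n (O : 'M[R]_(p, n)) :=
  forall X : T -> 'rV[R]_n, gaussian_vec P X -> gaussian_vec P (fun t => X t *m O^T).

Lemma preserves_gaussian1 n : preserves_gaussian (1%:M : 'M[R]_n).
Proof. by move=> X; congr gaussian_vec; apply/funext => t; rewrite trmx1 mulmx1. Qed.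

Lemma preserves_gaussianM p q n (A : 'M[R]_(p, q)) (B : 'M[R]_(q, n)) :
  preserves_gaussian A -> preserves_gaussian B -> preserves_gaussian (A *m B).
Proof.
move=> gA gB X /gB/gA; congr gaussian_vec.
by apply/funext => t; rewrite trmx_mul mulmxA.
Qed.

Lemma preserves_gaussian_block p1 n1 p2 n2 (A : 'M[R]_(p1, n1)) (B : 'M[R]_(p2, n2)) :
  preserves_gaussian A -> preserves_gaussian B -> preserves_gaussian (block_mx A 0 0 B).
Proof.
move=> gA gB X gX.
have gl := gaussian_vec_lsub gX; have gr := gaussian_vec_rsub gX.
have ind := gaussian_vec_split gX.
have -> : (fun t => X t *m (block_mx A 0 0 B)^T) =
    (fun t => row_mx (lsubmx (X t) *m A^T) (rsubmx (X t) *m B^T)).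
  apply/funext => t; rewrite -[X t in LHS]hsubmxK tr_block_mx !trmx0.
  by rewrite mul_row_block !mulmx0 addr0 add0r.
apply: gaussian_vec_row_mx; [exact: gA|exact: gB|].
have mm n p (D : 'M[R]_(n, p)) : measurable_fun setT (fun x : 'rV[R]_n => x *m D).
  exact: (measurable_mulmx D (@measurable_id _ _ setT)).
exact: (independent_comp (mm _ _ A^T) (mm _ _ B^T) ind).
Qed.

(** The base case of the induction on the number of rows; as a diagonal block, an empty matrix omits
    the remaining coordinates. *)
Lemma preserves_gaussian_empty n (O : 'M[R]_(0, n)) : preserves_gaussian O.
Proof.
move=> X gX; split; first exact: measurable_mulmx gX.1.
move=> A mA; rewrite big_ord0 /pushforward (_ : _ @^-1` _ = setT) ?probability_setT//.
by apply/seteqP; split => // t _ [].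
Qed.

Lemma preserves_gaussian_opp : preserves_gaussian (-1%:M : 'M[R]_1).
Proof.
move=> X gX; split; first exact: measurable_mulmx gX.1.
move=> A mA; rewrite /pushforward big_ord1.
rewrite -(normal01_sym (mA ord0)) -(gaussian_vec_coord ord0 gX); last first.
  rewrite -[X in measurable X]setTI.
  exact: oppr_measurable (mA ord0).
rewrite fineK; last first.
  rewrite ge0_fin_numE// probability_lty//.
  apply: (@measurable_preimage _ _ _ (measurableTypeR R) (fun t => X t 0 ord0)).
    exact: (measurableT_comp (measurable_mx_coord _ _) gX.1).
  rewrite -[X in measurable X]setTI.
  exact: oppr_measurable (mA ord0).
congr (P _); apply/seteqP; split=> t /=; rewrite linearN/= trmx1 mulmxN mulmx1.
  by move=> /(_ ord0); rewrite mxE.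
by move=> h i; rewrite (ord1 i) mxE.
Qed.

(** The two coordinates are independent, so box probabilities become double integrals against the
    normal law, and [normal01_reflection] compares these. *)
Lemma preserves_gaussian_reflection (c s : R) : s != 0 -> c ^+ 2 + s ^+ 2 = 1 ->
  preserves_gaussian (block_mx c%:M s%:M s%:M (- c)%:M : 'M[R]_(1 + 1)).
Proof.
move=> s0 cs X gX; split; first exact: measurable_mulmx gX.1.
move=> A mA; rewrite /pushforward.
pose A1 := A (lshift 1 ord0); pose A2 := A (rshift 1 ord0).
pose x t := X t 0 (lshift 1 ord0); pose y t := X t 0 (rshift 1 ord0).
have mx : measurable_fun setT x.
  exact: (measurableT_comp (measurable_mx_coord _ _) gX.1).
have my : measurable_fun setT y.
  exact: (measurableT_comp (measurable_mx_coord _ _) gX.1).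
have ind : independent P x y.
  have := independent_comp (measurable_mx_coord 0 0) (measurable_mx_coord 0 0) (gaussian_vec_split gX).
  congr independent; apply/funext => t; by rewrite /= /x /y !mxE.
pose g (p : R * R) : \bar R := (\1_A1 p.1 * \1_A2 p.2)%:E.
have mg : measurable_fun setT g.
  apply/measurable_EFinP; apply: measurable_funM; apply: measurableT_comp => //;
    apply: measurable_indic; exact: mA.
have g0 p : (0 <= g p)%E by rewrite lee_fin mulr_ge0.
pose f (p : R * R) := g (c * p.1 + s * p.2, s * p.1 - c * p.2).
have mf : measurable_fun setT f.
  apply: measurableT_comp => //; apply: measurable_fun_pair.
    by apply: measurable_funD; exact: measurable_funM.
  by apply: measurable_funB; exact: measurable_funM.
have f0 p : (0 <= f p)%E by exact: g0.
have law h : measurable_fun setT h -> (forall p : R * R, 0 <= h p)%E ->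
    (\int[P]_t h (x t, y t) = \int[N01]_u \int[N01]_v h (u, v))%E.
  move=> mh h0; rewrite (ge0_integral_independent mx my ind mh h0).
  transitivity (\int[P]_t \int[N01]_v h (x t, v))%E.
    apply: eq_integral => t _.
    apply: (ge0_integral_coord _ gX (f := fun v => h (x t, v))) => //.
    by apply: measurableT_comp => //; exact: pair1_measurable.
  apply: (ge0_integral_coord _ gX (f := fun u => \int[N01]_v h (u, v))%E).
    exact: (@measurable_fun_fubini_tonelli_F _ _ (measurableTypeR R) (measurableTypeR R) R N01 h).
  by move=> u; apply: integral_ge0 => v _; exact: h0.
have box (Y : T -> 'rV[R]_(1 + 1)) : measurable_fun setT Y ->
    P (Y @^-1` rbox A) = (\int[P]_t g (Y t 0%R (lshift 1 ord0), Y t 0%R (rshift 1 ord0)))%E.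
  move=> mY; have mD := measurable_preimage mY (measurable_rbox (fun i => mA i)).
  rewrite -[Y @^-1` _]setIT -integral_indic//; apply: eq_integral => t _.
  congr EFin; rewrite /g/= !indicE -natrM mulnb; congr (_%:R); congr nat_of_bool.
  apply/idP/idP => [/set_mem H|/andP[/set_mem H1 /set_mem H2]].
    by apply/andP; split; apply/mem_set; exact: H.
  by apply/mem_set => i; case: (split_ordP i) => j ->; rewrite (ord1 j).
rewrite -(gaussian_vec_box gX mA) box; last exact: measurable_mulmx gX.1.
rewrite box; last exact: gX.1.
apply: etrans (etrans (law f mf f0) _); last first.
  apply: etrans (normal01_reflection s0 cs mg g0) (esym (law g mg g0)).
apply: eq_integral => t _; congr g; congr pair.
  rewrite tr_block_mx !tr_scalar_mx -[X t in LHS]hsubmxK mul_row_block row_mxEl.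
  by rewrite !mul_mx_scalar !mxE.
rewrite tr_block_mx !tr_scalar_mx -[X t in LHS]hsubmxK mul_row_block row_mxEr.
by rewrite !mul_mx_scalar !mxE mulNr.
Qed.

Lemma mx11_mul_tr (a : 'M[R]_1) : a *m a^T = (a 0 0 ^+ 2)%:M.
Proof. by apply/matrixP => i j; rewrite !ord1 !mxE big_ord1 !mxE eqxx mulr1n expr2. Qed.

Lemma row_mul_tr n (w : 'rV[R]_n) : w *m w^T = (\sum_j w 0 j ^+ 2)%:M.
Proof.
apply/matrixP => i j; rewrite !ord1 !mxE eqxx mulr1n.
by apply: eq_bigr => k _; rewrite !mxE expr2.
Qed.

Lemma unit_mx11_to_1 (a : 'M[R]_1) : a *m a^T = 1%:M ->
  exists G : 'M[R]_1, [/\ preserves_gaussian G, G *m G^T = 1%:M & a *m G^T = 1%:M].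
Proof.
move=> aa; have : (a 0 0) ^+ 2 == 1.
  by rewrite mx11_mul_tr in aa; move/matrixP/(_ 0 0): aa; rewrite !mxE eqxx !mulr1n => ->.
rewrite sqrf_eq1 => /orP[] /eqP a1.
  exists 1%:M; split; [exact: preserves_gaussian1|by rewrite trmx1 mulmx1|].
  by rewrite trmx1 mulmx1 [LHS]mx11_scalar a1.
exists (- 1%:M); split; [exact: preserves_gaussian_opp| |].
  by rewrite linearN/= trmx1 mulNmx mulmxN mulmx1 opprK.
by rewrite linearN/= trmx1 mulmxN mulmx1 [a]mx11_scalar a1 raddfN opprK.
Qed.

Lemma orthonormal_block p1 n1 p2 n2 (A : 'M[R]_(p1, n1)) (B : 'M[R]_(p2, n2)) :
  A *m A^T = 1%:M -> B *m B^T = 1%:M ->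
  block_mx A 0 0 B *m (block_mx A 0 0 B)^T = 1%:M.
Proof.
move=> AA BB; rewrite tr_block_mx !trmx0 mulmx_block !mulmx0 !mul0mx AA BB.
by rewrite !addr0 add0r -scalar_mx_block.
Qed.

Lemma row_mul_block_tr p1 n1 p2 n2 (u : 'rV[R]_n1) (A : 'M[R]_(p1, n1)) (B : 'M[R]_(p2, n2)) :
  row_mx u 0 *m (block_mx A 0 0 B)^T = row_mx (u *m A^T) 0.
Proof. by rewrite tr_block_mx !trmx0 mul_row_block !mulmx0 !mul0mx !addr0. Qed.

(** By induction the tail of [w] is turned onto its first axis, where it becomes its norm [b]; a
    plane reflection of the first two coordinates then sends [(a, b)] to [(1, 0)]. *)
Lemma orthonormal_to_delta n (w : 'rV[R]_(1 + n)) : w *m w^T = 1%:M ->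
  exists G : 'M[R]_(1 + n), [/\ preserves_gaussian G, G *m G^T = 1%:M &
    w *m G^T = row_mx 1%:M 0].
Proof.
elim: n w => [|n IH] w; rewrite -[w]hsubmxK.
  move: (lsubmx w) (rsubmx w) => a w'.
  rewrite (_ : w' = 0); last by rewrite [LHS]thinmx0.
  rewrite tr_row_mx mul_row_col mul0mx addr0 => /unit_mx11_to_1[G1 [gG GG aG]].
  exists (block_mx G1 0 0 1%:M); split.
  - exact: preserves_gaussian_block gG (@preserves_gaussian1 _).
  - by apply: orthonormal_block => //; rewrite trmx1 mulmx1.
  - by rewrite tr_block_mx !trmx0 mul_row_block !mulmx0 !mul0mx aG !addr0.
move: (lsubmx w) (rsubmx w) => a w'.
rewrite tr_row_mx mul_row_col => ww.
(* The plane reflection used below needs a nonzero off-diagonal entry. If the tail vanishes, the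
   head is 1 or -1 and a sign change is enough. *)
have [w0|w0] := eqVneq w' 0.
  move: ww; rewrite w0 mul0mx addr0 => /unit_mx11_to_1[G1 [gG GG aG]].
  exists (block_mx G1 0 0 1%:M); split.
  - exact: preserves_gaussian_block gG (@preserves_gaussian1 _).
  - by apply: orthonormal_block => //; rewrite trmx1 mulmx1.
  - by rewrite tr_block_mx !trmx0 mul_row_block !mulmx0 !mul0mx aG !addr0.
pose b := Num.sqrt (\sum_j w' 0 j ^+ 2).
have s0 : 0 < \sum_j w' 0 j ^+ 2.
  rewrite lt_neqAle sumr_ge0 ?andbT; last by move=> j _; exact: sqr_ge0.
  apply: contra w0; rewrite eq_sym psumr_eq0; last by move=> j _; exact: sqr_ge0.
  move=> /allP h; apply/eqP/rowP => j; rewrite [RHS]mxE.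
  by apply/eqP; rewrite -sqrf_eq0; apply: h; exact: mem_index_enum.
have b0 : 0 < b by rewrite sqrtr_gt0.
have bb : w' *m w'^T = (b ^+ 2)%:M by rewrite row_mul_tr sqr_sqrtr// ltW.
have [G' [gG' GG' wG']] : exists G : 'M[R]_(1 + n), [/\ preserves_gaussian G, G *m G^T = 1%:M &
    (b^-1 *: w') *m G^T = row_mx 1%:M 0].
  apply: IH; rewrite linearZ/= -scalemxAl -scalemxAr scalerA bb scale_scalar_mx.
  by rewrite -invfM -expr2 mulVf// expf_neq0// gt_eqF.
have ab : a 0 0 ^+ 2 + b ^+ 2 = 1.
  move: ww; rewrite mx11_mul_tr bb -raddfD => /matrixP/(_ 0 0).
  by rewrite !mxE eqxx !mulr1n.
pose H : 'M[R]_(1 + 1) := block_mx (a 0 0)%:M b%:M b%:M (- a 0 0)%:M.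
have HH : H *m H^T = 1%:M.
  rewrite tr_block_mx !tr_scalar_mx mulmx_block -!scalar_mxM -!raddfD/=.
  rewrite (_ : _ * b + _ = 0); last by ring.
  rewrite (_ : b * a 0 0 + _ = 0); last by ring.
  rewrite (_ : b * b + _ = 1); last by rewrite -ab; ring.
  rewrite (_ : _ + b * b = 1); last by rewrite -ab; ring.
  rewrite !raddf0.
  by rewrite -scalar_mx_block.
(* The sizes [1 + (1 + n)] and [(1 + 1) + n] are convertible, so [H] can act on the first two
   coordinates without a cast. *)
pose A1 : 'M[R]_(1 + (1 + n)) := (block_mx H 0 0 1%:M : 'M[R]_((1 + 1) + n)).
pose A2 : 'M[R]_(1 + (1 + n)) := block_mx 1%:M 0 0 G'.
have A11 : A1 *m A1^T = 1%:M by apply: orthonormal_block HH _; rewrite trmx1 mulmx1.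
have A22 : A2 *m A2^T = 1%:M by apply: orthonormal_block GG'; rewrite trmx1 mulmx1.
exists (A1 *m A2); split.
- apply: preserves_gaussianM.
    apply: (preserves_gaussian_block (A := H) (B := 1%:M)) (@preserves_gaussian1 _).
    by apply: preserves_gaussian_reflection => //; rewrite gt_eqF.
  exact: preserves_gaussian_block (@preserves_gaussian1 _) gG'.
- by rewrite trmx_mul mulmxA -(mulmxA A1) A22 mulmx1.
rewrite trmx_mul mulmxA [in X in X *m _]/A2 tr_block_mx !trmx0 trmx1 mul_row_block !mulmx0 mulmx1 addr0 add0r.
have -> : w' *m G'^T = row_mx b%:M 0.
  have -> : w' = b *: (b^-1 *: w') by rewrite scalerA divff ?scale1r// gt_eqF.
  by rewrite -scalemxAl wG' scale_row_mx scaler0 scale_scalar_mx mulr1.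
have -> : row_mx a (row_mx b%:M (0 : 'rV_n)) = (row_mx (row_mx a b%:M) 0 : 'rV[R]_((1 + 1) + n)).
  by rewrite row_mxA castmx_id.
apply: etrans (row_mul_block_tr (row_mx a b%:M) H (1%:M : 'M[R]_n)) _.
rewrite tr_block_mx !tr_scalar_mx mul_row_block [a]mx11_scalar -!scalar_mxM -!raddfD/=.
rewrite !mxE eqxx !mulr1n -!expr2 ab mulrN [b * _]mulrC subrr.
rewrite raddf0.
transitivity (row_mx (1%:M : 'M[R]_1) (row_mx (0 : 'M[R]_1) (0 : 'rV[R]_n))).
  by rewrite row_mxA castmx_id.
by rewrite row_mx0.
Qed.

Lemma usubmx_mul_tr p1 p2 n (A : 'M[R]_(p1 + p2, n)) :
  usubmx A *m (usubmx A)^T = ulsubmx (A *m A^T).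
Proof. by rewrite -{3 4}[A]vsubmxK tr_col_mx mul_col_row block_mxKul. Qed.

(** The other rows are orthogonal to the first unit vector, hence vanish in the first column. *)
Lemma orthonormal_first_delta p n (Q : 'M[R]_(1 + p, 1 + n)) :
  Q *m Q^T = 1%:M -> usubmx Q = row_mx 1%:M 0 ->
  drsubmx Q *m (drsubmx Q)^T = 1%:M /\ Q = block_mx 1%:M 0 0 (drsubmx Q).
Proof.
move=> QQ uQ.
have QE : Q = block_mx 1%:M 0 (dlsubmx Q) (drsubmx Q).
  rewrite -[LHS]submxK; congr block_mx.
    by rewrite /ulsubmx uQ row_mxKl.
  by rewrite /ursubmx uQ row_mxKr.
move: QQ; rewrite {1 2}QE tr_block_mx mulmx_block !trmx1 !trmx0 !mul0mx !mulmx1 !mul1mx !addr0.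
rewrite (scalar_mx_block 1 p) => /eq_block_mx[_ _ d0 dd].
move: d0; rewrite mulmx0 addr0 => d0.
by split; [rewrite -[RHS]dd d0 mul0mx add0r|rewrite {1}QE d0].
Qed.

(** Choose [G] sending the first row of [O] to the first unit vector. Then [O *m G^T] is a 1
    followed by a smaller block with orthonormal rows, to which the induction hypothesis applies. *)
Lemma gaussian_vec_orthonormal p n (O : 'M[R]_(p, n)) :
  O *m O^T = 1%:M -> preserves_gaussian O.
Proof.
elim: p n O => [|p IH] n O OO; first exact: preserves_gaussian_empty.
case: n O OO => [|n] O OO.
  by move: OO; rewrite (thinmx0 O) mul0mx => /matrixP/(_ 0 0)/eqP; rewrite !mxE eqxx eq_sym oner_eq0.
have: usubmx (O : 'M[R]_(1 + p, 1 + n)) *m (usubmx (O : 'M[R]_(1 + p, 1 + n)))^T = 1%:M.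
  rewrite usubmx_mul_tr OO; have -> : (1%:M : 'M[R]_p.+1) = block_mx (1%:M : 'M[R]_1) 0 0 1%:M.
    exact: (@scalar_mx_block _ 1 p 1).
  by rewrite block_mxKul.
move=> /orthonormal_to_delta[G [gG GG wG]].
have GG' : G^T *m G = 1%:M by apply: mulmx1C.
have -> : O = (O *m G^T) *m G by rewrite -mulmxA GG' mulmx1.
apply: preserves_gaussianM gG.
have OO' : (O *m G^T) *m (O *m G^T)^T = 1%:M.
  by rewrite trmx_mul trmxK -mulmxA [G^T *m _]mulmxA GG' mul1mx.
have: exists O' : 'M[R]_(p, n), O' *m O'^T = 1%:M /\
    O *m G^T = block_mx 1%:M 0 0 O' :> 'M[R]_(1 + p, 1 + n).
  move: OO'; set Q : 'M[R]_(1 + p, 1 + n) := O *m G^T => QQ.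
  have uQ : usubmx Q = row_mx 1%:M 0 by rewrite -wG mul_usub_mx.
  by exists (drsubmx Q); exact: orthonormal_first_delta.
by move=> [Q [QQ ->]]; apply: preserves_gaussian_block (@preserves_gaussian1 _) (IH _ _ QQ).
Qed.

End Orthonormal.

(** * Dilations of a Gaussian vector and Euler's relation *)

Section Dilation.
Context (R : realType) d (T : measurableType d) (P : probability T R).
Local Notation N01 := (@normal_prob R 0 1).

Definition sqnorm n (u : 'rV[R]_n) : R := \sum_i u 0 i ^+ 2.

Lemma sqnorm_ge0 n (u : 'rV[R]_n) : 0 <= sqnorm u.
Proof. by apply: sumr_ge0 => i _; exact: sqr_ge0. Qed.

Lemma sqnormZ n (s : R) (u : 'rV[R]_n) : sqnorm (s *: u) = s ^+ 2 * sqnorm u.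
Proof. by rewrite mulr_sumr; apply: eq_bigr => i _; rewrite mxE exprMn. Qed.

Lemma measurable_sqnorm n : measurable_fun setT (@sqnorm n).
Proof.
by apply: measurable_sum => i; apply: measurable_funX; exact: measurable_mx_coord.
Qed.

Definition dilation_density_rV n (s : R) (u : 'rV[R]_n) : R :=
  \prod_i dilation_density s (u 0 i).

Lemma dilation_density_rV_gt0 n (s : R) (u : 'rV[R]_n) : 0 < s ->
  0 < dilation_density_rV s u.
Proof. by move=> s0; apply: prodr_gt0 => i _; exact: dilation_density_gt0. Qed.

Lemma dilation_density_rVE n (s : R) (u : 'rV[R]_n) :
  dilation_density_rV s u = s ^- n * expR ((1 - s ^- 2) * sqnorm u / 2).
Proof.
rewrite /dilation_density_rV big_split/= prodr_const card_ord exprVn; congr (_ * _).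
by rewrite -expR_sum; congr expR; rewrite /sqnorm !mulr_sumr mulr_suml.
Qed.

Lemma measurable_dilation_density_rV n s :
  measurable_fun setT (@dilation_density_rV n s).
Proof.
rewrite (funext (@dilation_density_rVE n s)).
apply: measurable_funM => //; apply: measurableT_comp => //.
apply: measurable_funM => //; apply: measurable_funM => //.
exact: measurable_sqnorm.
Qed.

Lemma dilation_density_row_mx n m s (u : 'rV[R]_n) (v : 'rV[R]_m) :
  dilation_density_rV s (row_mx u v) = dilation_density_rV s u * dilation_density_rV s v.
Proof.
rewrite /dilation_density_rV big_split_ord/=.
by congr (_ * _); apply: eq_bigr => i _; rewrite ?row_mxEl ?row_mxEr.
Qed.

Lemma measurable_row_mx_fun n m (s : R) :
  measurable_fun setT (fun p : 'rV[R]_n * 'rV[R]_m => row_mx (s *: p.1) (s *: p.2)).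
Proof.
apply: measurable_row_mx; apply: measurable_fun_mx => i j;
  under eq_fun do rewrite mxE; apply: measurable_funM => //.
  exact: (measurableT_comp (measurable_mx_coord _ _) measurable_fst).
exact: (measurableT_comp (measurable_mx_coord _ _) measurable_snd).
Qed.

Lemma measurable_scalemx n (s : R) : measurable_fun setT (fun u : 'rV[R]_n => s *: u).
Proof.
apply: measurable_fun_mx => i j; under eq_fun do rewrite mxE; apply: measurable_funM => //.
exact: measurable_mx_coord.
Qed.

Lemma gaussian_dilation1 (X : T -> 'rV[R]_1) (s : R) (f : 'rV[R]_1 -> \bar R) : 0 < s ->
  gaussian_vec P X -> measurable_fun setT f -> (forall x, 0 <= f x)%E ->
  (\int[P]_t f (s *: X t) = \int[P]_t (f (X t) * (dilation_density_rV s (X t))%:E))%E.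
Proof.
move=> s0 gX mf f0.
pose g (x : R) := f x%:M.
have gE (u : 'rV[R]_1) : f u = g (u 0 0) by rewrite /g -mx11_scalar.
have mg : measurable_fun setT g.
  apply: measurableT_comp => //; apply: measurable_fun_mx => i j.
  rewrite (_ : (fun _ => _) = id); last by apply/funext => t; rewrite !ord1 mxE eqxx mulr1n.
  exact: measurable_id.
under eq_integral do rewrite gE mxE.
under [RHS]eq_integral do rewrite gE /dilation_density_rV big_ord1.
have msg : measurable_fun setT (fun x => g (s * x)).
  by apply: measurableT_comp => //; exact: measurable_funM.
have md : measurable_fun setT (fun x => g x * (dilation_density s x)%:E)%E.
  by apply: emeasurable_funM => //; apply/measurable_EFinP; exact: measurable_dilation_density.
apply: etrans (ge0_integral_coord ord0 gX msg _) _; first by move=> x; exact: f0.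
apply: etrans (normal01_dilation s0 mg _) _; first by move=> x; exact: f0.
apply/esym; apply: etrans (ge0_integral_coord ord0 gX md _) _ => //.
by move=> x; apply: mule_ge0; [exact: f0|rewrite lee_fin ltW// dilation_density_gt0].
Qed.

(** The head and the tail of [X] are independent. The tail is dilated with the head held fixed, then
    Tonelli exchanges the integrals and the head is dilated with the tail held fixed. *)
Lemma gaussian_dilation_step n (X : T -> 'rV[R]_(1 + n)) (s : R) (f : 'rV[R]_(1 + n) -> \bar R) :
  0 < s -> gaussian_vec P X -> measurable_fun setT f -> (forall x, 0 <= f x)%E ->
  (forall (Y : T -> 'rV[R]_n) (g : 'rV[R]_n -> \bar R),
     gaussian_vec P Y -> measurable_fun setT g -> (forall x, 0 <= g x)%E ->
     (\int[P]_t g (s *: Y t) = \int[P]_t (g (Y t) * (dilation_density_rV s (Y t))%:E))%E) ->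
  (\int[P]_t f (s *: X t) = \int[P]_t (f (X t) * (dilation_density_rV s (X t))%:E))%E.
Proof.
move=> s0 gX mf f0 IH.
have gl := gaussian_vec_lsub gX; have gr := gaussian_vec_rsub gX.
have ind := gaussian_vec_split gX.
set l := (fun t => lsubmx (X t)) in gl ind; set r := (fun t => rsubmx (X t)) in gr ind.
have D0 m (u : 'rV[R]_m) : (0 <= (dilation_density_rV s u)%:E)%E.
  by rewrite lee_fin ltW// dilation_density_rV_gt0.
have mD m : measurable_fun setT (fun u : 'rV[R]_m => (dilation_density_rV s u)%:E).
  by apply/measurable_EFinP; exact: measurable_dilation_density_rV.
have swap (K : 'rV[R]_1 * 'rV[R]_n -> \bar R) : measurable_fun setT K -> (forall p, 0 <= K p)%E ->
    (\int[P]_t \int[P]_u K (l t, r u) = \int[P]_u \int[P]_t K (l t, r u))%E.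
  move=> mK K0; apply: (fubini_tonelli (fun p : T * T => K (l p.1, r p.2))) => //.
  apply: measurableT_comp => //; apply: measurable_fun_pair.
    exact: (measurableT_comp gl.1 measurable_fst).
  exact: (measurableT_comp gr.1 measurable_snd).
pose G (p : 'rV[R]_1 * 'rV[R]_n) := f (row_mx (s *: p.1) (s *: p.2)).
have mG : measurable_fun setT G by apply: measurableT_comp => //; exact: measurable_row_mx_fun.
pose K1 (p : 'rV[R]_1 * 'rV[R]_n) := (f (row_mx (s *: p.1) p.2) * (dilation_density_rV s p.2)%:E)%E.
have mK1 : measurable_fun setT K1.
  apply: emeasurable_funM; last exact: (measurableT_comp (mD n) measurable_snd).
  apply: measurableT_comp => //; apply: measurable_row_mx => //.
  exact: (measurableT_comp (measurable_scalemx s) measurable_fst).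
have K10 p : (0 <= K1 p)%E by exact: mule_ge0.
pose K2 (p : 'rV[R]_1 * 'rV[R]_n) :=
  (f (row_mx p.1 p.2) * (dilation_density_rV s p.1)%:E * (dilation_density_rV s p.2)%:E)%E.
have mK2 : measurable_fun setT K2.
  apply: emeasurable_funM; last exact: (measurableT_comp (mD n) measurable_snd).
  apply: emeasurable_funM; last exact: (measurableT_comp (mD 1%N) measurable_fst).
  by apply: measurableT_comp => //; exact: measurable_row_mx.
have K20 p : (0 <= K2 p)%E by rewrite !mule_ge0.
transitivity (\int[P]_t G (l t, r t))%E.
  by apply: eq_integral => t _; rewrite /G/= -scale_row_mx hsubmxK.
rewrite (ge0_integral_independent gl.1 gr.1 ind mG); last by move=> p; exact: f0.
transitivity (\int[P]_t \int[P]_u K1 (l t, r u))%E.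
  apply: eq_integral => t _; apply: (IH r (fun v => f (row_mx (s *: l t) v)) gr) => //.
  by apply: measurableT_comp => //; apply: measurable_row_mx => //; exact: measurable_id.
rewrite swap//; transitivity (\int[P]_u \int[P]_t K2 (l t, r u))%E.
  apply: eq_integral => u _.
  rewrite /K1 /K2 /=.
  under [RHS]eq_integral do rewrite muleAC.
  apply: (gaussian_dilation1 (f := fun w => f (row_mx w (r u)) * (dilation_density_rV s (r u))%:E)%E) => //.
    apply: emeasurable_funM => //; apply: measurableT_comp => //.
    by apply: measurable_row_mx => //; exact: measurable_id.
  by move=> w; exact: mule_ge0.
rewrite -swap// -(ge0_integral_independent gl.1 gr.1 ind mK2)//.
apply: eq_integral => t _; rewrite /K2/= -muleA -EFinM -dilation_density_row_mx.
by rewrite hsubmxK.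
Qed.

Lemma gaussian_dilation n (X : T -> 'rV[R]_n) (s : R) (f : 'rV[R]_n -> \bar R) : 0 < s ->
  gaussian_vec P X -> measurable_fun setT f -> (forall x, 0 <= f x)%E ->
  (\int[P]_t f (s *: X t) = \int[P]_t (f (X t) * (dilation_density_rV s (X t))%:E))%E.
Proof.
move=> s0; elim: n X f => [|n IH] X f gX mf f0.
  apply: eq_integral => t _; rewrite /dilation_density_rV big_ord0 mule1.
  by congr f; rewrite [LHS]thinmx0 [RHS]thinmx0.
exact: (@gaussian_dilation_step n X s f s0 gX mf f0 IH).
Qed.

Lemma gaussian_dilation_independent d' (E : measurableType d') n (X : T -> E)
    (U : T -> 'rV[R]_n) (s : R) (f : E * 'rV[R]_n -> \bar R) :
  0 < s -> measurable_fun setT X -> gaussian_vec P U -> independent P X U ->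
  measurable_fun setT f -> (forall x, 0 <= f x)%E ->
  (\int[P]_t f (X t, s *: U t) =
   \int[P]_t (f (X t, U t) * (dilation_density_rV s (U t))%:E))%E.
Proof.
move=> s0 mX gU ind mf f0.
have D0 (u : 'rV[R]_n) : (0 <= (dilation_density_rV s u)%:E)%E.
  by rewrite lee_fin ltW// dilation_density_rV_gt0.
pose g (p : E * 'rV[R]_n) := f (p.1, s *: p.2).
have mg : measurable_fun setT g.
  apply: measurableT_comp => //; apply: measurable_fun_pair => //.
  exact: (measurableT_comp (measurable_scalemx s) measurable_snd).
pose h (p : E * 'rV[R]_n) := (f p * (dilation_density_rV s p.2)%:E)%E.
have mh : measurable_fun setT h.
  apply: emeasurable_funM => //; apply/measurable_EFinP.
  exact: (measurableT_comp (measurable_dilation_density_rV s) measurable_snd).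
apply: etrans (ge0_integral_independent mX gU.1 ind mg _) _; first by move=> p; exact: f0.
apply/esym; apply: etrans (ge0_integral_independent mX gU.1 ind mh _) _.
  by move=> p; exact: mule_ge0.
apply: eq_integral => t _; apply/esym.
apply: (gaussian_dilation (f := fun u => f (X t, u)) s0 gU) => //.
by apply: measurableT_comp => //; exact: pair1_measurable.
Qed.

(** The hypothesis says that [a s^(k+2) - (a + b/2) s^2] is minimal at [s = 1] among positive [s];
    its derivative there is [k a - b]. *)
Lemma min_at1_eq (k : nat) (a b : R) :
  (forall s, 0 < s -> s ^+ 2 * a + (s ^+ 2 - 1) * (b / 2) <= s ^+ k.+2 * a) ->
  k%:R * a = b.
Proof.
move=> H.
pose f : R -> R := a *: id ^+ k.+2 - (a + b / 2) *: id ^+ 2.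
have fE t : f t = a * t ^+ k.+2 - (a + b / 2) * t ^+ 2 by rewrite /f !fctE.
have df (t : R) : is_derive t 1 f
    (a *: (k.+2%:R * t ^+ k.+1 *: 1) - (a + b / 2) *: (2 * t ^+ 1 *: 1)).
  exact: is_deriveB.
have : is_derive (1 : R) 1 f 0.
  apply: (@derive1_at_min R f 0 2 1) => [|t _||t].
  - exact: ler0n.
  - by have [] := df t.
  - by rewrite in_itv/= ltr01 ltr1n.
  rewrite in_itv/= => /andP[t0 _]; rewrite !fE !expr1n !mulr1.
  by have := H _ t0; lra.
have [_ e1] := df 1; case=> _; rewrite e1 /GRing.scale/= !expr1n !mulr1.
by rewrite -[k.+2]addn2 natrD => h; lra.
Qed.

(* Euler's relation for the derivative at [s = 1] of [s |-> E f (X, s U)]. *)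
Lemma gaussian_euler d' (E : measurableType d') n (X : T -> E) (U : T -> 'rV[R]_n)
    (k : nat) (f : E * 'rV[R]_n -> R) :
  measurable_fun setT X -> gaussian_vec P U -> independent P X U ->
  measurable_fun setT f -> (forall x, 0 <= f x) ->
  (forall s x u, 0 < s -> f (x, s *: u) = s ^+ k * f (x, u)) ->
  P.-integrable setT (fun t => (f (X t, U t))%:E) ->
  P.-integrable setT (fun t => (f (X t, U t) * sqnorm (U t))%:E) ->
  \int[P]_t (f (X t, U t) * sqnorm (U t)) = (n + k)%:R * \int[P]_t f (X t, U t).
Proof.
move=> mX gU ind mf f0 fhom if1 if2.
set b := Rintegral _ _ _; set a := Rintegral _ _ _.
have aE : (\int[P]_t (f (X t, U t))%:E = a%:E)%E.
  by rewrite fineK//; exact: integrable_fin_num.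
have bE : (\int[P]_t (f (X t, U t) * sqnorm (U t))%:E = b%:E)%E.
  by rewrite fineK//; exact: integrable_fin_num.
apply/esym; apply: min_at1_eq => s s0.
have mXU : measurable_fun setT (fun t => (X t, U t)).
  by apply: measurable_fun_pair => //; exact: gU.1.
have mfXU := measurableT_comp mf mXU.
(* Both sides are the expectation of [f (X, s U)]: by the dilation density on the left, by
   homogeneity on the right. *)
have h : (\int[P]_t (f (X t, U t) * dilation_density_rV s (U t))%:E = (s ^+ k * a)%:E)%E.
  rewrite EFinM -aE -integralZl//.
  under [RHS]eq_integral do rewrite -EFinM -fhom//.
  rewrite (gaussian_dilation_independent (f := fun p => (f p)%:E) s0 mX gU ind)//.
  exact/measurable_EFinP.
have iD : P.-integrable setT (fun t => (f (X t, U t) * dilation_density_rV s (U t))%:E).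
  apply/integrableP; split.
    apply/measurable_EFinP; apply: measurable_funM => //.
    exact: (measurableT_comp (measurable_dilation_density_rV s) gU.1).
  under eq_integral do rewrite gee0_abs ?lee_fin ?mulr_ge0 ?(ltW (dilation_density_rV_gt0 _ _))//.
  by rewrite h ltry.
(* A lower bound of [f] times the dilation density, from [1 + x <= expR x]. It is an equality at
   [s = 1], which is what [min_at1_eq] needs. *)
pose g t := s ^- n * (f (X t, U t) + (1 - s ^- 2) / 2 * (f (X t, U t) * sqnorm (U t))).
have ig : P.-integrable setT (fun t => (g t)%:E).
  under eq_fun do rewrite EFinM EFinD [((1 - s ^- 2) / 2 * _)%:E]EFinM.
  apply: integrableZl => //; apply: integrableD => //; exact: integrableZl.
have : (\int[P]_t (g t)%:E <= (s ^+ k * a)%:E)%E.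
  rewrite -h; apply: le_integral => // t _; rewrite lee_fin /g dilation_density_rVE.
  rewrite [leRHS]mulrCA ler_pM2l ?invr_gt0 ?exprn_gt0//.
  rewrite (_ : _ + _ = f (X t, U t) * (1 + (1 - s ^- 2) * sqnorm (U t) / 2)); last by ring.
  by rewrite ler_wpM2l// expR_ge1Dx.
have -> : (\int[P]_t (g t)%:E = (s ^- n * (a + (1 - s ^- 2) / 2 * b))%:E)%E.
  under eq_integral do rewrite EFinM EFinD [((1 - s ^- 2) / 2 * _)%:E]EFinM.
  rewrite integralZl//; last by apply: integrableD => //; exact: integrableZl.
  rewrite integralD//; last exact: integrableZl.
  by rewrite integralZl// aE bE.
rewrite lee_fin mulrC ler_pdivrMr ?exprn_gt0// => h2.
have -> : s ^+ 2 * a + (s ^+ 2 - 1) * (b / 2) = s ^+ 2 * (a + (1 - s ^- 2) / 2 * b).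
  by field; rewrite lt0r_neq0.
apply: le_trans (_ : s ^+ 2 * (s ^+ k * a * s ^+ n) <= _).
  by rewrite ler_pM2l// exprn_gt0.
by rewrite le_eqVlt; apply/orP; left; apply/eqP; rewrite -[(n + k).+2]addn2 !exprD; ring.
Qed.

End Dilation.

(** * Random variables with moments of all orders *)

Section Moments.
Context (R : realType) d (T : measurableType d) (P : probability T R).
Local Notation N01 := (@normal_prob R 0 1).

(** Completing the square turns [expR (a x)] times the standard density into [expR (a^2 / 2)] times
    the normal density centred at [a]. *)
Lemma integrable_expR_normal01 (a : R) :
  (\int[N01]_x (expR (a * x))%:E < +oo)%E.
Proof.
have mE : measurable_fun setT (fun x : R => (expR (a * x))%:E).
  apply/measurable_EFinP; apply: measurableT_comp => //; exact: measurable_funM.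
rewrite ge0_integral_normal01//.
under eq_integral => x _.
  rewrite -EFinM normal_pdf01E.
  rewrite (_ : expR (a * x) * _ = expR (a ^+ 2 / 2) * normal_pdf a 1 x); first over.
  rewrite normal_pdfE ?oner_neq0// /normal_fun.
  rewrite mulrCA [RHS]mulrCA -!expRD; congr (_ * expR _); rewrite expr1n; lra.
under eq_integral do rewrite EFinM.
rewrite integralZl//; last exact: integrable_normal_pdf.
by rewrite integral_normal_pdf mule1 ltry.
Qed.

Lemma expr_le_fact_expR (k : nat) (x : R) : 0 <= x -> x ^+ k <= k`!%:R * expR x.
Proof.
case: k => [|k] x0.
  by rewrite expr0 fact0 mul1r -expR0 ler_expR.
have k0 : 0 < k.+1`!%:R :> R by rewrite ltr0n fact_gt0.
rewrite mulrC -ler_pdivrMr//; apply: le_trans (expR_ge1Dxn k x0).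
by rewrite lerDr.
Qed.

(** Unlike integrability, this class is closed under products, so the integrability of polynomial
    expressions follows their structure. *)
Definition all_moments (f : T -> R) :=
  measurable_fun setT f /\ forall k, P.-integrable setT (fun t => (`|f t| ^+ k)%:E).

Lemma integrable_le (f g : T -> R) : measurable_fun setT f ->
  P.-integrable setT (fun t => (g t)%:E) -> (forall t, `|f t| <= g t) ->
  P.-integrable setT (fun t => (f t)%:E).
Proof.
move=> mf ig fg; apply: (le_integrable _ _ _ ig) => //; first exact/measurable_EFinP.
by move=> t _; rewrite !abse_EFin lee_fin (le_trans (fg t))// ler_norm.
Qed.

Lemma integrableDR (f g : T -> R) :
  P.-integrable setT (fun t => (f t)%:E) -> P.-integrable setT (fun t => (g t)%:E) ->
  P.-integrable setT (fun t => (f t + g t)%:E).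
Proof. by move=> hf hg; under eq_fun do rewrite EFinD; exact: integrableD. Qed.

Lemma integrableZR (c : R) (f : T -> R) :
  P.-integrable setT (fun t => (f t)%:E) -> P.-integrable setT (fun t => (c * f t)%:E).
Proof. by move=> hf; under eq_fun do rewrite EFinM; exact: integrableZl. Qed.

Lemma measurable_normX (f : T -> R) k : measurable_fun setT f ->
  measurable_fun setT (fun t => `|f t| ^+ k).
Proof. by move=> mf; apply: measurable_funX; exact: measurableT_comp. Qed.

Lemma all_moments_cst (c : R) : all_moments (fun=> c).
Proof. by split => // k; exact: finite_measure_integrable_cst. Qed.

Lemma all_momentsD (f g : T -> R) :
  all_moments f -> all_moments g -> all_moments (fun t => f t + g t).
Proof.
move=> [mf hf] [mg hg]; split=> [|k]; first exact: measurable_funD.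
apply: (@integrable_le _ (fun t => 2 ^+ k * (`|f t| ^+ k + `|g t| ^+ k))).
- by apply: measurable_normX; exact: measurable_funD.
- by apply: integrableZR; exact: integrableDR.
move=> t; rewrite normrX normr_id.
have h (x y : R) : 0 <= x -> x <= y -> (x + y) ^+ k <= 2 ^+ k * (x ^+ k + y ^+ k).
  move=> x0 xy; have y0 := le_trans x0 xy.
  apply: (@le_trans _ _ (2 ^+ k * y ^+ k)); last by rewrite ler_wpM2l ?exprn_ge0// lerDr exprn_ge0.
  by rewrite -exprMn lerXn2r ?nnegrE ?addr_ge0 ?mulr_ge0//; lra.
apply: (@le_trans _ _ ((`|f t| + `|g t|) ^+ k)).
  by rewrite lerXn2r ?nnegrE ?addr_ge0// ler_normD.
case: (leP `|f t| `|g t|) => [|/ltW] fg; first exact: h.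
by rewrite addrC [X in _ * X]addrC; exact: h.
Qed.

Lemma all_momentsM (f g : T -> R) :
  all_moments f -> all_moments g -> all_moments (fun t => f t * g t).
Proof.
move=> [mf hf] [mg hg]; split=> [|k]; first exact: measurable_funM.
apply: (@integrable_le _ (fun t => `|f t| ^+ (k * 2) + `|g t| ^+ (k * 2))).
- by apply: measurable_normX; exact: measurable_funM.
- exact: integrableDR.
move=> t; rewrite normrX normr_id normrM exprMn !exprM.
move: (`|f t| ^+ k) (`|g t| ^+ k) => x y; have := sqr_ge0 (x - y).
have := sqr_ge0 (x + y); have := sqr_ge0 x; have := sqr_ge0 y; rewrite sqrrB sqrrD; lra.
Qed.

Lemma all_moments_integrable (f : T -> R) :
  all_moments f -> P.-integrable setT (fun t => (f t)%:E).
Proof.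
by move=> [mf hf]; apply: (integrable_le mf (hf 1%N)) => t; rewrite expr1.
Qed.

Lemma all_moments_bounded (f : T -> R) (M : R) : measurable_fun setT f ->
  (forall t, `|f t| <= M) -> all_moments f.
Proof.
move=> mf fM; split => // k.
apply: (@integrable_le _ (fun=> M ^+ k)) => [||t].
- exact: measurable_normX.
- exact: finite_measure_integrable_cst.
- by rewrite normrX normr_id lerXn2r ?nnegrE ?(le_trans _ (fM t)).
Qed.

Lemma all_moments_sum I (s : seq I) (f : I -> T -> R) :
  (forall i, all_moments (f i)) -> all_moments (fun t => \sum_(i <- s) f i t).
Proof.
move=> hf; elim: s => [|i s IH].
  by under eq_fun do rewrite big_nil; exact: all_moments_cst.
by under eq_fun do rewrite big_cons; exact: all_momentsD.
Qed.

Lemma all_moments_coord n (X : T -> 'rV[R]_n) i :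
  gaussian_vec P X -> all_moments (fun t => X t 0 i).
Proof.
move=> gX; have mXi : measurable_fun setT (fun t => X t 0 i).
  exact: (measurableT_comp (measurable_mx_coord _ _) gX.1).
have mEa a : measurable_fun setT (fun x : R => (expR (a * x))%:E).
  apply/measurable_EFinP; apply: measurableT_comp => //; exact: measurable_funM.
have iE a : P.-integrable setT (fun t => (expR (a * X t 0 i))%:E).
  apply/integrableP; split.
    by apply: (measurableT_comp (mEa a)).
  under eq_integral do rewrite gee0_abs ?lee_fin ?expR_ge0//.
  apply: le_lt_trans (integrable_expR_normal01 a).
  by rewrite (ge0_integral_coord i gX (mEa a))// => x; rewrite lee_fin expR_ge0.
split => // k.
apply: (@integrable_le _ (fun t => k`!%:R * (expR (1 * X t 0 i) + expR (-1 * X t 0 i)))).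
- exact: measurable_normX.
- by apply: integrableZR; exact: integrableDR.
move=> t; rewrite normrX normr_id.
apply: le_trans (expr_le_fact_expR k (normr_ge0 _)) _.
rewrite ler_wpM2l ?ler0n// mul1r mulN1r.
have := expR_ge0 (X t 0 i); have := expR_ge0 (- X t 0 i).
by case: (ger0P (X t 0 i)) => _; lra.
Qed.

End Moments.

(** * Polynomials and Hermite tensors *)

Section PolynomialFunctions.
Variables (R : realType) (n : nat).
Implicit Types f g : 'rV[R]_n -> R.

(* [polyfun k f]: [f] is a polynomial function of degree < [k]. *)
Inductive polyfun : nat -> ('rV[R]_n -> R) -> Prop :=
| polyfun0 k : polyfun k (fun=> 0)
| polyfun_cst k c : polyfun k.+1 (fun=> c)
| polyfun_coordM k i f : polyfun k f -> polyfun k.+1 (fun u => u 0 i * f u)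
| polyfunD k f g : polyfun k f -> polyfun k g -> polyfun k (fun u => f u + g u).

Lemma polyfunW k l f : (k <= l)%N -> polyfun k f -> polyfun l f.
Proof.
move=> + fk; elim: fk l => {k f} [k|k c|k i f _ IH|k f g _ IHf _ IHg] l kl.
- exact: polyfun0.
- by case: l kl => // l _; exact: polyfun_cst.
- by case: l kl => // l kl; apply: polyfun_coordM; exact: IH.
- by apply: polyfunD; [exact: IHf|exact: IHg].
Qed.

Lemma polyfunZ k c f : polyfun k f -> polyfun k (fun u => c * f u).
Proof.
elim=> {k f} [k|k c'|k i f _ IH|k f g _ IHf _ IHg].
- by under eq_fun do rewrite mulr0; exact: polyfun0.
- exact: polyfun_cst.
- by under eq_fun do rewrite mulrCA; exact: polyfun_coordM.
- by under eq_fun do rewrite mulrDr; exact: polyfunD.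
Qed.

Lemma polyfun_sum I (s : seq I) k (f : I -> 'rV[R]_n -> R) :
  (forall i, polyfun k (f i)) -> polyfun k (fun u => \sum_(i <- s) f i u).
Proof.
move=> hf; elim: s => [|i s IH].
  by under eq_fun do rewrite big_nil; exact: polyfun0.
by under eq_fun do rewrite big_cons; exact: polyfunD.
Qed.

Lemma polyfun_monomial (s : seq 'I_n) k f :
  polyfun k f -> polyfun (size s + k) (fun u => (\prod_(j <- s) u 0 j) * f u).
Proof.
move=> fk; elim: s => [|i s IH].
  by under eq_fun do rewrite big_nil mul1r.
by under eq_fun do rewrite big_cons -mulrA; exact: polyfun_coordM.
Qed.

Lemma polyfun_prod (s : seq 'I_n) : polyfun (size s).+1 (fun u => \prod_(j <- s) u 0 j).
Proof.
have := polyfun_monomial s (polyfun_cst 0 1); rewrite addn1.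
by under eq_fun do rewrite mulr1.
Qed.

Lemma measurable_polyfun k f : polyfun k f -> measurable_fun setT f.
Proof.
elim=> {k f} [k|k c'|k i f _ IH|k f g _ IHf _ IHg] //.
- by apply: measurable_funM => //; exact: measurable_mx_coord.
- exact: measurable_funD.
Qed.

Lemma all_moments_polyfun d (T : measurableType d) (P : probability T R) (X : T -> 'rV[R]_n) k f :
  gaussian_vec P X -> polyfun k f -> all_moments P (fun t => f (X t)).
Proof.
move=> gX; elim=> {k f} [k|k c'|k i f _ IH|k f g _ IHf _ IHg].
- exact: all_moments_cst.
- exact: all_moments_cst.
- by apply: all_momentsM => //; exact: all_moments_coord.
- exact: all_momentsD.
Qed.

End PolynomialFunctions.

Lemma polyfun_mulmx (R : realType) n p (A : 'M[R]_(p, n)) k (f : 'rV[R]_n -> R) :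
  polyfun k f -> polyfun k (fun u : 'rV[R]_p => f (u *m A)).
Proof.
elim=> {k f} [k|k c'|k i f _ IH|k f g _ IHf _ IHg].
- exact: polyfun0.
- exact: polyfun_cst.
- under eq_fun do rewrite mxE mulr_suml.
  apply: polyfun_sum => j; under eq_fun do rewrite -mulrA.
  by apply: polyfun_coordM; exact: polyfunZ.
- exact: polyfunD.
Qed.

Section Derivatives.
Variables (R : realType) (n : nat).
Implicit Types f g : 'rV[R]_n -> R.

Lemma is_derive_line (f : 'rV[R]_n -> R) (u v : 'rV[R]_n) (D : R) :
  is_derive (0 : R) 1 (fun t : R => f (t *: v + u)) D -> is_derive u v f D.
Proof.
move=> [h1 h2].
have E : (fun h : R => h^-1 *: ((f \o shift u) (h *: v) - f u)) =
  (fun h : R => h^-1 *: (((fun t : R => f (t *: v + u)) \o shift 0) (h *: 1) - f (0 *: v + u))).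
  apply/funext => h /=; rewrite scale0r add0r addr0.
  by rewrite [h *: 1]mulr1.
split; first by rewrite /derivable E.
by rewrite -h2 /derive E.
Qed.

Lemma shift_coordE (i j : 'I_n) (t : R) (u : 'rV[R]_n) :
  (t *: delta_mx 0 i + u) 0 j = (i == j)%:R * t + u 0 j.
Proof. by rewrite !mxE eqxx/= eq_sym mulrC. Qed.

Lemma is_derive_polyfun k f i : polyfun k f ->
  exists2 g, polyfun k g & forall u, is_derive u (delta_mx 0 i : 'rV[R]_n) f (g u).
Proof.
elim=> {k f} [k|k c|k j f fk [g gk fg]|k f g _ [f' f'k ff'] _ [g' g'k gg']].
- by exists (fun=> 0) => [|u]; [exact: polyfun0|exact: is_derive_cst].
- by exists (fun=> 0) => [|u]; [exact: polyfun0|exact: is_derive_cst].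
- exists (fun u : 'rV[R]_n => u 0 j * g u + (i == j)%:R * f u) => [|u].
    apply: polyfunD; first exact: polyfun_coordM.
    by apply: polyfunZ; exact: polyfunW fk.
  have dj : is_derive u (delta_mx 0 i : 'rV[R]_n) (fun u : 'rV[R]_n => u 0 j) ((i == j)%:R : R).
    apply: is_derive_line; under eq_fun do rewrite shift_coordE.
    by apply: is_derive_eq; rewrite /GRing.scale/=; ring.
  have := @is_deriveM _ _ _ _ _ _ _ _ dj (fg u).
  by move=> h; apply: (is_derive_eq h); rewrite /GRing.scale/= [f u * _]mulrC.
- exists (fun u => f' u + g' u) => [|u]; first exact: polyfunD.
  exact: is_deriveD.
Qed.

Lemma gauss_pdfE (u : 'rV[R]_n) :
  gauss_pdf u = normal_peak 1 ^+ n * expR (- sqnorm u / 2).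
Proof.
rewrite /gauss_pdf; under eq_bigr do rewrite normal_pdf01E.
rewrite big_split/= prodr_const card_ord -expR_sum; congr (_ * expR _).
by rewrite -sumrN mulr_suml; apply: eq_bigr => i _; rewrite mulNr.
Qed.

Lemma gauss_pdf_gt0 (u : 'rV[R]_n) : 0 < gauss_pdf u.
Proof. by apply: prodr_gt0 => i _; exact: normal_pdf01_gt0. Qed.

Lemma sqnorm_shift i (t : R) (u : 'rV[R]_n) :
  sqnorm (t *: delta_mx 0 i + u) = sqnorm u + 2 * t * u 0 i + t ^+ 2.
Proof.
rewrite /sqnorm (bigD1 i)//= [X in _ = X + _ + _](bigD1 i)//= shift_coordE eqxx mul1r.
rewrite (eq_bigr (fun j => u 0 j ^+ 2)); first by ring.
by move=> j /negbTE ji; rewrite shift_coordE eq_sym ji mul0r add0r.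
Qed.

Lemma is_derive_gauss_pdf i (u : 'rV[R]_n) :
  is_derive u (delta_mx 0 i : 'rV[R]_n) (@gauss_pdf R n) (- u 0 i * gauss_pdf u).
Proof.
apply: is_derive_line; under eq_fun do rewrite gauss_pdfE sqnorm_shift.
pose g : R -> R := (fun t => - (sqnorm u + 2 * t * u 0 i + t ^+ 2) / 2).
have dg : is_derive (0 : R) 1 g (- u 0 i).
  by rewrite /g; apply: is_derive_eq; rewrite /GRing.scale/=; field.
have := @is_derive1_comp _ expR g 0 _ _ (is_derive_expR (g 0)) dg.
move=> /(is_deriveZ (normal_peak 1 ^+ n)) h; apply: (is_derive_eq h).
rewrite gauss_pdfE /g /GRing.scale/= mulr0 mul0r expr0n/= !addr0.
by ring.
Qed.

(** The derivative of [gauss_pdf u * q u] along coordinate [j] is [gauss_pdf u] times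
    [d_j q - u_j q]. The leading monomial is recorded apart from the lower-degree part [l] because
    it alone contributes to the parity tensor of order r. *)
Lemma iter_partial_gauss_pdf (s : seq 'I_n) :
  exists q l : 'rV[R]_n -> R, [/\ polyfun (size s).+1 q, polyfun (size s) l,
    (forall u, q u = (-1) ^+ size s * \prod_(j <- s) u 0 j + l u) &
    foldr (@partial R n) (@gauss_pdf R n) s = fun u => gauss_pdf u * q u].
Proof.
elim: s => [|j s [q [l [qk lk qE IH]]]].
  exists (fun=> 1), (fun=> 0); split; [exact: polyfun_cst|exact: polyfun0|move=> u|].
    by rewrite big_nil expr0 mulr1 addr0.
  by apply/funext => u; rewrite mulr1.
have [g gk qg] := is_derive_polyfun j qk.
exists (fun u => g u - u 0 j * q u), (fun u => g u - u 0 j * l u); split => [||u|] /=.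
- apply: polyfunD; first exact: polyfunW gk.
  under eq_fun do rewrite -mulN1r mulrCA.
  by apply: polyfun_coordM; exact: polyfunZ.
- apply: polyfunD; first exact: gk.
  under eq_fun do rewrite -mulN1r mulrCA.
  by apply: polyfun_coordM; exact: polyfunZ.
- by rewrite big_cons qE exprS; ring.
rewrite IH; apply/funext => u; rewrite /partial.
have := is_deriveM (is_derive_gauss_pdf j u) (qg u) => -[_ ->].
by rewrite /GRing.scale/=; ring.
Qed.

End Derivatives.

(** * Stein's identity and the means of Hermite tensors *)

Section Stein.
Context (R : realType) d (T : measurableType d) (P : probability T R).

Lemma gaussian_vec_law n (X Y : T -> 'rV[R]_n) (f : 'rV[R]_n -> \bar R) :
  gaussian_vec P X -> gaussian_vec P Y -> measurable_fun setT f ->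
  (\int[P]_t f (X t) = \int[P]_t f (Y t))%E.
Proof.
move=> gX gY mf; apply: (eq_law_integral gX.1 gY.1) => //.
apply: (eq_law_rV gX.1 gY.1); first exact: probability_lty measurableT.
by move=> A mA; exact: etrans (gaussian_vec_box gX mA) (esym (gaussian_vec_box gY mA)).
Qed.

Definition flip n (i : 'I_n) (u : 'rV[R]_n) : 'rV[R]_n :=
  \row_j (if j == i then - u 0 j else u 0 j).

Lemma gaussian_vec_flip n (X : T -> 'rV[R]_n) i :
  gaussian_vec P X -> gaussian_vec P (fun t => flip i (X t)).
Proof.
pose D := diag_mx (\row_j (if j == i then -1 else 1) : 'rV[R]_n).
have DD : D *m D^T = 1%:M.
  rewrite tr_diag_mx mulmx_diag -diag_const_mx; congr diag_mx.
  by apply/rowP => j; rewrite !mxE; case: ifP => _; rewrite ?mulrNN mulr1.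
move=> /(gaussian_vec_orthonormal DD); congr gaussian_vec; apply/funext => t.
apply/rowP => j; rewrite tr_diag_mx mul_mx_diag !mxE.
by case: ifP => _; rewrite ?mulrN mulr1.
Qed.

Lemma integral_flip_odd n (X : T -> 'rV[R]_n) i (f : 'rV[R]_n -> R) :
  gaussian_vec P X -> measurable_fun setT f -> (forall u, f (flip i u) = - f u) ->
  P.-integrable setT (fun t => (f (X t))%:E) -> \int[P]_t f (X t) = 0.
Proof.
move=> gX mf fN fi.
have : \int[P]_t f (X t) = \int[P]_t f (flip i (X t)).
  rewrite /Rintegral; congr fine.
  apply: (gaussian_vec_law (f := fun u => (f u)%:E)) => //; first exact: gaussian_vec_flip.
  exact/measurable_EFinP.
under [in RHS]eq_Rintegral do rewrite fN -mulN1r.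
by rewrite RintegralZl// => h; lra.
Qed.

(** Carries the coordinates other than [i] while keeping the dimension, so that not depending on
    coordinate [i] reads [m (zero_coord i u) = m u]. *)
Definition zero_coord n (i : 'I_n) (u : 'rV[R]_n) : 'rV[R]_n :=
  \row_j (if j == i then 0 else u 0 j).

Lemma measurable_zero_coord n (i : 'I_n) : measurable_fun setT (zero_coord i).
Proof.
apply: measurable_fun_mx => a b; case E : (b == i).
  under eq_fun do rewrite mxE E.
  exact: measurable_cst.
under eq_fun do rewrite mxE E.
exact: measurable_mx_coord.
Qed.

Lemma independent_coord n (X : T -> 'rV[R]_n) i : gaussian_vec P X ->
  independent P (fun t => zero_coord i (X t)) (fun t => (X t 0 i)%:M : 'rV[R]_1).
Proof.
move=> gX; have mXi j : measurable_fun setT (fun t => X t 0 j).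
  exact: (measurableT_comp (measurable_mx_coord _ _) gX.1).
apply: independent_rV.
- exact: measurableT_comp (measurable_zero_coord i) gX.1.
- apply: measurable_fun_mx => a b.
  rewrite (_ : (fun _ => _) = (fun t => X t 0 i)); last first.
    by apply/funext => t; rewrite !ord1 mxE eqxx mulr1n.
  exact: mXi.
move=> A B mA mB.
pose C (D : set R) j := if j == i then D else A j.
have mC D : measurable D -> forall j, measurable (C D j).
  by move=> mD j; rewrite /C; case: ifP.
have BE : (fun t => (X t 0 i)%:M : 'rV[R]_1) @^-1` rbox B = X @^-1` rbox (fun j => if j == i then B ord0 else setT).
  apply/seteqP; split=> t /= H.
    by move=> j; case: eqP => // ->; have := H ord0; rewrite mxE eqxx mulr1n.
  by move=> j; rewrite (ord1 j) mxE eqxx mulr1n; have := H i; rewrite eqxx.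
(* Coordinate [i] of [zero_coord i] is constantly 0, so the side [A i] either excludes every sample
   or is no constraint. *)
have [A0|A0] := pselect (A i 0); last first.
  have -> : (fun t => zero_coord i (X t)) @^-1` rbox A = set0.
    by apply/seteqP; split => // t /= /(_ i); rewrite mxE eqxx.
  by rewrite set0I measure0 mul0e.
have AE : (fun t => zero_coord i (X t)) @^-1` rbox A = X @^-1` rbox (C setT).
  apply/seteqP; split=> t /= H j; have := H j; rewrite /C mxE; case: eqP => // ->.
  by [].
rewrite AE BE -preimage_setI rboxI !(gaussian_vec_box gX)//; last 3 first.
- by move=> j; case: ifP.
- exact: mC.
- by move=> j; rewrite /C; case: ifP => _; [rewrite setTI; exact: mB|rewrite setIT; exact: mA].
rewrite -EFinM; congr EFin; rewrite -big_split/=; apply: eq_bigr => j _.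
rewrite /C; case: ifP => _; first by rewrite setTI probability_setT mul1r.
by rewrite setIT probability_setT mulr1.
Qed.

(** Euler's relation in dimension one, for the even power of coordinate [i], which is homogeneous of
    degree [b.*2]. Since [gaussian_euler] asks for a nonnegative function, [m] is split as
    [(|m| + m) - |m|]. *)
Lemma gaussian_moment_rec n (X : T -> 'rV[R]_n) i (b : nat) k (m : 'rV[R]_n -> R) :
  gaussian_vec P X -> polyfun k m -> (forall u, m (zero_coord i u) = m u) ->
  \int[P]_t (X t 0 i ^+ b.*2.+2 * m (X t)) =
  b.*2.+1%:R * \int[P]_t (X t 0 i ^+ b.*2 * m (X t)).
Proof.
move=> gX mk m0; have mm := measurable_polyfun mk.
have mom := all_moments_polyfun gX mk.
have momi := all_moments_coord i gX.
have momX a : all_moments P (fun t => X t 0 i ^+ a).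
  elim: a => [|a IH]; first by under eq_fun do rewrite expr0; exact: all_moments_cst.
  by under eq_fun do rewrite exprS; exact: all_momentsM.
have mnorm : all_moments P (fun t => `|m (X t)|).
  split=> [|a]; first by apply: measurableT_comp => //; exact: mom.1.
  by under eq_fun do rewrite normr_id; exact: mom.2.
have gi : gaussian_vec P (fun t => (X t 0 i)%:M : 'rV[R]_1).
  have := gaussian_vec_sub (h := fun _ : 'I_1 => i) _ gX.
  rewrite (_ : (fun t => \row_j X t 0 i) = (fun t => (X t 0 i)%:M)).
    by apply => a c _; rewrite (ord1 a) (ord1 c).
  by apply/funext => t; apply/rowP => j; rewrite !mxE (ord1 j) eqxx mulr1n.
have mz : measurable_fun setT (fun t => zero_coord i (X t)).
  exact: measurableT_comp (measurable_zero_coord i) gX.1.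
have key (h : 'rV[R]_n -> R) : measurable_fun setT h -> (forall u, 0 <= h u) ->
    (forall u, h (zero_coord i u) = h u) -> all_moments P (fun t => h (X t)) ->
    \int[P]_t (X t 0 i ^+ b.*2.+2 * h (X t)) =
    b.*2.+1%:R * \int[P]_t (X t 0 i ^+ b.*2 * h (X t)).
  move=> mh h0 hz momh.
  pose f (p : 'rV[R]_n * 'rV[R]_1) := p.2 0 0 ^+ b.*2 * h p.1.
  have fE t : f (zero_coord i (X t), (X t 0 i)%:M) = X t 0 i ^+ b.*2 * h (X t).
    by rewrite /f/= mxE eqxx mulr1n hz.
  have nE t : sqnorm ((X t 0 i)%:M : 'rV[R]_1) = X t 0 i ^+ 2.
    by rewrite /sqnorm big_ord1 mxE eqxx mulr1n.
  have := @gaussian_euler _ _ _ P _ _ 1 (fun t => zero_coord i (X t))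
    (fun t => (X t 0 i)%:M : 'rV[R]_1) b.*2 f mz gi (independent_coord i gX).
  under eq_Rintegral do rewrite fE nE mulrAC -exprD addn2.
  under [in X in _ = X]eq_Rintegral do rewrite fE.
  rewrite add1n; apply.
  - apply: measurable_funM; last exact: (measurableT_comp mh measurable_fst).
    apply: measurable_funX; exact: (measurableT_comp (measurable_mx_coord _ _) measurable_snd).
  - move=> p; rewrite mulr_ge0// -mul2n exprM; exact/exprn_ge0/sqr_ge0.
  - by move=> s x u s0; rewrite /f/= mxE exprMn mulrA.
  - under eq_fun do rewrite fE.
    by apply: all_moments_integrable; exact: all_momentsM.
  under eq_fun do rewrite fE nE.
  by apply: all_moments_integrable; apply: all_momentsM => //; exact: all_momentsM.
have E1 := key (fun u => `|m u| + m u) _ _ _ _.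
have E2 := key (fun u => `|m u|) _ _ _ _.
have ii a (h : T -> R) : all_moments P h -> P.-integrable setT (fun t => (X t 0 i ^+ a * h t)%:E).
  by move=> mh; apply: all_moments_integrable; exact: all_momentsM.
have split a : \int[P]_t (X t 0 i ^+ a * m (X t)) =
    \int[P]_t (X t 0 i ^+ a * (`|m (X t)| + m (X t))) - \int[P]_t (X t 0 i ^+ a * `|m (X t)|).
  rewrite -RintegralB//; last exact: ii.
    by apply: eq_Rintegral => t _; ring.
  by apply: ii; exact: all_momentsD.
rewrite !split E1 ?E2 ?mulrBr//.
- exact: measurableT_comp.
- by move=> u; rewrite m0.
- by apply: measurable_funD => //; exact: measurableT_comp.
- by move=> u; rewrite -lerBlDr sub0r -normrN ler_norm.
- by move=> u; rewrite m0.
- exact: all_momentsD.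
Qed.

Lemma coord_flip n (i j : 'I_n) (u : 'rV[R]_n) :
  flip i u 0 j = (-1) ^+ (j == i) * u 0 j.
Proof. by rewrite mxE; case: eqP => _; rewrite ?expr1 ?mulN1r ?expr0 ?mul1r. Qed.

Lemma prod_flip n (i : 'I_n) (s : seq 'I_n) (u : 'rV[R]_n) :
  \prod_(j <- s) flip i u 0 j = (-1) ^+ count_mem i s * \prod_(j <- s) u 0 j.
Proof.
elim: s => [|j s IH]; first by rewrite !big_nil expr0 mulr1.
by rewrite !big_cons IH coord_flip /= exprD; ring.
Qed.

Lemma prod_zero_coord n (i : 'I_n) (s : seq 'I_n) (u : 'rV[R]_n) : i \notin s ->
  \prod_(j <- s) zero_coord i u 0 j = \prod_(j <- s) u 0 j.
Proof.
move=> iNs; rewrite !big_seq; apply: eq_bigr => j js; rewrite mxE; case: eqP => // ji.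
by rewrite -ji js in iNs.
Qed.

(** For even [a] both sides vanish, by oddness in coordinate [i] or by the factor [a = 0]; for odd
    [a] this is the recursion of even moments. *)
Lemma stein_monomial n (X : T -> 'rV[R]_n) i a (s : seq 'I_n) :
  gaussian_vec P X -> i \notin s ->
  \int[P]_t (a%:R * X t 0 i ^+ a.-1 * \prod_(j <- s) X t 0 j) =
  \int[P]_t (X t 0 i * (X t 0 i ^+ a * \prod_(j <- s) X t 0 j)).
Proof.
move=> gX iNs.
have momi := all_moments_coord i gX.
have momX e : all_moments P (fun t => X t 0 i ^+ e).
  elim: e => [|e IH]; first by under eq_fun do rewrite expr0; exact: all_moments_cst.
  by under eq_fun do rewrite exprS; exact: all_momentsM.
have momS := all_moments_polyfun gX (polyfun_prod R s).
have ii e : P.-integrable setT (fun t => (X t 0 i ^+ e * \prod_(j <- s) X t 0 j)%:E).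
  by apply: all_moments_integrable; exact: all_momentsM.
have mi e : measurable_fun setT (fun u : 'rV[R]_n => u 0 i ^+ e * \prod_(j <- s) u 0 j).
  apply: measurable_funM; last exact: measurable_polyfun (polyfun_prod R s).
  by apply: measurable_funX; exact: measurable_mx_coord.
have odd0 e : odd e -> \int[P]_t (X t 0 i ^+ e * \prod_(j <- s) X t 0 j) = 0.
  move=> oe; apply: (integral_flip_odd (i := i) gX (mi e)) => // u.
  rewrite prod_flip coord_flip eqxx expr1 exprMn (count_memPn iNs) expr0 mul1r.
  by rewrite -signr_odd oe expr1 mulN1r mulNr.
under [RHS]eq_Rintegral do rewrite mulrA -exprS.
under eq_Rintegral do rewrite -mulrA.
rewrite RintegralZl//; last exact: ii.
have [oa|ea] := boolP (odd a); last first.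
  rewrite [RHS]odd0 ?oddS//; case: a ea => [|a] ea; first by rewrite mul0r.
  by rewrite odd0 ?mulr0//; move: ea => /=; rewrite negbK.
have -> : a = a./2.*2.+1 by rewrite -[LHS]odd_double_half oa.
rewrite /=; apply/esym.
apply: (gaussian_moment_rec _ gX (polyfun_prod R s)).
by move=> u; exact: prod_zero_coord.
Qed.

Lemma is_derive_monomial n (i : 'I_n) a (s : seq 'I_n) c (u : 'rV[R]_n) : i \notin s ->
  is_derive u (delta_mx 0 i : 'rV[R]_n)
    (fun u : 'rV[R]_n => c * (u 0 i ^+ a * \prod_(j <- s) u 0 j))
    (c * (a%:R * u 0 i ^+ a.-1 * \prod_(j <- s) u 0 j)).
Proof.
move=> iNs; apply: is_derive_line.
under eq_fun => t.
  rewrite shift_coordE eqxx mul1r.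
  rewrite (_ : \prod_(j <- s) _ = \prod_(j <- s) u 0 j); last first.
    rewrite !big_seq; apply: eq_bigr => j js; rewrite shift_coordE.
    by case: eqP => [ij|_]; [rewrite ij js in iNs|rewrite mul0r add0r].
  rewrite mulrCA mulrC; over.
case: a => [|a].
  by under eq_fun do rewrite expr0 mulr1; rewrite !mul0r mulr0; exact: is_derive_cst.
have dg : is_derive (0 : R) 1 (fun t : R => t + u 0 i) 1.
  by apply: is_derive_eq; rewrite addr0.
rewrite (_ : (fun t => _) = (c * \prod_(j <- s) u 0 j) *: (fun t : R => t + u 0 i) ^+ a.+1); last first.
  by apply/funext => t; rewrite !fctE.
have h := is_deriveZ (c * \prod_(j <- s) u 0 j) (is_deriveX a.+1 dg).
apply: (is_derive_eq h); rewrite /GRing.scale/= add0r; ring.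
Qed.

(** The extra monomial makes the induction on [f] go through: each coordinate factor of [f] is moved
    into it, into the power [a] if it is [i] and into [s] otherwise, until a constant remains and
    [stein_monomial] applies. *)
Lemma stein_poly n (X : T -> 'rV[R]_n) (i : 'I_n) k (f : 'rV[R]_n -> R) :
  gaussian_vec P X -> polyfun k f -> forall a (s : seq 'I_n), i \notin s ->
  exists g : 'rV[R]_n -> R, [/\
    forall u, is_derive u (delta_mx 0 i : 'rV[R]_n)
      (fun u : 'rV[R]_n => f u * (u 0 i ^+ a * \prod_(j <- s) u 0 j)) (g u),
    P.-integrable setT (fun t => (g (X t))%:E) &
    \int[P]_t g (X t) =
    \int[P]_t (X t 0 i * (f (X t) * (X t 0 i ^+ a * \prod_(j <- s) X t 0 j)))].
Proof.
move=> gX; have momi := all_moments_coord i gX.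
have momX e : all_moments P (fun t => X t 0 i ^+ e).
  elim: e => [|e IH]; first by under eq_fun do rewrite expr0; exact: all_moments_cst.
  by under eq_fun do rewrite exprS; exact: all_momentsM.
have momS s := all_moments_polyfun gX (polyfun_prod R s).
elim=> {k f} [k|k c|k l f fk IH|k f g fk IHf gk IHg] a s iNs.
- exists (fun=> 0); split => [u||].
  + by under eq_fun do rewrite mul0r; exact: is_derive_cst.
  + exact: all_moments_integrable (all_moments_cst _ _).
  + by apply: eq_Rintegral => t _; rewrite mul0r mulr0.
- exists (fun u => c * (a%:R * u 0 i ^+ a.-1 * \prod_(j <- s) u 0 j)); split => [u||].
  + exact: is_derive_monomial.
  + apply: all_moments_integrable; apply: all_momentsM; first exact: all_moments_cst.
    by apply: all_momentsM => //; apply: all_momentsM => //; exact: all_moments_cst.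
  + rewrite RintegralZl//; last first.
      apply: all_moments_integrable.
      by apply: all_momentsM => //; apply: all_momentsM => //; exact: all_moments_cst.
    rewrite stein_monomial// -RintegralZl//.
      by apply: eq_Rintegral => t _; ring.
    by apply: all_moments_integrable; apply: all_momentsM => //; exact: all_momentsM.
- have [->|li] := eqVneq l i.
    have [g [dg gi gE]] := IH a.+1 s iNs.
    exists g; split => //.
      by move=> u; have := dg u; congr is_derive; apply/funext => v; rewrite exprS; ring.
    by rewrite gE; apply: eq_Rintegral => t _; rewrite exprS; ring.
  have [|g [dg gi gE]] := IH a (l :: s); first by rewrite inE negb_or eq_sym li.
  exists g; split => //.
    by move=> u; have := dg u; congr is_derive; apply/funext => v; rewrite big_cons; ring.
  by rewrite gE; apply: eq_Rintegral => t _; rewrite big_cons; ring.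
have [f' [df f'i f'E]] := IHf a s iNs; have [g' [dg g'i g'E]] := IHg a s iNs.
exists (fun u => f' u + g' u); split => [u||].
- have := is_deriveD (df u) (dg u); congr is_derive.
  by apply/funext => v; rewrite !fctE; ring.
- exact: integrableDR.
rewrite RintegralD// f'E g'E -RintegralD//.
- by apply: eq_Rintegral => t _; ring.
- apply: all_moments_integrable; apply: all_momentsM => //.
  by apply: all_momentsM; [exact: all_moments_polyfun fk|exact: all_momentsM].
- apply: all_moments_integrable; apply: all_momentsM => //.
  by apply: all_momentsM; [exact: all_moments_polyfun gk|exact: all_momentsM].
Qed.

Lemma stein n (X : T -> 'rV[R]_n) (i : 'I_n) k (f g : 'rV[R]_n -> R) :
  gaussian_vec P X -> polyfun k f ->
  (forall u, is_derive u (delta_mx 0 i : 'rV[R]_n) f (g u)) ->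
  \int[P]_t g (X t) = \int[P]_t (X t 0 i * f (X t)).
Proof.
move=> gX fk dg; have [//|h [dh _ hE]] := stein_poly gX fk 0 (s := [::]) (i := i).
rewrite (_ : g = h).
  by rewrite hE; apply: eq_Rintegral => t _; rewrite expr0 big_nil !mulr1.
apply/funext => u; have [_ <-] := dg u; have [_ <-] := dh u; congr derive.
by apply/funext => v; rewrite expr0 big_nil !mulr1.
Qed.

(** The sign in the definition of [hermite] cancels the sign of the leading monomial, so the latter
    appears with a positive coefficient. *)
Lemma hermite_polyfun n k (t : k.-tuple 'I_n) :
  exists2 l : 'rV[R]_n -> R, polyfun k l & forall u, hermite u t =
    (Num.sqrt k`!%:R)^-1 * (\prod_(j <- t) u 0 j + l u).
Proof.
have [q [l [qk lk qE E]]] := iter_partial_gauss_pdf R t; rewrite size_tuple in lk qE.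
exists (fun u => (-1) ^+ k * l u) => [|u]; first exact: polyfunZ.
rewrite /hermite E mulrC [gauss_pdf u * _]mulrC mulfK ?gt_eqF ?gauss_pdf_gt0//.
rewrite mulrA [q u * _]mulrC qE mulrC; congr (_ * _).
by rewrite mulrDr mulrA -exprD addnn -mul2n exprM sqrrN !expr1n mul1r.
Qed.

(** The outermost derivative leaves, up to a constant, [d_i q - u_i q], whose mean is zero by
    Stein's identity. *)
Lemma integral_hermite n (X : T -> 'rV[R]_n) k (t : k.-tuple 'I_n) :
  gaussian_vec P X -> (0 < k)%N -> \int[P]_w hermite (X w) t = 0.
Proof.
move=> gX; case: k t => // k t _; case/tupleP: t => i t.
have [q [l [qk lk qE E]]] := iter_partial_gauss_pdf R t.
have [g gk dg] := is_derive_polyfun i qk.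
have hE (u : 'rV[R]_n) : hermite u [tuple of i :: t] =
    (-1) ^+ k.+1 / Num.sqrt k.+1`!%:R * (g u - u 0 i * q u).
  rewrite /hermite /= E; congr (_ * _); rewrite /partial.
  have := is_deriveM (is_derive_gauss_pdf i u) (dg u) => -[_ ->].
  by rewrite /GRing.scale/=; field; rewrite gt_eqF ?gauss_pdf_gt0.
under eq_Rintegral do rewrite hE.
have momi := all_moments_coord i gX.
have ig := all_moments_integrable (all_moments_polyfun gX gk).
have iq : P.-integrable setT (fun w => (X w 0 i * q (X w))%:E).
  by apply: all_moments_integrable; apply: all_momentsM => //; exact: all_moments_polyfun qk.
rewrite RintegralZl//; last exact: (integrableB measurableT ig iq).
by rewrite RintegralB// (stein gX qk dg) subrr mulr0.
Qed.

Lemma hermite1E n (u : 'rV[R]_n) i : hermite u [tuple i] = u 0 i.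
Proof.
rewrite /hermite /= /partial; have [_ ->] := is_derive_gauss_pdf i u.
rewrite (_ : 1`!%:R = 1 :> R)// sqrtr1 divr1 expr1 mulfK ?gt_eqF ?gauss_pdf_gt0//; ring.
Qed.

Lemma hermite2E n (u : 'rV[R]_n) i :
  hermite u [tuple i; i] = (Num.sqrt 2)^-1 * (u 0 i ^+ 2 - 1).
Proof.
have dc : is_derive u (delta_mx 0 i : 'rV[R]_n) (fun v : 'rV[R]_n => - v 0 i) (-1).
  apply: is_derive_line; under eq_fun do rewrite shift_coordE eqxx mul1r.
  by apply: is_derive_eq; rewrite addr0.
rewrite /hermite /= (_ : partial i (@gauss_pdf R n) = fun v => - v 0 i * gauss_pdf v); last first.
  by apply/funext => v; rewrite /partial; have [_ ->] := is_derive_gauss_pdf i v.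
rewrite /partial; have [_ ->] := is_deriveM dc (is_derive_gauss_pdf i u).
by rewrite /GRing.scale/= sqrrN expr1n div1r; congr (_ * _); field; rewrite gt_eqF ?gauss_pdf_gt0.
Qed.

End Stein.

(** * Conditional expectation and leap decompositions *)

Section NullSets.
Context d (T : measurableType d) (R : realType) (P : probability T R).

(** This turns a vanishing level into a null event: one looks for an event of the conditioning
    variable on which the integrated function of U is positive. *)
Lemma pos_integral_null (D : set T) (f : T -> R) :
  measurable D -> P.-integrable setT (fun t => (f t)%:E) ->
  {ae P, forall t, D t -> 0 < f t} ->
  (\int[P]_(t in D) (f t)%:E <= 0)%E -> P D = 0%E.
Proof.
move=> mD fiT f0 fle0.
have fi : P.-integrable D (fun t => (f t)%:E) by exact: integrableS fiT.
have mfD := measurable_int _ fi.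
have : (\int[P]_(t in D) `|(f t)%:E| = 0)%E.
  apply/eqP; rewrite eq_le integral_ge0 ?andbT//.
  rewrite (ae_eq_integral (fun t => (f t)%:E))//.
    exact: measurableT_comp.
  by apply: filterS f0 => t h Dt; rewrite gee0_abs// lee_fin ltW// h.
move=> /(ae_eq_integral_abs _ mD mfD) fz.
have [N [mN N0 sub]] : {ae P, forall t, ~ D t}.
  by move: f0 fz; apply: filterS2 => t h1 h2 Dt; have := h2 Dt; case=> /eqP; rewrite gt_eqF ?h1.
apply/eqP; rewrite eq_le measure_ge0 andbT -N0; apply: le_measure; rewrite ?inE//.
by move=> t Dt; apply: sub => /= /(_ Dt).
Qed.

Lemma ae_eq_measure (A B : set T) : measurable A -> measurable B ->
  {ae P, forall t, A t <-> B t} -> P A = P B.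
Proof.
suff H (C D : set T) : measurable C -> measurable D ->
    {ae P, forall t, C t <-> D t} -> (P C <= P D)%E.
  move=> mA mB AB; apply/eqP; rewrite eq_le H//=; apply: H => //.
  by apply: filterS AB => t; exact: iff_sym.
move=> mC mD [N [mN N0 sub]].
have CDN : C `<=` D `|` N.
  by move=> t Ct; have [Dt|nDt] := pselect (D t); [left|right; apply: sub => /= -[/(_ Ct)]].
apply: le_trans (_ : P (D `|` N) <= _)%E.
  by apply: le_measure; rewrite ?inE//; exact: measurableU.
apply: le_trans (measureU2 _ _ _) _ => //.
by rewrite [X in (_ + X)%E]N0 adde0.
Qed.

Lemma ae_null (D : set T) : measurable D -> P D = 0%E -> {ae P, forall t, ~ D t}.
Proof. by move=> mD D0; exists D; split => // t /= /contrapT. Qed.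

Lemma ae_eq_RintegralT (D : set T) (f g : T -> R) : measurable D ->
  measurable_fun setT f -> measurable_fun setT g ->
  {ae P, forall t, f t = g t} -> \int[P]_(t in D) f t = \int[P]_(t in D) g t.
Proof.
move=> mD mf mg fg; rewrite /Rintegral; congr fine; apply: ae_eq_integral => //.
- by apply/measurable_EFinP; exact: measurable_funTS.
- by apply/measurable_EFinP; exact: measurable_funTS.
- by apply: filterS fg => t -> .
Qed.

End NullSets.

Section ConditionalExpectation.
Context d (T : measurableType d) (R : realType) (P : probability T R).
Context d' (E : measurableType d').
Implicit Types (X : T -> R) (W : T -> E) (g : E -> R).

(** The version is the Radon-Nikodym derivative, on the space of values of [W], of the image of the
    charge [X dP] with respect to the law of [W]. *)
Lemma is_cexp_ex X W : measurable_fun setT W ->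
  P.-integrable setT (fun t => (X t)%:E) -> exists g, is_cexp P X W g.
Proof.
move=> mW iX.
pose W' : {mfun T >-> E} := mfun_Sub (mem_set mW : W \in mfun).
pose nu : {charge set T -> \bar R} := induced_charge iX.
pose mu := distribution P W'.
have [nuW nuWE] : exists q : {charge set E -> \bar R}, q = pushforward nu W' :> (set E -> \bar R).
  by unshelve refine (ex_intro _ (pushforward nu W' : {charge set E -> \bar R}) _).
have dom : nuW `<< mu.
  rewrite nuWE; apply: (@dominates_pushforward _ _ _ _ _ P nu W') => //.
  apply/null_content_dominatesP => A mA PA; apply: null_set_integral => //.
  exact: measurable_funTS (measurable_int _ iX).
pose f := Radon_Nikodym nuW mu.
have ffin x : f x \is a fin_num by exact: Radon_Nikodym_fin_num.
have fint : mu.-integrable setT f by exact: Radon_Nikodym_integrable.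
have mf := measurable_int _ fint.
have fE x : (fine (f x))%:E = f x by rewrite fineK.
exists (fun x => fine (f x)); split.
- apply/measurable_EFinP; have -> : EFin \o (fun x => fine (f x)) = f by apply/funext.
  exact: mf.
- under eq_fun do rewrite fE.
  apply/integrableP; split; first exact: (measurableT_comp mf mW).
  move/integrableP : fint => [_]; rewrite ge0_integral_pushforward//.
  exact: measurableT_comp.
move=> B mB; under eq_integral do rewrite fE.
have := Radon_Nikodym_integral dom mB; rewrite -/f => h.
have {h} -> : (\int[P]_(t in W @^-1` B) (X t)%:E = \int[mu]_(x in B) f x)%E.
  by rewrite -h nuWE.
rewrite integral_pushforward//.
apply: (integrableS measurableT) => //; first exact: measurable_preimage.
apply/integrableP; split; first exact: (measurableT_comp mf mW).
move/integrableP : fint => [_]; rewrite ge0_integral_pushforward//.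
exact: measurableT_comp.
Qed.

Lemma cexpP X W : measurable_fun setT W ->
  P.-integrable setT (fun t => (X t)%:E) -> is_cexp P X W (cexp P X W).
Proof.
move=> mW iX; have [g gP] := is_cexp_ex mW iX.
by apply: (@xgetPex _ _ [set g | is_cexp P X W g]); exists g.
Qed.

Lemma is_cexp_lin X1 X2 W g1 g2 a b : measurable_fun setT W ->
  P.-integrable setT (fun t => (X1 t)%:E) -> P.-integrable setT (fun t => (X2 t)%:E) ->
  is_cexp P X1 W g1 -> is_cexp P X2 W g2 ->
  is_cexp P (fun t => a * X1 t + b * X2 t) W (fun x => a * g1 x + b * g2 x).
Proof.
move=> mW i1 i2 [mg1 ig1 e1] [mg2 ig2 e2]; split.
- by apply: measurable_funD; exact: measurable_funM.
- by apply: integrableDR; exact: integrableZR.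
move=> B mB; have mWB := measurable_preimage mW mB.
have s (f : T -> R) : P.-integrable setT (fun t => (f t)%:E) ->
    P.-integrable (W @^-1` B) (fun t => (f t)%:E).
  by apply: integrableS.
have lin (f h : T -> R) : P.-integrable setT (fun t => (f t)%:E) ->
    P.-integrable setT (fun t => (h t)%:E) ->
    (\int[P]_(t in W @^-1` B) (a * f t + b * h t)%:E =
     a%:E * \int[P]_(t in W @^-1` B) (f t)%:E + b%:E * \int[P]_(t in W @^-1` B) (h t)%:E)%E.
  move=> jf jh; under eq_integral do rewrite EFinD !EFinM.
  by rewrite integralD ?integralZl//; try apply: integrableZl => //; exact: s.
by rewrite (lin (fun t => g1 (W t)) (fun t => g2 (W t)))// lin// e1// e2.
Qed.

Lemma measurable_lt_set d0 (U : measurableType d0) (f g : U -> R) :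
  measurable_fun setT f -> measurable_fun setT g -> measurable [set x | f x < g x].
Proof.
move=> mf mg; rewrite (_ : [set x | _] = setT `&` (fun x => f x < g x) @^-1` [set true]).
  exact: (measurable_fun_ltr mf mg).
by rewrite setTI; apply/seteqP; split => x /=.
Qed.

Lemma is_cexp_ge0 X W g : measurable_fun setT W ->
  P.-integrable setT (fun t => (X t)%:E) -> (forall t, 0 <= X t) ->
  is_cexp P X W g -> {ae P, forall t, 0 <= g (W t)}.
Proof.
move=> mW iX X0 [mg ig e].
have mB : measurable [set x | g x < 0].
  by apply: measurable_lt_set.
have mWB := measurable_preimage mW mB.
have : P (W @^-1` [set x | g x < 0]) = 0%E.
  apply: (@pos_integral_null _ _ _ P _ (fun t => - g (W t))) => //.
  - by have := integrableZR (-1) ig; under eq_fun do rewrite mulN1r.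
  - by apply: aeW => t /=; rewrite oppr_gt0.
  under eq_integral do rewrite -mulN1r EFinM.
  rewrite integralZl//; last exact: integrableS ig.
  rewrite e// EFinN mulN1e oppe_le0.
  by apply: integral_ge0 => t _; rewrite lee_fin.
move=> /(ae_null mWB); apply: filterS => t /= /negP; by rewrite -leNgt.
Qed.

Lemma is_cexp_uniq X W g1 g2 : measurable_fun setT W ->
  P.-integrable setT (fun t => (X t)%:E) ->
  is_cexp P X W g1 -> is_cexp P X W g2 -> {ae P, forall t, g1 (W t) = g2 (W t)}.
Proof.
move=> mW iX c1 c2.
have i0 : P.-integrable setT (fun _ : T => (0 : R)%:E) by exact: integrable0.
have c0 a b : a + b = 0 -> is_cexp P (fun=> 0) W (fun x => a * g1 x + b * g2 x).
  move=> ab; have := is_cexp_lin a b mW iX iX c1 c2; congr is_cexp.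
  by apply/funext => t; rewrite -mulrDl ab mul0r.
have h1 := is_cexp_ge0 mW i0 (fun=> lexx _) (c0 1 (-1) (subrr _)).
have h2 := is_cexp_ge0 mW i0 (fun=> lexx _) (c0 (-1) 1 (addNr _)).
by move: h1 h2; apply: filterS2 => t h1 h2; apply/eqP; rewrite eq_le; apply/andP; split; lra.
Qed.

Lemma cexp_ae X W g : measurable_fun setT W ->
  P.-integrable setT (fun t => (X t)%:E) -> is_cexp P X W g ->
  {ae P, forall t, cexp P X W (W t) = g (W t)}.
Proof. by move=> mW iX; apply: is_cexp_uniq => //; exact: cexpP. Qed.

(* Jensen: [2 q X - q^2 <= X^2] for every [q]; taking [q] among the integers loses at most 1. *)
Lemma integrable_cexp_sqr X W : measurable_fun setT W -> all_moments P X ->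
  P.-integrable setT (fun t => (cexp P X W (W t) ^+ 2)%:E).
Proof.
move=> mW mX; have iX := all_moments_integrable mX.
have iX2 := all_moments_integrable (all_momentsM mX mX).
have i1 := all_moments_integrable (all_moments_cst P (1 : R)).
have c := cexpP mW iX; have [h ch] := is_cexp_ex mW iX2.
set g := cexp P X W in c *.
have c1 : is_cexp P (fun=> 1) W (fun=> 1) by split.
have key (q : R) : {ae P, forall t, 2 * q * g (W t) - q ^+ 2 <= h (W t)}.
  have i12 := integrableDR (integrableZR (- (2 * q)) iX) (integrableZR (q ^+ 2) i1).
  have cc := is_cexp_lin 1 1 mW iX2 i12 ch (is_cexp_lin (- (2 * q)) (q ^+ 2) mW iX i1 c c1).
  have i3 := integrableDR (integrableZR 1 iX2) (integrableZR 1 i12).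
  have X0 t : 0 <= 1 * (X t * X t) + 1 * (- (2 * q) * X t + q ^+ 2 * 1).
    have := sqr_ge0 (X t - q); rewrite sqrrB; lra.
  by apply: filterS (is_cexp_ge0 mW i3 X0 cc) => t; lra.
have [mg ig _] := c; have [mh ih _] := ch.
have bd : {ae P, forall t, g (W t) ^+ 2 <= h (W t) + 1}.
  (* Countably many values of [q] leave one common null set; both signs are kept because the sign of
     [g (W t)] varies. *)
  have : {ae P, forall t, forall n : nat, 2 * n%:R * g (W t) - n%:R ^+ 2 <= h (W t) /\
      2 * (- n%:R) * g (W t) - n%:R ^+ 2 <= h (W t)}.
    apply/ae_foralln => n; have := key (- n%:R); have := key n%:R.
    by apply: filterS2 => t; rewrite sqrrN.
  apply: filterS => t hn.
  pose n := Num.trunc `|g (W t)|.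
  have /andP[n1 n2] : n%:R <= `|g (W t)| < n.+1%:R by apply: trunc_itv.
  have [h1 h2] := hn n; move: n1 n2; rewrite -natr1.
  case: (ger0P (g (W t))) => g0 n1 n2.
    have : (g (W t) - n%:R) ^+ 2 <= 1 by rewrite -[leRHS](expr1n _ 2) lerXn2r ?nnegrE//; lra.
    rewrite sqrrB; lra.
  have : (- g (W t) - n%:R) ^+ 2 <= 1 by rewrite -[leRHS](expr1n _ 2) lerXn2r ?nnegrE//; lra.
  rewrite sqrrB sqrrN; lra.
have mg2 : measurable_fun setT (fun t => g (W t) ^+ 2).
  by apply: measurable_funX; exact: measurableT_comp.
apply/integrableP; split; first exact/measurable_EFinP.
have ih1 := integrableDR ih i1.
have : (\int[P]_t `|(h (W t) + 1)%:E| < +oo)%E by move/integrableP : ih1 => [].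
apply: le_lt_trans; apply: ae_ge0_le_integral => //.
- by apply: measurableT_comp => //; exact/measurable_EFinP.
- by apply: measurableT_comp => //; exact: measurable_int ih1.
apply: filterS bd => t ht _; rewrite !abse_EFin lee_fin ger0_norm ?sqr_ge0//.
exact: le_trans ht (ler_norm _).
Qed.

End ConditionalExpectation.

Section OrthogonalProjection.
Variables (R : realType) (n : nat).
Implicit Types (S : 'M[R]_n) (z : 'rV[R]_n).

Lemma frame_perp S : frame S *m (frame (perp S))^T = 0.
Proof.
have : (frame (perp S) <= perp S)%MS by rewrite eq_frame.
move=> /sub_kermxP h.
have /submxP[D ->] : (frame S <= S)%MS by rewrite eq_frame.
have e : S *m (frame (perp S))^T = (frame (perp S) *m S^T)^T by rewrite trmx_mul trmxK.
by rewrite -mulmxA e h trmx0 mulmx0.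
Qed.

Lemma cap_perp S : (S :&: perp S)%MS = 0.
Proof.
apply/eqP; rewrite -submx0; apply/rV_subP => v; rewrite sub_capmx => /andP[vS /sub_kermxP vP].
have /submxP[a va] : (v <= frame S)%MS by rewrite eq_frame.
have /submxP[D FD] : (frame S <= S)%MS by rewrite eq_frame.
have : v *m (frame S)^T = 0 by rewrite FD trmx_mul mulmxA vP mul0mx.
by rewrite va -mulmxA frame_orthonormal mulmx1 => ->; rewrite mul0mx sub0mx.
Qed.

Lemma rank_perp S : (\rank (perp S) + \rank S = n)%N.
Proof. by rewrite mxrank_ker mxrank_tr subnK// rank_leq_col. Qed.

Lemma sub_perp m (A : 'M[R]_(m, n)) S : A *m (frame S)^T = 0 -> (A <= perp S)%MS.
Proof.
move=> h; apply/sub_kermxP.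
have /submxP[D ->] : (S <= frame S)%MS by rewrite eq_frame.
by rewrite trmx_mul mulmxA h mul0mx.
Qed.

(** Replaces the projection along a complement by a product with orthonormal rows, the form in which
    rotation invariance applies. *)
Lemma oprojE S z : oproj S z = z *m (frame S)^T *m frame S.
Proof.
have zE : z = z *m (frame S)^T *m frame S + (z - z *m (frame S)^T *m frame S).
  by rewrite addrC subrK.
rewrite /oproj {1}zE mulmxDl proj_mx_id ?cap_perp//; last first.
  by apply: submx_trans (submxMl _ _) _; rewrite eq_frame.
rewrite proj_mx_0 ?addr0 ?cap_perp//.
apply: sub_perp; rewrite mulmxBl -[X in _ - X]mulmxA frame_orthonormal mulmx1.
by rewrite subrr.
Qed.

Lemma frame_decomposition S z :
  z = z *m (frame S)^T *m frame S + z *m (frame (perp S))^T *m frame (perp S).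
Proof.
set F := frame S; set G := frame (perp S).
have : (z - z *m F^T *m F <= G)%MS.
  rewrite eq_frame; apply: sub_perp.
  by rewrite mulmxBl -[X in _ - X]mulmxA frame_orthonormal mulmx1 subrr.
move=> /submxP[b bE].
have : b = z *m G^T.
  have <- : b *m G *m G^T = b by rewrite -mulmxA /G frame_orthonormal mulmx1.
  by rewrite -bE mulmxBl -!mulmxA frame_perp !mulmx0 subr0.
by move=> <-; rewrite -bE addrC subrK.
Qed.

Lemma frames_orthonormal S :
  col_mx (frame S) (frame (perp S)) *m (col_mx (frame S) (frame (perp S)))^T = 1%:M.
Proof.
rewrite tr_col_mx mul_col_row !frame_orthonormal frame_perp.
rewrite -[frame (perp S) *m _]trmxK trmx_mul trmxK frame_perp trmx0.
by rewrite -scalar_mx_block.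
Qed.

End OrthogonalProjection.

(** * Existence and growth of leap decompositions *)

Section LeapExistence.
Variables (R : realType) (r : nat).
Variables (lam : 'M[R]_r -> nat -> \bar R) (spn : 'M[R]_r -> nat -> 'M[R]_r).

Lemma leap_exponent_le K :
  (forall S k, ~~ row_full S -> (1 <= k)%N -> (0 < lam S k)%E ->
    (\rank S < \rank (S + spn S k)%MS)%N) ->
  (forall S, ~~ row_full S -> exists k, [/\ (1 <= k)%N, (k <= K)%N & (0 < lam S k)%E]) ->
  exists2 e, leap_exponent lam spn e & (e <= K)%N.
Proof.
move=> grow pos.
have lev S : ~~ row_full S -> exists k, first_level lam S k /\ (k <= K)%N.
  move=> fS; have [k0 [k1 kK kl]] := pos S fS.
  have ex : exists k, (1 <= k)%N && (0 < lam S k)%E by exists k0; rewrite k1 kl.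
  case: (ex_minnP ex) => k /andP[k1' kl'] kmin.
  exists k; split; last by apply: leq_trans (kmin _ _) kK; rewrite k1 kl.
  by split => // j j1 jl; apply: kmin; rewrite j1 jl.
(* The default 0 can only occur at a full [S], which is not reached before step [L]. *)
pose lv S := xget 0%N [set k | first_level lam S k /\ (k <= K)%N].
have lvP S : ~~ row_full S -> first_level lam S (lv S) /\ (lv S <= K)%N.
  move=> /lev[k kP]; exact: (@xgetPex _ 0%N [set k | first_level lam S k /\ (k <= K)%N]) (ex_intro _ k kP).
pose Sq i := iter i (fun S => (S + spn S (lv S))%MS) 0.
have full : exists L, row_full (Sq L).
  apply: contrapT => nfull.
  have nf i : ~~ row_full (Sq i) by apply/negP => h; apply: nfull; exists i.
  (* Each step raises the rank by at least one, so step [r.+1] would exceed the dimension. *)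
  have rk i : (i <= \rank (Sq i))%N.
    elim: i => // i IH; apply: leq_ltn_trans IH _.
    by have [[k1 kl _] _] := lvP _ (nf i); exact: grow.
  by have := rk r.+1; rewrite leqNgt ltnS rank_leq_col.
case: (ex_minnP full) => L fL Lmin.
have nf i : (i < L)%N -> ~~ row_full (Sq i).
  by move=> iL; apply/negP => /Lmin; rewrite leqNgt iL.
(* The level numbered [i] is chosen at the subspace numbered [i - 1]. *)
exists (\max_(1 <= i < L.+1) lv (Sq i.-1)).
  exists L, Sq, (fun i => lv (Sq i.-1)); split => //; split => //.
  by move=> i /nf/lvP[].
apply/bigmax_leqP_seq => i; rewrite mem_index_iota => /andP[i1 iL] _.
by have [|//] := lvP (Sq i.-1); apply: nf; case: i i1 iL.
Qed.

Lemma leap_exponent_gt0 e : (0 < r)%N -> leap_exponent lam spn e -> (0 < e)%N.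
Proof.
move=> r0 [L [S [k [D ->]]]]; case: L D => [|L] D.
  by have := leap_end D; rewrite (leap_start D) /row_full mxrank0 eq_sym -leqn0 leqNgt r0.
have [k1 _ _] := leap_level D (ltn0Sn L).
rewrite big_ltn//; apply: leq_trans k1 _; exact: leq_maxl.
Qed.

End LeapExistence.

Section LeapGrowth.
Context (R : realType) d (T : measurableType d) (P : probability T R).

Lemma frobenius_expectation_gt0 k m (z : T -> tensor R k m) :
  (forall t, measurable_fun setT (fun w => z w t)) ->
  (0 < 'E_P[fun w => frobenius2 (z w)])%E ->
  exists t, (0 < \int[P]_w (z w t ^+ 2)%:E)%E.
Proof.
move=> mz; rewrite unlock /frobenius2 /=.
under eq_integral do rewrite -sumEFin.
rewrite ge0_integral_sum//; last 2 first.
- by move=> t; apply/measurable_EFinP; exact: measurable_funX.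
- by move=> t w _; rewrite lee_fin sqr_ge0.
move=> h; apply: contrapT => /forallNP H.
move: h; rewrite big1 ?ltxx// => t _.
have := H t; move=> /negP; rewrite -leNgt => le0; apply/eqP; rewrite eq_le le0/=.
by apply: integral_ge0 => w _; rewrite lee_fin sqr_ge0.
Qed.

Lemma frobenius_expectation_eq0 k m (z : T -> tensor R k m) :
  (forall t, measurable_fun setT (fun w => z w t)) ->
  ~ (0 < 'E_P[fun w => frobenius2 (z w)])%E ->
  forall t, {ae P, forall w, z w t = 0}.
Proof.
move=> mz n t.
have mzt : measurable_fun setT (fun w => z w t ^+ 2) by exact: measurable_funX.
have [N [mN N0 sub]] : {ae P, forall w, setT w -> (z w t ^+ 2)%:E = 0%E}.
  apply/(ae_eq_integral_abs P measurableT); first exact/measurable_EFinP.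
  under eq_integral do rewrite gee0_abs ?lee_fin ?sqr_ge0//.
  apply/eqP; rewrite eq_le integral_ge0 ?andbT; last by move=> w _; rewrite lee_fin sqr_ge0.
  rewrite leNgt; apply/negP => h; apply: n; apply: lt_le_trans h _.
  rewrite unlock; apply: ge0_le_integral => //.
  - by move=> w _; rewrite lee_fin sqr_ge0.
  - exact/measurable_EFinP.
  - by apply/measurable_EFinP; apply: measurable_sum => s; exact: measurable_funX.
  move=> w _; rewrite lee_fin /frobenius2 (bigD1 t)//= lerDl.
  by apply: sumr_ge0 => s _; exact: sqr_ge0.
exists N; split => // w /= wz; apply: sub => /= /(_ I) [] /eqP; rewrite sqrf_eq0 => /eqP.
exact: wz.
Qed.

(** The entry of the second-moment tensor at the concatenation of [t] with itself is the second
    moment of entry [t]. Its finiteness is needed because [fine] sends an infinite value to 0. *)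
Lemma tensor_span_neq0 k m (z : T -> tensor R k.+1 m) t :
  P.-integrable setT (fun w => (z w t ^+ 2)%:E) ->
  (0 < \int[P]_w (z w t ^+ 2)%:E)%E ->
  tensor_span (fun s : (k.+1 + k.+1).-tuple 'I_m =>
    fine 'E_P[fun w => tensor_prod (z w) (z w) s]) != 0.
Proof.
move=> zi zp; rewrite /= ; apply/eqP => /eqP.
rewrite -mxrank_eq0 genmxE mxrank_tr mxrank_eq0 => /eqP/matrixP A0.
have {A0} E0 s : fine 'E_P[fun w => tensor_prod (z w) (z w) s] = 0.
  have [i [s' ->]] : exists i s', s = cons_tuple i s'.
    by case/tupleP: s => i s'; exists i, s'; apply: val_inj.
  by have := A0 i (enum_rank s'); rewrite !mxE enum_rankK.
have := E0 (cat_tuple t t).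
have -> : ('E_P[fun w => tensor_prod (z w) (z w) (cat_tuple t t)] = \int[P]_w (z w t ^+ 2)%:E)%E.
  rewrite unlock; apply: eq_integral => w _; rewrite /tensor_prod expr2; congr (_ * _)%:E.
    congr z; apply: eq_from_tnth => i; rewrite tnth_mktuple.
    exact: tnth_lshift.
  congr z; apply: eq_from_tnth => i; rewrite tnth_mktuple.
  exact: tnth_rshift.
by move/eqP; rewrite gt_eqF// fine_gt0// zp/= integrable_lty.
Qed.

(** The image of [V] lies in the orthogonal complement of [S], and it is nonzero because the rows of
    the frame are orthonormal. *)
Lemma rank_in_ambient r (S : 'M[R]_r) (V : 'M[R]_(perp_dim S)) :
  V != 0 -> (\rank S < \rank (S + in_ambient V)%MS)%N.
Proof.
move=> V0; have sub : (in_ambient V <= perp S)%MS.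
  by rewrite /in_ambient genmxE; apply: submx_trans (submxMl _ _) _; rewrite eq_frame.
have c0 : (S :&: in_ambient V)%MS = 0.
  apply/eqP; rewrite -submx0 -(cap_perp S).
  by rewrite sub_capmx capmxSl (submx_trans (capmxSr _ _) sub).
rewrite mxrank_disjoint_sum// -[X in (X < _)%N]addn0 ltn_add2l lt0n mxrank_eq0.
apply: contra V0; rewrite /in_ambient -mxrank_eq0 genmxE mxrank_eq0 => /eqP h.
by rewrite -[V]mulmx1 -(frame_orthonormal (perp S)) mulmxA h mul0mx.
Qed.

Lemma leap_growth r (S : 'M[R]_r) k (z : T -> tensor R k (perp_dim S)) :
  (1 <= k)%N -> (forall t, measurable_fun setT (fun w => z w t)) ->
  (forall t, P.-integrable setT (fun w => (z w t ^+ 2)%:E)) ->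
  (0 < 'E_P[fun w => frobenius2 (z w)])%E ->
  (\rank S < \rank (S + in_ambient (tensor_span (fun s : (k + k).-tuple _ =>
     fine 'E_P[fun w => tensor_prod (z w) (z w) s])))%MS)%N.
Proof.
case: k z => // k z _ mz zi /(frobenius_expectation_gt0 mz)[t tp].
by apply: rank_in_ambient; exact: tensor_span_neq0 (zi t) tp.
Qed.

End LeapGrowth.

(** * The projections of a sample and the meaning of a vanishing level *)

Section Samples.
Variables (R : realType) (r : nat).
Local Notation sample := ('rV[R]_r * measurableTypeR R)%type.
Variable P : probability sample R.
Hypothesis hZ : std_gaussian (pushforward P fst).
Implicit Types (S : 'M[R]_r) (w : sample).

Lemma gaussian_fst : gaussian_vec P (fun w => w.1 : 'rV[R]_r).
Proof. by split => //; exact: measurable_fst. Qed.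

Lemma ZbarE S w : Zbar S w = w.1 *m (frame (perp S))^T.
Proof. by rewrite /Zbar oprojE -mulmxA frame_orthonormal mulmx1. Qed.

Lemma ZparE S w : Zpar S w = w.1 *m (frame S)^T *m frame S.
Proof. exact: oprojE. Qed.

Lemma fst_decomposition S w : w.1 = Zpar S w + Zbar S w *m frame (perp S).
Proof. by rewrite ZbarE ZparE; exact: frame_decomposition. Qed.

Lemma gaussian_Zbar S : gaussian_vec P (Zbar S).
Proof.
rewrite (funext (ZbarE S)).
by apply: (gaussian_vec_orthonormal (frame_orthonormal _)); exact: gaussian_fst.
Qed.

Lemma measurable_Zpar S : measurable_fun setT (Zpar S : sample -> _).
Proof.
rewrite (_ : Zpar S = fun w => w.1 *m ((frame S)^T *m frame S)).
  exact: measurable_mulmx measurable_fst.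
by apply/funext => w; rewrite ZparE mulmxA.
Qed.

Lemma measurable_Ybar S : measurable_fun setT (Ybar S : sample -> _).
Proof.
by apply: measurable_fun_pair; [exact: measurable_Zpar|exact: measurable_snd].
Qed.

(** The frames of S and of its complement, stacked, have orthonormal rows, so the two coordinate
    vectors are complementary blocks of one standard Gaussian vector. *)
Lemma independent_Zpar_Zbar S : independent P (Zpar S) (Zbar S).
Proof.
have gX : gaussian_vec P (fun w => row_mx (w.1 *m (frame S)^T) (w.1 *m (frame (perp S))^T)).
  have := gaussian_vec_orthonormal (frames_orthonormal S) gaussian_fst.
  by congr gaussian_vec; apply/funext => w; rewrite tr_col_mx mul_mx_row.
have := gaussian_vec_split gX.
rewrite (_ : (fun t => lsubmx _) = (fun w => w.1 *m (frame S)^T)); last first.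
  by apply/funext => w; rewrite row_mxKl.
rewrite (_ : (fun t => rsubmx _) = Zbar S); last first.
  by apply/funext => w; rewrite row_mxKr ZbarE.
have mm : measurable_fun setT (fun x : 'rV[R]_(\rank S) => x *m frame S).
  exact: (measurable_mulmx (frame S) (@measurable_id _ _ setT)).
move=> /(independent_comp mm (@measurable_id _ _ setT)).
by congr independent; apply/funext => w; rewrite /= ?ZparE.
Qed.

(** If Y is almost surely a function of Z_S, then so is [Ybar S], and Z_S is independent of the
    projection on the complement. *)
Lemma intrinsic_dimension_contra S (f : 'rV[R]_r -> R) :
  intrinsic_dimension P -> ~~ row_full S -> measurable_fun setT f ->
  {ae P, forall w, w.2 = f (Zpar S w)} -> False.
Proof.
move=> hdim pS mf hf; apply: hdim; exists S => // A B mA mB.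
pose g (x : 'rV[R]_r) : sample := (x, f x).
have mg : measurable_fun setT g by apply: measurable_fun_pair.
have mA' : measurable_fun setT (fun w : sample => oproj (perp S) w.1).
  rewrite (_ : (fun w => _) = Zpar (perp S))//; exact: measurable_Zpar.
have mgZ : measurable_fun setT (g \o Zpar S) by apply: measurableT_comp => //; exact: measurable_Zpar.
have E : {ae P, forall w, Ybar S w = g (Zpar S w)}.
  by apply: filterS hf => w h; rewrite /Ybar /g h.
have -> : P (Ybar S @^-1` B) = P ((g \o Zpar S) @^-1` B).
  apply: ae_eq_measure; [exact: measurable_preimage (measurable_Ybar S) mB|exact: measurable_preimage|].
  by apply: filterS E => w /= ->.
rewrite (@ae_eq_measure _ _ _ P (_ `&` _) ((fun w : sample => oproj (perp S) w.1) @^-1` A `&` (g \o Zpar S) @^-1` B)); last 3 first.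
- by apply: measurableI; [exact: measurable_preimage|exact: measurable_preimage (measurable_Ybar S) mB].
- by apply: measurableI; exact: measurable_preimage.
- by apply: filterS E => w /= ->.
have mm : measurable_fun setT (fun x : 'rV[R]_(perp_dim S) => x *m frame (perp S)).
  exact: (measurable_mulmx (frame (perp S)) (@measurable_id _ _ setT)).
have := independent_comp mg mm (independent_Zpar_Zbar (S := S)) mB mA.
rewrite setIC muleC => h; rewrite (_ : (fun w => oproj _ _) = (fun x => x *m frame (perp S)) \o Zbar S)//.
by apply/funext => w; rewrite /= ZbarE oprojE.
Qed.

Lemma all_moments_hermite S k (t : k.-tuple 'I_(perp_dim S)) :
  all_moments P (fun w => hermite (Zbar S w) t).
Proof.
have [l lk hE] := hermite_polyfun R t.
have h : polyfun k.+1 (fun u : 'rV[R]_(perp_dim S) => hermite u t).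
  rewrite (funext hE); apply: polyfunZ; apply: polyfunD; last exact: polyfunW lk.
  by have := polyfun_prod R t; rewrite size_tuple.
exact: all_moments_polyfun (gaussian_Zbar S) h.
Qed.

Section Zeta.
Variables (S : 'M[R]_r) (k : nat).

Lemma zeta_cexp (t : k.-tuple 'I_(perp_dim S)) :
  is_cexp P (fun w => hermite (Zbar S w) t) (Ybar S) (fun y => zeta P y t).
Proof.
apply: cexpP; first exact: measurable_Ybar.
exact: all_moments_integrable (all_moments_hermite t).
Qed.

Lemma measurable_zeta (t : k.-tuple 'I_(perp_dim S)) :
  measurable_fun setT (fun w => zeta P (Ybar S w) t).
Proof. by have [h _ _] := zeta_cexp t; exact: measurableT_comp h (measurable_Ybar S). Qed.

Lemma integrable_zeta_sqr (t : k.-tuple 'I_(perp_dim S)) :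
  P.-integrable setT (fun w => (zeta P (Ybar S w) t ^+ 2)%:E).
Proof.
exact: integrable_cexp_sqr (measurable_Ybar S) (all_moments_hermite t).
Qed.

(** The form in which a vanishing level is used: conditional expectations no longer appear. *)
Lemma lambda2_eq0 : ~ (0 < lambda2 P S k)%E ->
  forall (t : k.-tuple 'I_(perp_dim S)) B, measurable B ->
  (\int[P]_(w in Ybar S @^-1` B) (hermite (Zbar S w) t)%:E = 0)%E.
Proof.
move=> l0 t B mB; have [mg ig e] := zeta_cexp t; rewrite -e//.
have z0 := frobenius_expectation_eq0 measurable_zeta l0 t.
have mYB := measurable_preimage (measurable_Ybar S) mB.
rewrite (ae_eq_integral (cst 0%E))//; first by rewrite integral0.
- by apply/measurable_EFinP; apply: measurable_funTS; exact: measurable_zeta.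
- by apply: filterS z0 => w -> .
Qed.

End Zeta.

Lemma gen_leap_le K :
  (forall S, ~~ row_full S -> exists k, [/\ (1 <= k)%N, (k <= K)%N & (0 < lambda2 P S k)%E]) ->
  exists2 e, gen_leap_exponent P e & (e <= K)%N.
Proof.
move=> h; apply: leap_exponent_le => // S k pS k1 kl.
apply: leap_growth k1 _ _ kl; first exact: measurable_zeta.
exact: integrable_zeta_sqr.
Qed.

Section InfoZeta.
(** Makes [Y h_k] square integrable, so that [izeta] is a genuine conditional expectation with
    finite second moments. *)
Hypothesis mY : all_moments P (fun w => w.2 : R).
Variables (S : 'M[R]_r) (k : nat).

Lemma all_moments_Y_hermite (t : k.-tuple 'I_(perp_dim S)) :
  all_moments P (fun w => w.2 * hermite (Zbar S w) t).
Proof. by apply: all_momentsM => //; exact: all_moments_hermite. Qed.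

Lemma izeta_cexp (t : k.-tuple 'I_(perp_dim S)) :
  is_cexp P (fun w => w.2 * hermite (Zbar S w) t) (Zpar S) (fun x => izeta P x t).
Proof.
apply: cexpP; first exact: measurable_Zpar.
exact: all_moments_integrable (all_moments_Y_hermite t).
Qed.

Lemma measurable_izeta (t : k.-tuple 'I_(perp_dim S)) :
  measurable_fun setT (fun w => izeta P (Zpar S w) t).
Proof. by have [h _ _] := izeta_cexp t; exact: measurableT_comp h (measurable_Zpar S). Qed.

Lemma integrable_izeta_sqr (t : k.-tuple 'I_(perp_dim S)) :
  P.-integrable setT (fun w => (izeta P (Zpar S w) t ^+ 2)%:E).
Proof.
exact: integrable_cexp_sqr (measurable_Zpar S) (all_moments_Y_hermite t).
Qed.

Lemma ilambda2_eq0 : ~ (0 < ilambda2 P S k)%E ->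
  forall (t : k.-tuple 'I_(perp_dim S)) B, measurable B ->
  (\int[P]_(w in Zpar S @^-1` B) (w.2 * hermite (Zbar S w) t)%:E = 0)%E.
Proof.
move=> l0 t B mB; have [mg ig e] := izeta_cexp t; rewrite -e//.
have z0 := frobenius_expectation_eq0 measurable_izeta l0 t.
have mYB := measurable_preimage (measurable_Zpar S) mB.
rewrite (ae_eq_integral (cst 0%E))//; first by rewrite integral0.
- by apply/measurable_EFinP; apply: measurable_funTS; exact: measurable_izeta.
- by apply: filterS z0 => w -> .
Qed.

End InfoZeta.

Lemma info_leap_le K : all_moments P (fun w => w.2 : R) ->
  (forall S, ~~ row_full S -> exists k, [/\ (1 <= k)%N, (k <= K)%N & (0 < ilambda2 P S k)%E]) ->
  exists2 e, info_leap_exponent P e & (e <= K)%N.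
Proof.
move=> mY h; apply: leap_exponent_le => // S k pS k1 kl.
apply: leap_growth k1 _ _ kl; first exact: measurable_izeta.
exact: integrable_izeta_sqr.
Qed.

End Samples.

(** * Polynomials and intersections of half-spaces *)

Section PolynomialBounds.
Variable R : realType.

Lemma polyfunM n k l (f g : 'rV[R]_n -> R) : polyfun k f -> polyfun l g ->
  exists j, polyfun j (fun u => f u * g u).
Proof.
move=> pf pg; elim: pf => {k f} [k|k c|k i f pf [j IH]|k f1 f2 pf1 [j1 IH1] pf2 [j2 IH2]].
- exists 0%N; rewrite (_ : (fun _ => _) = fun=> 0); first exact: polyfun0.
  by apply/funext => u; rewrite mul0r.
- by exists l; exact: polyfunZ.
- exists j.+1; rewrite (_ : (fun _ => _) = fun u : 'rV[R]_n => u 0 i * (f u * g u)).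
    exact: polyfun_coordM.
  by apply/funext => u; rewrite mulrA.
- exists (maxn j1 j2); rewrite (_ : (fun _ => _) = fun u => f1 u * g u + f2 u * g u).
    by apply: polyfunD; [apply: polyfunW IH1|apply: polyfunW IH2]; rewrite ?leq_maxl ?leq_maxr.
  by apply/funext => u; rewrite mulrDl.
Qed.

Lemma polyfun_meval n (q : mpoly.mpoly n R) :
  exists k, polyfun k (fun z : 'rV[R]_n => mpoly.meval (fun i => z 0 i) q).
Proof.
rewrite (_ : (fun z => _) = (fun z : 'rV[R]_n => \sum_(m <- mpoly.msupp q)
  mpoly.mcoeff m q * \prod_(i <- index_enum 'I_n) z 0 i ^+ mpoly.fun_of_multinom m i)); last first.
  by apply/funext => z; rewrite mpoly.mevalE.
elim: (mpoly.msupp q) => [|m s [k IH]].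
  exists 0%N; rewrite (_ : (fun _ => _) = fun=> 0); first exact: polyfun0.
  by apply/funext => z; rewrite big_nil.
have [l hl] : exists l, polyfun l (fun z : 'rV[R]_n =>
    \prod_(i <- index_enum 'I_n) z 0 i ^+ mpoly.fun_of_multinom m i).
  elim: (index_enum _) => [|i e [l IHe]].
    exists 1%N; rewrite (_ : (fun _ => _) = fun=> 1); first exact: polyfun_cst.
    by apply/funext => z; rewrite big_nil.
  have h : polyfun (size (nseq (mpoly.fun_of_multinom m i) i)).+1 (fun z : 'rV[R]_n => z 0 i ^+ mpoly.fun_of_multinom m i).
    rewrite (_ : (fun _ => _) = (fun z : 'rV[R]_n => \prod_(j <- nseq (mpoly.fun_of_multinom m i) i) z 0 j)).
      exact: polyfun_prod.
    by apply/funext => z; rewrite big_nseq; elim: (mpoly.fun_of_multinom m i) => [|a IHa]; rewrite ?expr0// exprS IHa.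
  have [j hj] := polyfunM h IHe.
  exists j; rewrite (_ : (fun _ => _) = (fun z : 'rV[R]_n => z 0 i ^+ mpoly.fun_of_multinom m i * \prod_(i0 <- e) z 0 i0 ^+ mpoly.fun_of_multinom m i0))//.
  by apply/funext => z; rewrite big_cons.
exists (maxn l k); rewrite (_ : (fun _ => _) = (fun z : 'rV[R]_n => mpoly.mcoeff m q * (\prod_(i <- index_enum 'I_n) z 0 i ^+ mpoly.fun_of_multinom m i)
  + \sum_(m <- s) mpoly.mcoeff m q * \prod_(i <- index_enum 'I_n) z 0 i ^+ mpoly.fun_of_multinom m i)).
  by apply: polyfunD; [apply: polyfunZ; apply: polyfunW hl|apply: polyfunW IH]; rewrite ?leq_maxl ?leq_maxr.
by apply/funext => z; rewrite big_cons.
Qed.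

Lemma polyfun_bounded n k (f : 'rV[R]_n -> R) (M : R) : polyfun k f ->
  exists C, forall u : 'rV[R]_n, (forall i, `|u 0 i| <= M) -> `|f u| <= C.
Proof.
move=> pf; elim: pf => {k f} [k|k c|k i f pf [C IH]|k f1 f2 pf1 [C1 IH1] pf2 [C2 IH2]].
- by exists 0 => u _; rewrite normr0.
- by exists `|c|.
- by exists (M * C) => u hu; rewrite normrM ler_pM// IH.
- exists (C1 + C2) => u hu; apply: le_trans (ler_normD _ _) _.
  by apply: lerD; [exact: IH1|exact: IH2].
Qed.

Lemma polyfun_continuous n k (f : 'rV[R]_n -> R) : polyfun k f -> continuous f.
Proof.
move=> pf; elim: pf => {k f} [k|k c|k i f pf IH|k f1 f2 pf1 IH1 pf2 IH2] u.
- exact: cst_continuous.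
- exact: cst_continuous.
- by apply: (@continuousM R 'rV[R]_n (fun u : 'rV[R]_n => u 0 i) f u); [exact: (@coord_continuous R 1 n 0 i u)|exact: IH].
- by apply: (@continuousD R R^o 'rV[R]_n f1 f2 u); [exact: IH1|exact: IH2].
Qed.

Lemma polyfun_line n k (f : 'rV[R]_n -> R) (a h : 'rV[R]_n) : polyfun k f ->
  exists p : {poly R}, forall t, f (a + t *: h) = p.[t].
Proof.
move=> pf; elim: pf => {k f} [k|k c|k i f pf [p IH]|k f1 f2 pf1 [p1 IH1] pf2 [p2 IH2]].
- by exists 0 => t; rewrite horner0.
- by exists c%:P => t; rewrite hornerC.
- exists (((a 0 i)%:P + (h 0 i) *: 'X) * p) => t.
  by rewrite IH !hornerE !mxE; congr (_ * _); rewrite [t * _]mulrC.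
- by exists (p1 + p2) => t; rewrite IH1 IH2 hornerD.
Qed.

(** Horner induction on [s * 'X + c]: once [|s|] stays above [k > 0], the product [|s t|] eventually
    exceeds [|c|] by 1. *)
Lemma poly_eventually_ge (p : {poly R}) : p != 0 ->
  exists k t0 : R, 0 < k /\ forall t : R, t0 <= t -> k <= `|p.[t]|.
Proof.
elim/poly_ind: p => [|s c IH]; first by rewrite eqxx.
have [->|s0] := eqVneq s 0.
  rewrite mul0r add0r polyC_eq0 => c0.
  by exists `|c|, 0; split; [rewrite normr_gt0|move=> t _; rewrite hornerC].
move=> _; have [k [t0 [k0 h]]] := IH s0.
exists 1, (`|t0| + (1 + `|c|) / k); split=> // t ht.
have c1 : 0 <= (1 + `|c|) / k by rewrite divr_ge0// ?addr_ge0// ltW.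
have t1 : t0 <= t by apply: le_trans ht; rewrite -[leLHS]addr0 lerD// ler_norm.
have t2 : (1 + `|c|) / k <= t by apply: le_trans ht; rewrite lerDr.
have t3 : 1 + `|c| <= k * t by rewrite mulrC -ler_pdivrMr.
rewrite !hornerE; apply: le_trans (lerB_normD _ _).
rewrite lerBrDr normrM; apply: le_trans t3 _.
apply: ler_pM; [exact: ltW|exact: le_trans c1 t2|exact: h|exact: ler_norm].
Qed.

Lemma poly_bounded_cst (p : {poly R}) (C : R) :
  (forall t, `|p.[t]| <= C) -> forall t s, p.[t] = p.[s].
Proof.
elim/poly_ind: p => [|s c _] h t t'; first by rewrite !horner0.
have [->|s0] := eqVneq s 0; first by rewrite mul0r add0r !hornerC.
exfalso; have [k [t0 [k0 hk]]] := poly_eventually_ge s0.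
(* At this point [|s.[x] * x|] is at least [1 + |c| + C], so the value of the polynomial exceeds [C]
   in absolute value. *)
pose x := `|t0| + (1 + `|c| + C) / k.
have C0 : 0 <= C by apply: le_trans (h 0).
have c1 : 0 <= (1 + `|c| + C) / k by rewrite divr_ge0// ?addr_ge0// ltW.
have t1 : t0 <= x by rewrite -[leLHS]addr0 lerD// ler_norm.
have t2 : (1 + `|c| + C) / k <= x by rewrite lerDr.
have t3 : 1 + `|c| + C <= k * x by rewrite mulrC -ler_pdivrMr.
have := h x; rewrite !hornerE => hx.
have := le_trans (lerB_normD _ _) hx; rewrite normrM => hx'.
have : k * x <= `|s.[x]| * `|x|.
  by apply: ler_pM; [exact: ltW|exact: le_trans c1 t2|exact: hk|exact: ler_norm].
have := normr_ge0 c; lra.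
Qed.

Lemma polyfun_const_of_bounded n k (f : 'rV[R]_n -> R) (a h : 'rV[R]_n) (C : R) :
  polyfun k f -> (forall t, `|f (a + t *: h)| <= C) -> f (a + h) = f a.
Proof.
move=> pf hC; have [p hp] := polyfun_line a h pf.
have := @poly_bounded_cst p C _ 1 0.
rewrite -!hp scale1r scale0r addr0; apply => t.
by rewrite -hp.
Qed.

End PolynomialBounds.

Section FullSupport.
Variable R : realType.

Lemma normal_prob_ball_gt0 (x e : R) : 0 < e -> (0 < normal_prob 0 1 (ball x e))%E.
Proof.
move=> e0; have mB : measurable (ball x e : set R) by exact: measurable_ball.
rewrite lt0e measure_ge0 andbT; apply/negP => /eqP N0.
(* A lower bound of the density on the ball, whose points have absolute value below [|x| + e]. *)
pose c : R := normal_peak 1 * expR (- (`|x| + e) ^+ 2 / 2).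
have c0 : 0 < c by rewrite mulr_gt0 ?expR_gt0// normal_peak_gt0.
have : (c%:E * lebesgue_measure (ball x e : set R) <= 0)%E.
  rewrite -N0 /normal_prob -integral_cst//; apply: ge0_le_integral => //.
  - by move=> t _; rewrite lee_fin ltW.
  - apply/measurable_EFinP; apply: measurable_funTS; exact: measurable_normal_pdf.
  - move=> t /= tx; rewrite lee_fin normal_pdf01E /c ler_pM2l ?normal_peak_gt0// ler_expR.
    rewrite !mulNr lerN2 ler_pM2r ?invr_gt0// -[leLHS]real_normK ?num_real//.
    rewrite lerXn2r ?nnegrE ?addr_ge0// ?ltW//.
    rewrite (_ : t = x - (x - t)); last by ring.
    by apply: le_lt_trans (ler_normB _ _) _; rewrite ltrD2l.
rewrite (lebesgue_measure_ball x (ltW e0)) -EFinM lee_fin leNgt => /negP; apply.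
by rewrite mulr_gt0// mulrn_wgt0.
Qed.

(** A nonempty open set contains a cube of positive Gaussian measure. This upgrades almost sure
    bounds on continuous functions to bounds everywhere. *)
Lemma gaussian_ae_dense d (T : measurableType d) (P : probability T R) n
    (X : T -> 'rV[R]_n) (A : set 'rV[R]_n) :
  gaussian_vec P X -> open A -> {ae P, forall t, ~ A (X t)} -> A = set0.
Proof.
move=> gX oA hA; rewrite -subset0 => z Az.
have /nbhs_ballP[e /= e0 he] : nbhs z A by exact: open_nbhs_nbhs.
pose B i : set R := ball (z 0 i) e.
have mB i : measurable (B i) by exact: measurable_ball.
have PB : P (X @^-1` rbox B) = 0%E.
  rewrite (@ae_eq_measure _ _ _ P _ set0) ?measure0//.
    by apply: measurable_preimage; [exact: gX.1|exact: measurable_rbox].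
  apply: filterS hA => t nA; split=> //= tB; apply: nA; apply: he.
  by split=> // i j; rewrite ord1; exact: tB.
have := gaussian_vec_box gX mB; rewrite PB => -[] /esym/eqP.
apply/negP; rewrite gt_eqF// prodr_gt0// => i _.
rewrite fine_gt0// normal_prob_ball_gt0//=.
exact: le_lt_trans (probability_le1 (normal_prob 0 1) (mB i)) (ltry 1).
Qed.

End FullSupport.

(** * Vanishing first and second levels *)

Section LowLevels.
Variables (R : realType) (r : nat).
Local Notation sample := ('rV[R]_r * measurableTypeR R)%type.
Variable P : probability sample R.
Hypothesis hZ : std_gaussian (pushforward P fst).
Hypothesis hdim : intrinsic_dimension P.
Implicit Types (S : 'M[R]_r) (w : sample).

Lemma lambda2_eq0_linear S (c : 'rV[R]_(perp_dim S)) : ~ (0 < lambda2 P S 1)%E ->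
  forall B, measurable B ->
  (\int[P]_(w in Ybar S @^-1` B) (\sum_i c 0%R i * Zbar S w 0%R i)%:E = 0)%E.
Proof.
move=> l0 B mB; have mYB := measurable_preimage (measurable_Ybar S) mB.
transitivity (\int[P]_(w in Ybar S @^-1` B)
    \sum_(i < perp_dim S) (c 0%R i)%:E * (hermite (Zbar S w) [tuple i])%:E)%E.
  apply: eq_integral => w _; rewrite -sumEFin; apply: eq_bigr => i _.
  by rewrite hermite1E EFinM.
have ih i : P.-integrable setT (fun w => (hermite (Zbar S w) [tuple i])%:E).
  exact: all_moments_integrable (all_moments_hermite hZ [tuple i]).
have ihD i : P.-integrable (Ybar S @^-1` B) (fun w => (hermite (Zbar S w) [tuple i])%:E).
  exact: integrableS (ih i).
rewrite integral_sum//; last by move=> i; apply: integrableZl.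
by rewrite big1// => i _; rewrite integralZl// (lambda2_eq0 hZ l0)// mule0.
Qed.

Lemma ilambda2_eq0_linear S (c : 'rV[R]_(perp_dim S)) :
  all_moments P (fun w => w.2 : R) -> ~ (0 < ilambda2 P S 1)%E ->
  forall B, measurable B ->
  (\int[P]_(w in Zpar S @^-1` B) (w.2 * \sum_i c 0%R i * Zbar S w 0%R i)%:E = 0)%E.
Proof.
move=> mY l0 B mB; have mZB := measurable_preimage (measurable_Zpar S) mB.
transitivity (\int[P]_(w in Zpar S @^-1` B)
    \sum_(i < perp_dim S) (c 0%R i)%:E * (w.2 * hermite (Zbar S w) [tuple i])%:E)%E.
  apply: eq_integral => w _; rewrite mulr_sumr -sumEFin; apply: eq_bigr => i _.
  by rewrite hermite1E -EFinM mulrCA.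
have ih i : P.-integrable setT (fun w => (w.2 * hermite (Zbar S w) [tuple i])%:E).
  exact: all_moments_integrable (all_moments_Y_hermite hZ mY [tuple i]).
have ihD i : P.-integrable (Zpar S @^-1` B) (fun w => (w.2 * hermite (Zbar S w) [tuple i])%:E).
  exact: integrableS (ih i).
rewrite integral_sum//; last by move=> i; apply: integrableZl.
by rewrite big1// => i _; rewrite integralZl// (ilambda2_eq0 hZ mY l0)// mule0.
Qed.

(** Up to the factor [sqrt 2], [|U|^2 - m] is the trace of the second Hermite tensor. *)
Lemma lambda2_eq0_sqnorm S : ~ (0 < lambda2 P S 2)%E -> forall B, measurable B ->
  (\int[P]_(w in Ybar S @^-1` B) (sqnorm (Zbar S w) - (perp_dim S)%:R)%:E = 0)%E.
Proof.
move=> l0 B mB; have mYB := measurable_preimage (measurable_Ybar S) mB.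
transitivity (\int[P]_(w in Ybar S @^-1` B)
    \sum_(i < perp_dim S) (Num.sqrt 2)%:E * (hermite (Zbar S w) [tuple i; i])%:E)%E.
  apply: eq_integral => w _; under eq_bigr do rewrite -EFinM; rewrite sumEFin /sqnorm.
  have -> : (perp_dim S)%:R = \sum_(i < perp_dim S) (1 : R) by rewrite sumr_const card_ord.
  rewrite -sumrB.
  congr _%:E; apply: eq_bigr => i _; rewrite hermite2E mulrA divff ?mul1r//.
have ih i : P.-integrable setT (fun w => (hermite (Zbar S w) [tuple i; i])%:E).
  exact: all_moments_integrable (all_moments_hermite hZ [tuple i; i]).
have ihD i : P.-integrable (Ybar S @^-1` B) (fun w => (hermite (Zbar S w) [tuple i; i])%:E).
  exact: integrableS (ih i).
rewrite integral_sum//; last by move=> i; apply: integrableZl.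
by rewrite big1// => i _; rewrite integralZl// (lambda2_eq0 hZ l0)// mule0.
Qed.

(** A crude bound that avoids square roots, from [m <= (m + 1)^2]. *)
Lemma sqnorm_le_coord n (u : 'rV[R]_n) (m : nat) i :
  sqnorm u <= m%:R -> `|u 0 i| <= m.+1%:R.
Proof.
move=> h; rewrite -(@ler_pXn2r _ 2) ?nnegrE// real_normK ?num_real//.
apply: le_trans (_ : m%:R <= _); last by rewrite -natrX ler_nat (leq_trans (leqnSn m))// leq_pmulr.
by apply: le_trans h; rewrite /sqnorm (bigD1 i)//= lerDl sumr_ge0// => j _; exact: sqr_ge0.
Qed.

Lemma polyfun_sqnorm n : polyfun 3 (@sqnorm R n).
Proof.
apply: polyfun_sum => i.
rewrite (_ : (fun u => _) = (fun u : 'rV[R]_n => u 0 i * (u 0 i * 1))).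
  by do 2 apply: polyfun_coordM; exact: polyfun_cst.
by apply/funext => u; rewrite mulr1 expr2.
Qed.

Lemma polynomial_level k (f : 'rV[R]_r -> R) : polyfun k f -> model P f ->
  forall S, ~~ row_full S -> (0 < lambda2 P S 2)%E.
Proof.
move=> pf hf S pS; apply: contrapT => l0.
pose m : nat := perp_dim S; pose G := frame (perp S).
pose O := (frame S)^T *m frame S.
have pfG : polyfun k (fun v : 'rV[R]_(r + m) => f (v *m col_mx 1%:M G)) by exact: polyfun_mulmx.
have key (N : nat) : exists C : R, forall z, sqnorm (oproj S z) < N%:R -> `|f z| <= C.
  (* The radius bounds all coordinates of Z_S and U as long as [|Z_S|^2 <= N] and [|U|^2 <= m];
     hence [|Y| > C] together with the first bound forces [|U|^2 > m]. *)
  have [C hC] := polyfun_bounded (N.+1 + m.+1)%:R pfG.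
  have big w : sqnorm (Zpar S w) < N%:R -> C < `|f w.1| -> m%:R < sqnorm (Zbar S w).
    move=> hN; rewrite !ltNge; apply: contra => hs.
    have := hC (row_mx (Zpar S w) (Zbar S w)).
    rewrite mul_row_col mulmx1 -fst_decomposition; apply => i; rewrite mxE natrD.
    case: splitP => j _.
      by apply: le_trans (sqnorm_le_coord j (ltW hN)) _; rewrite lerDl.
    by apply: le_trans (sqnorm_le_coord j hs) _; rewrite lerDr.
  exists C.
  pose B : set sample := [set y : sample | sqnorm y.1 < N%:R /\ C < `|y.2 : R|].
  have mB : measurable B.
    rewrite (_ : B = [set y : sample | sqnorm y.1 < N%:R] `&`
      [set y : sample | C < `|y.2 : R|])//.
    apply: measurableI; apply: measurable_lt_set => //.
    - by apply: measurableT_comp => //; exact: measurable_sqnorm.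
    - by apply: measurableT_comp => //; exact: measurable_snd.
  have PB : P (Ybar S @^-1` B) = 0%E.
    apply: (@pos_integral_null _ _ _ P _ (fun w => sqnorm (Zbar S w) - m%:R)).
    - exact: measurable_preimage (measurable_Ybar S) mB.
    - apply: all_moments_integrable; apply: all_momentsD; last exact: all_moments_cst.
      exact: all_moments_polyfun (gaussian_Zbar hZ S) (polyfun_sqnorm _).
    - by apply: filterS hf => w wf [/= h1]; rewrite wf subr_gt0; exact: big.
    - by rewrite lambda2_eq0_sqnorm.
  have := ae_null (measurable_preimage (measurable_Ybar S) mB) PB => aeB.
  (* The set where the bound fails is open and almost surely avoided by Z, hence empty: the bound
     holds at every point, not only almost everywhere. *)
  pose A := [set z : 'rV[R]_r | sqnorm (oproj S z) < N%:R /\ C < `|f z|].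
  suff A0 : A = set0.
    by move=> z hz; rewrite leNgt; apply/negP => fz; have : A z by []; rewrite A0.
  apply: (gaussian_ae_dense (gaussian_fst hZ)).
    apply: openI.
      have /continuousP := polyfun_continuous (polyfun_mulmx O (@polyfun_sqnorm r)).
      move=> /(_ [set x | x < N%:R] (@open_lt R N%:R)); congr open.
      by apply/seteqP; split => z /=; rewrite oprojE mulmxA.
    have /continuousP/(_ [set x : R | C < `|x|]) := polyfun_continuous pf; apply.
    apply: (@open_comp _ _ (fun x : R => `|x|) [set x | C < x]); last exact: (@open_gt R C).
    by move=> x _; exact: (@norm_continuous R R^o x).
  by apply: filterS2 hf aeB => w wf nB [h1 h2]; apply: nB; split; rewrite /= ?wf.
(* On the line through [z] and its projection, the projection on S is constant, so one bound [C]
   serves the whole line and [f] is constant on it. *)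
have fE z : f z = f (oproj S z).
  have [C hC] := key (Num.bound (sqnorm (oproj S z))).
  have OO : O *m O = O by rewrite /O mulmxA -[_ *m frame S *m _]mulmxA frame_orthonormal mulmx1.
  rewrite -[in LHS](subrK (oproj S z) z) addrC.
  apply: (polyfun_const_of_bounded (C := C) pf) => t; apply: hC.
  have -> : oproj S (oproj S z + t *: (z - oproj S z)) = oproj S z.
    have oE x : oproj S x = x *m O by rewrite oprojE mulmxA.
    by rewrite !oE mulmxDl -scalemxAl mulmxBl -mulmxA OO subrr scaler0 addr0.
  by apply: archi_boundP; exact: sqnorm_ge0.
apply: (@intrinsic_dimension_contra _ _ _ hZ S f hdim pS).
  exact: measurable_polyfun pf.
by apply: filterS hf => w ->; exact: fE.
Qed.

Lemma measurable_forall_ord d (T : measurableType d) M (A : 'I_M -> set T) :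
  (forall j, measurable (A j)) -> measurable [set x | forall j, A j x].
Proof.
move=> mA; have -> : [set x | forall j, A j x] = \bigcap_(j in [set: 'I_M]) A j.
  by apply/seteqP; split=> z h i; [move=> _; exact: h|exact: h].
exact: fin_bigcap_measurable.
Qed.

Lemma natr_forall M (b : 'I_M -> bool) : \prod_(j < M) (b j)%:R = [forall j, b j]%:R :> R.
Proof.
case: (boolP [forall j, b j]) => [/forallP h|/forallPn[j hj]].
  by rewrite big1// => j _; rewrite h.
by rewrite (bigD1 j)//= (negbTE hj) mul0r.
Qed.

Lemma mul_row_tr n (v z : 'rV[R]_n) : (v *m z^T) 0 0 = \sum_i v 0 i * z 0 i.
Proof. by rewrite mxE; apply: eq_bigr => i _; rewrite mxE. Qed.

Lemma mul_row_trD n (v x y : 'rV[R]_n) :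
  (v *m (x + y)^T) 0 0 = (v *m x^T) 0 0 + (v *m y^T) 0 0.
Proof. by rewrite linearD mulmxDr mxE. Qed.

Lemma polyfun_mul_row_tr n (v : 'rV[R]_n) : polyfun 2 (fun z => (v *m z^T) 0 0).
Proof.
rewrite (funext (mul_row_tr v)); apply: polyfun_sum => i; apply: polyfunZ.
rewrite (_ : (fun u => _) = (fun u : 'rV[R]_n => u 0 i * 1)).
  by apply: polyfun_coordM; exact: polyfun_cst.
by apply/funext => u; rewrite mulr1.
Qed.

(** * Comparison of a half-space intersection with a cone *)

Section HalfSpaces.
Variables (M : nat) (v : 'I_M -> 'rV[R]_r) (alpha : 'I_M -> R).
Variable S : 'M[R]_r.
Local Notation m := (perp_dim S).
Local Notation G := (frame (perp S)).
Hypothesis pS : ~~ row_full S.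
Let f (z : 'rV[R]_r) : R := 2 * \prod_(j < M) (alpha j < (v j *m z^T) 0 0)%R%:R - 1.
Hypothesis hf : model P f.
Hypothesis l1 : ~ (0 < lambda2 P S 1)%E.
Hypothesis l2 : ~ (0 < lambda2 P S 2)%E.

Let b j (a : 'rV[R]_r) : R := (v j *m a^T) 0 0 - alpha j.
Let c j (u : 'rV[R]_m) : R := ((v j *m G^T) *m u^T) 0 0.
Let E : set ('rV[R]_r * 'rV[R]_m) := fun p => (forall j, 0 < b j p.1) /\ (forall j, 0 < b j p.1 + c j p.2).
(** The factor [sqrt m] makes [T] and [E] agree on the sphere [|u|^2 = m]. As the [b j] are
    positive, [E] is contained in [T] outside this sphere and contains it inside. *)
Let T : set ('rV[R]_r * 'rV[R]_m) := fun p => (forall j, 0 < b j p.1) /\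
  (forall j, 0 < b j p.1 * Num.sqrt (sqnorm p.2) + Num.sqrt m%:R * c j p.2).
Let D := [set p | E p /\ ~ T p] `|` [set p | T p /\ ~ E p].

Let f_gt0 z : (0 < f z) <-> (forall j, alpha j < (v j *m z^T) 0 0).
Proof.
rewrite /f natr_forall; case: forallP => h /=; first by split=> // _; lra.
by split=> //; lra.
Qed.

Let perp_dim_gt0 : (0 < m)%N.
Proof.
have := rank_perp S; rewrite /perp_dim; case: (\rank (perp S)) => //.
by rewrite add0n => h; move: pS; rewrite /row_full h eqxx.
Qed.

Let bcE w j : b j (Zpar S w) + c j (Zbar S w) = (v j *m w.1^T) 0 0 - alpha j.
Proof.
have -> : (v j *m w.1^T) 0 0 = (v j *m (Zpar S w)^T) 0 0 + c j (Zbar S w).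
  by rewrite {1}(fst_decomposition S w) mul_row_trD /c [(Zbar S w *m _)^T]trmx_mul mulmxA.
by rewrite /b addrAC.
Qed.

Let f_gt0E w : (0 < f w.1) <-> (forall j, 0 < b j (Zpar S w) + c j (Zbar S w)).
Proof.
rewrite f_gt0; split=> h j; have := h j; rewrite bcE; lra.
Qed.

Let measurable_b j : measurable_fun setT (b j).
Proof.
by apply: measurable_funB => //; exact: measurable_polyfun (polyfun_mul_row_tr (v j)).
Qed.

Let measurable_c j : measurable_fun setT (c j).
Proof. exact: measurable_polyfun (polyfun_mul_row_tr _). Qed.

(** On this event of [Ybar S] the linear form [c j] of U is positive, whereas its integral over the
    event vanishes with the first level. *)
Let ae_b j : {ae P, forall w, ~ (b j (Zpar S w) <= 0 /\ 0 < w.2)}.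
Proof.
pose B : set sample := [set y : sample | b j y.1 <= 0 /\ 0 < (y.2 : R)].
have mB : measurable B.
  rewrite (_ : B = ~` [set y : sample | 0 < b j y.1] `&` [set y : sample | 0 < (y.2 : R)]).
    apply: measurableI; last by apply: measurable_lt_set => //; exact: measurable_snd.
    apply: measurableC; apply: measurable_lt_set => //.
    by apply: measurableT_comp (measurable_b j) measurable_fst.
  by apply/seteqP; split=> y [/= h1 h2]; split => //=; [apply/negP; rewrite -leNgt|rewrite leNgt; apply/negP].
apply: (ae_null (measurable_preimage (measurable_Ybar S) mB)).
apply: (@pos_integral_null _ _ _ P _ (fun w => c j (Zbar S w))).
- exact: measurable_preimage (measurable_Ybar S) mB.
- apply: all_moments_integrable.
  exact: all_moments_polyfun (gaussian_Zbar hZ S) (polyfun_mul_row_tr _).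
- apply: filterS hf => w wf [/= h1]; rewrite wf => /f_gt0E/(_ j); lra.
- under eq_integral do rewrite /c mul_row_tr.
  by rewrite lambda2_eq0_linear.
Qed.

(** The positivity of all [b j], part of [E], costs nothing by [ae_b]. Thus [E] is almost surely an
    event of [Ybar S], over which the second level can be tested. *)
Let E_iff : {ae P, forall w, E (Zpar S w, Zbar S w) <-> 0 < w.2}.
Proof.
have h : {ae P, forall w, forall j, ~ (b j (Zpar S w) <= 0 /\ 0 < w.2)}.
  by apply: filter_forall; exact: ae_b.
apply: filterS2 hf h => w wf hj; split=> [[_ /= h]|w0].
  by rewrite wf; apply/f_gt0E.
split=> /= j; last by move: j; apply/f_gt0E; rewrite -wf.
by rewrite ltNge; apply/negP => bj; exact: (hj j).
Qed.

Let cZ s j u : c j (s *: u) = s * c j u.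
Proof. by rewrite /c linearZ /= -scalemxAr mxE. Qed.

Let T_cone s a u : 0 < s -> T (a, s *: u) <-> T (a, u).
Proof.
move=> s0; rewrite /T /=.
have h j : b j a * Num.sqrt (sqnorm (s *: u)) + Num.sqrt m%:R * c j (s *: u) =
    s * (b j a * Num.sqrt (sqnorm u) + Num.sqrt m%:R * c j u).
  by rewrite sqnormZ sqrtrM ?sqr_ge0// sqrtr_sqr gtr0_norm// cZ; ring.
by split=> -[h1 h2]; split=> // j; have := h2 j; rewrite h pmulr_rgt0.
Qed.

Let measurable_b1 j : measurable_fun setT (fun p : 'rV[R]_r * 'rV[R]_m => b j p.1).
Proof. by apply: measurableT_comp (measurable_b j) measurable_fst. Qed.

Let measurable_c2 j : measurable_fun setT (fun p : 'rV[R]_r * 'rV[R]_m => c j p.2).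
Proof. by apply: measurableT_comp (measurable_c j) measurable_snd. Qed.

Let measurable_E : measurable E.
Proof.
by apply: measurableI; apply: measurable_forall_ord => j; apply: measurable_lt_set => //;
  apply: measurable_funD.
Qed.

Let measurable_T : measurable T.
Proof.
apply: measurableI; apply: measurable_forall_ord => j; apply: measurable_lt_set => //.
apply: measurable_funD; apply: measurable_funM => //.
apply: measurableT_comp; first exact: continuous_measurable_fun (@sqrt_continuous R).
by apply: measurableT_comp (@measurable_sqnorm R m) measurable_snd.
Qed.

Let measurable_D : measurable D.
Proof.
by apply: measurableU; apply: measurableI => //; apply: measurableC.
Qed.

Let W w : 'rV[R]_r * 'rV[R]_m := (Zpar S w, Zbar S w).

Let measurable_W : measurable_fun setT (W : sample -> _).
Proof.
by apply: measurable_fun_pair; [exact: measurable_Zpar|exact: (gaussian_Zbar hZ S).1].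
Qed.

Let g p : R := (\1_T p - \1_E p) * (sqnorm p.2 - m%:R).

(** The inequality is strict on the symmetric difference [D], so a zero integral of [g] makes [D]
    null. *)
Let g_gt0 p : D p -> 0 < g p.
Proof.
have m0 : 0 < m%:R :> R by rewrite ltr0n.
have sm0 : 0 < Num.sqrt m%:R :> R by rewrite sqrtr_gt0.
have sq := sqnorm_ge0 p.2; have sq0 := sqrtr_ge0 (sqnorm p.2).
have mE : m%:R = Num.sqrt m%:R ^+ 2 :> R by rewrite sqr_sqrtr// ltW.
have sE : sqnorm p.2 = Num.sqrt (sqnorm p.2) ^+ 2 by rewrite sqr_sqrtr.
rewrite /g !indicE => -[[Ep Tp]|[Tp Ep]].
  (* In [E] but not in [T]: some [j] has [b |u| <= - sqrt m c < sqrt m b], so [|u| < sqrt m]. *)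
  rewrite (mem_set Ep) (memNset Tp) sub0r mulN1r oppr_gt0 subr_lt0.
  have [j hj] : exists j, b j p.1 * Num.sqrt (sqnorm p.2) + Num.sqrt m%:R * c j p.2 <= 0.
    apply: contrapT => h; apply: Tp; split=> [|j]; first exact: Ep.1.
    by rewrite ltNge; apply/negP => hj; apply: h; exists j.
  have bj := Ep.1 j; have bcj := Ep.2 j.
  rewrite sE mE ltrXn2r// ?ltW// -(ltr_pM2l bj).
  have := mulr_gt0 sm0 bcj; lra.
(* In [T] but not in [E]: some [j] has [sqrt m b <= - sqrt m c < b |u|], so [|u| > sqrt m]. *)
rewrite (mem_set Tp) (memNset Ep) subr0 mul1r subr_gt0.
have [j hj] : exists j, b j p.1 + c j p.2 <= 0.
  apply: contrapT => h; apply: Ep; split=> [|j]; first exact: Tp.1.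
  by rewrite ltNge; apply/negP => hj; apply: h; exists j.
have bj := Tp.1 j; have bcj := Tp.2 j.
have h : Num.sqrt m%:R * (b j p.1 + c j p.2) <= 0 by rewrite pmulr_rle0.
rewrite sE mE ltrXn2r// ?ltW// -(ltr_pM2l bj).
lra.
Qed.

Let g_eq0 p : ~ D p -> g p = 0.
Proof.
rewrite /g !indicE => nD; have [Ep|Ep] := pselect (E p); have [Tp|Tp] := pselect (T p).
- by rewrite (mem_set Ep) (mem_set Tp) subrr mul0r.
- by exfalso; apply: nD; left.
- by exfalso; apply: nD; right.
- by rewrite (memNset Ep) (memNset Tp) subrr mul0r.
Qed.

Let all_moments_indicW (A : set ('rV[R]_r * 'rV[R]_m)) : measurable A ->
  all_moments P (fun w => \1_A (W w)).
Proof.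
move=> mA; apply: (@all_moments_bounded _ _ _ _ _ 1).
  by apply: measurableT_comp measurable_W; exact: measurable_indic.
by move=> w; rewrite indicE ger0_norm ?ler0n// lern1 leq_b1.
Qed.

Let all_moments_sqnorm : all_moments P (fun w => sqnorm (Zbar S w)).
Proof. exact: all_moments_polyfun (gaussian_Zbar hZ S) (polyfun_sqnorm _). Qed.

Let integral_T : \int[P]_w (\1_T (W w) * sqnorm (Zbar S w)) = m%:R * \int[P]_w \1_T (W w).
Proof.
have aT := all_moments_indicW measurable_T.
(* The indicator of a cone is homogeneous of degree 0, the case [k = 0] of Euler's relation. *)
suff : \int[P]_w (\1_T (W w) * sqnorm (Zbar S w)) = (m + 0)%:R * \int[P]_w \1_T (W w).
  by rewrite addn0.
apply: (@gaussian_euler _ _ _ P _ _ _ _ _ 0 (fun p => \1_T p)).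
- exact: measurable_Zpar.
- exact: gaussian_Zbar.
- exact: independent_Zpar_Zbar.
- exact: measurable_indic.
- by move=> p; rewrite indicE ler0n.
- move=> s a u s0; rewrite expr0 mul1r !indicE; congr (_%:R); congr nat_of_bool.
  by apply/idP/idP; rewrite !inE => h; apply/(T_cone _ _ s0).
- exact: all_moments_integrable.
- by apply: all_moments_integrable; apply: all_momentsM.
Qed.

Let integral_E : \int[P]_w (\1_E (W w) * (sqnorm (Zbar S w) - m%:R)) = 0.
Proof.
pose B : set sample := [set y : sample | 0 < (y.2 : R)].
have mB : measurable B by apply: measurable_lt_set => //; exact: measurable_snd.
have mYB := measurable_preimage (measurable_Ybar S) mB.
have mq : measurable_fun setT (fun w => sqnorm (Zbar S w) - m%:R).
  by apply: measurable_funB => //; exact: all_moments_sqnorm.1.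
have h : \int[P]_(w in Ybar S @^-1` B) (sqnorm (Zbar S w) - m%:R) = 0.
  by rewrite /Rintegral lambda2_eq0_sqnorm.
rewrite -[RHS]h [RHS]Rintegral_mkcond; apply: ae_eq_RintegralT => //.
- by apply: measurable_funM => //; exact: (all_moments_indicW measurable_E).1.
- rewrite patch_indic; apply: measurable_funM => //; exact: measurable_indic.
- apply: filterS E_iff => w wE; rewrite patch_indic /= mulrC; congr (_ * _).
  by rewrite !indicE; congr (_%:R); congr nat_of_bool; apply/idP/idP; rewrite !inE => /wE.
Qed.

Let integrable_gW : P.-integrable setT (fun w => (g (W w))%:E).
Proof.
apply: all_moments_integrable; apply: all_momentsM.
  rewrite /=; apply: all_momentsD; first exact: all_moments_indicW.
  by under eq_fun do rewrite -mulN1r; apply: all_momentsM; [exact: all_moments_cst|exact: all_moments_indicW].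
by apply: all_momentsD => //; exact: all_moments_cst.
Qed.

Let integral_g : \int[P]_w g (W w) = 0.
Proof.
have aT := all_moments_indicW measurable_T; have aE := all_moments_indicW measurable_E.
transitivity (\int[P]_w ((\1_T (W w) * sqnorm (Zbar S w) - m%:R * \1_T (W w)) -
  \1_E (W w) * (sqnorm (Zbar S w) - m%:R))).
  by apply: eq_Rintegral => w _; rewrite /g /=; ring.
have i1 : P.-integrable setT (fun w => (\1_T (W w) * sqnorm (Zbar S w))%:E).
  by apply: all_moments_integrable; apply: all_momentsM.
have i2 : P.-integrable setT (fun w => (m%:R * \1_T (W w))%:E).
  by apply: all_moments_integrable; apply: all_momentsM => //; exact: all_moments_cst.
have i3 : P.-integrable setT (fun w => (\1_E (W w) * (sqnorm (Zbar S w) - m%:R))%:E).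
  apply: all_moments_integrable; apply: all_momentsM => //.
  by apply: all_momentsD => //; exact: all_moments_cst.
rewrite RintegralB//; last by apply: integrableDR => //; under eq_fun do rewrite -mulNr; apply: integrableZR; exact: all_moments_integrable.
rewrite RintegralB// integral_T integral_E RintegralZl ?subrr//.
exact: all_moments_integrable.
Qed.

Let ae_D : {ae P, forall w, ~ D (W w)}.
Proof.
have mWD := measurable_preimage measurable_W measurable_D.
apply: (ae_null mWD).
apply: (@pos_integral_null _ _ _ P _ (fun w => g (W w))) => //.
  by apply: aeW => w; exact: g_gt0.
rewrite integral_mkcond (_ : _ \_ _ = fun w => (g (W w))%:E); last first.
  apply/funext => w; rewrite patchE; case: ifPn => // /negP h.
  by rewrite g_eq0// => Dw; apply: h; rewrite inE.
by rewrite -[leLHS]fineK ?integrable_fin_num// [fine _]integral_g.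
Qed.

(** The dilated pair has a density with respect to the original pair, because U is independent of
    Z_S; so it avoids the same null set. *)
Let ae_D_dilation (n : nat) : {ae P, forall w, ~ D (Zpar S w, n.+1%:R^-1 *: Zbar S w)}.
Proof.
have s0 : 0 < n.+1%:R^-1 :> R by rewrite invr_gt0 ltr0n.
have mV : measurable_fun setT (fun w : sample => (Zpar S w, n.+1%:R^-1 *: Zbar S w)).
  apply: measurable_fun_pair; first exact: measurable_Zpar.
  by apply: measurableT_comp (@measurable_scalemx R m _) (gaussian_Zbar hZ S).1.
have mD := measurable_preimage mV measurable_D.
apply: (ae_null mD).
have mI : measurable_fun setT (fun p : 'rV[R]_r * 'rV[R]_m => (\1_D p : R)%:E).
  by apply/measurable_EFinP; exact: measurable_indic.
have I0 p : (0 <= (\1_D p : R)%:E)%E by rewrite lee_fin indicE ler0n.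
have := gaussian_dilation_independent s0 (measurable_Zpar S) (gaussian_Zbar hZ S)
  (@independent_Zpar_Zbar _ _ _ hZ S) mI I0.
rewrite [RHS](_ : _ = 0%E); last first.
  rewrite (ae_eq_integral (cst 0%E))//; first by rewrite integral0.
    apply: emeasurable_funM; apply/measurable_EFinP.
      exact: (all_moments_indicW measurable_D).1.
    by apply: measurableT_comp (@measurable_dilation_density_rV R m _) (gaussian_Zbar hZ S).1.
  apply: filterS ae_D => w nD _; rewrite indicE memNset ?mul0e//.
move=> <-; rewrite -[in LHS](setIT (_ @^-1` D)) -integral_indic//.
Qed.

Lemma halfspaces_project : {ae P, forall w, w.2 = f (Zpar S w)}.
Proof.
have hD : {ae P, forall w, forall n : nat, ~ D (Zpar S w, n.+1%:R^-1 *: Zbar S w)}.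
  exact: ae_foralln ae_D_dilation.
apply: filterS3 hf E_iff hD => w wf wE wD.
have DE n : E (Zpar S w, n.+1%:R^-1 *: Zbar S w) <-> T (Zpar S w, n.+1%:R^-1 *: Zbar S w).
  split=> h; apply: contrapT => h'; apply: (wD n); first by left.
  by right.
(* As [f] takes two values of opposite signs, it remains to compare the signs at Z and at Z_S. *)
have fE z : f z = if `[< 0 < f z >] then 1 else -1.
  by case: asboolP; rewrite /f natr_forall; case: forallP => /= _; lra.
rewrite wf fE [RHS]fE; congr (if _ then _ else _).
apply/asboolP/asboolP => [h|].
  have [A0 _] : E (Zpar S w, Zbar S w) by apply/wE; rewrite wf.
  by apply/f_gt0 => j; have := A0 j; rewrite /b /=; lra.
move=> /f_gt0 h; rewrite -wf; apply/wE.
have A0 j : 0 < b j (Zpar S w) by rewrite /b subr_gt0.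
have s0 (n : nat) : 0 < n.+1%:R^-1 :> R by rewrite invr_gt0 ltr0n.
have -> : Zbar S w = 1%:R^-1 *: Zbar S w by rewrite invr1 scale1r.
apply/(DE 0%N)/T_cone => //.
(* With this [n] every [|c j U|] is below [(n + 1) b j], so [U / (n + 1)] is in [E], hence in [T];
   the cone property brings back U itself. *)
pose n := Num.bound (\sum_j `|c j (Zbar S w)| / b j (Zpar S w)).
apply: (T_cone _ _ (s0 n)).1; apply: (DE n).1; split=> //= j.
have : `|c j (Zbar S w)| / b j (Zpar S w) < n.+1%:R.
  apply: (@le_lt_trans _ _ (\sum_j `|c j (Zbar S w)| / b j (Zpar S w))).
    rewrite (bigD1 j)//= lerDl sumr_ge0// => i _; rewrite divr_ge0// ltW//.
  apply: lt_trans (_ : n%:R < _); last by rewrite ltr_nat.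
  by apply: archi_boundP; rewrite sumr_ge0// => i _; rewrite divr_ge0// ltW.
rewrite ltr_pdivrMr// => hj; rewrite cZ.
rewrite -(pmulr_rgt0 _ (_ : 0 < n.+1%:R)) ?ltr0n// mulrDr mulrA divff ?mul1r ?pnatr_eq0//.
have := ler_norm (- c j (Zbar S w)); rewrite normrN; lra.
Qed.

End HalfSpaces.

Lemma halfspaces_level M (v : 'I_M -> 'rV[R]_r) (alpha : 'I_M -> R) :
  model P (fun z => 2 * \prod_(j < M) (alpha j < (v j *m z^T) 0 0)%R%:R - 1) ->
  forall S, ~~ row_full S ->
  exists k, [/\ (1 <= k)%N, (k <= 2)%N & (0 < lambda2 P S k)%E].
Proof.
move=> hf S pS; apply: contrapT => h.
have l1 : ~ (0 < lambda2 P S 1)%E by move=> ?; apply: h; exists 1%N.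
have l2 : ~ (0 < lambda2 P S 2)%E by move=> ?; apply: h; exists 2%N.
apply: (intrinsic_dimension_contra hZ hdim pS _ (halfspaces_project pS hf l1 l2)).
apply: measurable_funB => //; apply: measurable_funM => //.
apply: measurable_prod => j _.
rewrite (_ : (fun _ => _) = \1_[set z : 'rV[R]_r | alpha j < (v j *m z^T) 0 0]).
  apply: measurable_indic; apply: measurable_lt_set => //.
  exact: measurable_polyfun (polyfun_mul_row_tr (v j)).
apply/funext => z; rewrite indicE; congr (_%:R); congr nat_of_bool.
by apply/idP/idP; rewrite inE.
Qed.

End LowLevels.

(** * Staircases *)

Section SignProducts.
Variable R : realType.

Lemma measurable_sg : measurable_fun setT (@Num.sg R).
Proof.
rewrite (_ : @Num.sg R = fun x => \1_[set x | 0 < x] x - \1_[set x | x < 0] x).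
  by apply: measurable_funB; apply: measurable_indic; apply: measurable_lt_set.
apply/funext => x; rewrite !indicE; case: (sgrP x) => [->|x0|x0].
- by rewrite !memNset ?subr0//= ltxx.
- by rewrite mem_set// memNset ?subr0//= ltNge ltW.
- by rewrite memNset ?mem_set ?sub0r//= ltNge ltW.
Qed.

Definition sgprod n (Q : pred 'I_n) (z : 'rV[R]_n) : R := \prod_(l < n | Q l) Num.sg (z 0 l).

Lemma sgprod_flip n (Q : pred 'I_n) a (z : 'rV[R]_n) :
  sgprod Q (flip a z) = (-1) ^+ Q a * sgprod Q z.
Proof.
rewrite /sgprod; have h l : l != a -> flip a z 0 l = z 0 l.
  by move=> la; rewrite coord_flip (negbTE la) mul1r.
case: (boolP (Q a)) => Qa; last first.
  rewrite mul1r; apply: eq_bigr => l Ql; rewrite h//.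
  by apply: contraNneq Qa => <-.
rewrite (bigD1 a)//= [in RHS](bigD1 a)//= coord_flip eqxx expr1 mulN1r sgrN mulrA mulN1r.
by congr (_ * _); apply: eq_bigr => l /andP[_ la]; rewrite h.
Qed.

Lemma measurable_sgprod n (Q : pred 'I_n) : measurable_fun setT (sgprod Q).
Proof.
rewrite (_ : sgprod Q = fun z => \prod_l (if Q l then Num.sg (z 0 l) else 1)).
  apply: measurable_prod => l _; case: (Q l) => //.
  apply: (measurableT_comp measurable_sg).
  exact: (@measurable_mx_coord _ (measurableTypeR R) 1 n 0 l).
by apply/funext => z; rewrite /sgprod big_mkcond.
Qed.

Lemma normr_sgprod n (Q : pred 'I_n) z : `|sgprod Q z| <= 1.
Proof.
rewrite /sgprod; elim/big_rec: _ => [|l x _ hx]; first by rewrite normr1.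
by rewrite normrM mulr_ile1// normr_sg lern1 leq_b1.
Qed.

Lemma sgr_prod n (Q : pred 'I_n) (z : 'rV[R]_n) :
  Num.sg (\prod_(l < n | Q l) z 0 l) = sgprod Q z.
Proof. by rewrite /sgprod; elim/big_rec2: _ => [|l x y _ <-]; rewrite ?sgr1 ?sgrM. Qed.

Lemma sgprodE n (Q : pred 'I_n) z : sgprod Q z = (\prod_(l < n | Q l) sgz (z 0 l))%:~R.
Proof. by rewrite rmorph_prod; apply: eq_bigr => l _; rewrite sgrEz. Qed.

Lemma sgprod_sqr n (Q : pred 'I_n) (z : 'rV[R]_n) : (forall l, z 0 l != 0) -> sgprod Q z ^+ 2 = 1.
Proof.
move=> z0; rewrite /sgprod -prodrXl big1// => l _.
by rewrite sqr_sg z0.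
Qed.

End SignProducts.

Section TestFunctions.
Context d (T : measurableType d) (R : realType) (P : probability T R).

Lemma Rintegral_probability_cst (c : R) : \int[P]_t c = c.
Proof. by rewrite /Rintegral; have := expectation_cst P c; rewrite unlock => ->. Qed.

Lemma Rintegral_sum I (s : seq I) (f : I -> T -> R) :
  (forall i, P.-integrable setT (fun t => (f i t)%:E)) ->
  \int[P]_t (\sum_(i <- s) f i t) = \sum_(i <- s) \int[P]_t f i t.
Proof.
move=> h; elim: s => [|i s IH].
  by under eq_Rintegral do rewrite big_nil; rewrite Rintegral_cst// mul0r big_nil.
under eq_Rintegral do rewrite big_cons.
rewrite big_cons -IH RintegralD//; first exact: h.
elim: s {IH} => [|j s IH].
  rewrite (_ : EFin \o _ = cst 0%E); first exact: integrable0.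
  by apply/funext => t; rewrite /= big_nil.
rewrite (_ : EFin \o _ = fun t => (f j t + \sum_(i <- s) f i t)%:E).
  exact: integrableDR.
by apply/funext => t; rewrite /= big_cons.
Qed.

Lemma Rintegral_gt0 (f : T -> R) : P.-integrable setT (fun t => (f t)%:E) ->
  {ae P, forall t, 0 < f t} -> 0 < \int[P]_t f t.
Proof.
move=> fi f0; rewrite ltNge; apply/negP => h.
have : P setT = 0%E.
  apply: (@pos_integral_null _ _ _ P setT f) => //; first by apply: filterS f0.
  by rewrite -[leLHS]fineK ?integrable_fin_num// lee_fin.
by rewrite probability_setT => /eqP; rewrite eqe oner_eq0.
Qed.

Lemma all_moments_ae (f g : T -> R) : measurable_fun setT f -> all_moments P g ->
  {ae P, forall t, f t = g t} -> all_moments P f.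
Proof.
move=> mf [mg hg] fg; split=> // k; have /integrableP[_ hk] := hg k.
have mk h : measurable_fun setT h -> measurable_fun setT (fun t : T => (`|h t : R| ^+ k)%:E).
  by move=> mh; apply/measurable_EFinP; exact: measurable_normX.
apply/integrableP; split; first exact: mk.
rewrite (ae_eq_integral (fun t => `|(`|g t| ^+ k)%:E|)%E)//.
- by apply: measurableT_comp => //; exact: mk.
- by apply: measurableT_comp => //; exact: mk.
- by apply: filterS fg => t ->.
Qed.

(** A test function with values in a finite list is a finite combination of indicators of events of
    [W], so vanishing integrals over events suffice and no limit is taken. *)
Lemma integral_test_eq0 d' (E : measurableType d') (W : T -> E) (l : T -> R)
    (psi : E -> R) (s : seq R) :
  measurable_fun setT W -> measurable_fun setT psi -> uniq s ->
  P.-integrable setT (fun t => (l t)%:E) ->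
  (forall B, measurable B -> (\int[P]_(t in W @^-1` B) (l t)%:E = 0)%E) ->
  {ae P, forall t, psi (W t) \in s} -> measurable_fun setT l ->
  \int[P]_t (psi (W t) * l t) = 0.
Proof.
move=> mW mpsi us il hl hs ml.
pose B c := psi @^-1` [set c].
have mB c : measurable (B c) by apply: measurable_preimage.
have mWB c : measurable (W @^-1` B c) by exact: measurable_preimage.
have iB c : P.-integrable setT (fun t => (l t * \1_(W @^-1` B c) t)%:E).
  apply: (@integrable_le _ _ _ _ _ (fun t => `|l t|)).
  - by apply: measurable_funM => //; exact: measurable_indic.
  - exact: integrable_norm il.
  - by move=> t; rewrite normrM ler_piMr// indicE ger0_norm ?ler0n// lern1 leq_b1.
have zB c : \int[P]_t (l t * \1_(W @^-1` B c) t) = 0.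
  transitivity (\int[P]_(t in W @^-1` B c) l t); last by rewrite /Rintegral hl.
  by rewrite [RHS]Rintegral_mkcond patch_indic.
transitivity (\int[P]_t (\sum_(c <- s) c * (l t * \1_(W @^-1` B c) t))); last first.
  rewrite Rintegral_sum; last by move=> c; exact: integrableZR.
  by rewrite big1// => c _; rewrite RintegralZl//; [rewrite (zB c) mulr0|exact: iB].
apply: ae_eq_RintegralT => //.
- by apply: measurable_funM => //; exact: measurableT_comp.
- by apply: measurable_sum => c; do 2 apply: measurable_funM => //.
apply: filterS hs => t st; rewrite (bigD1_seq (psi (W t)))//= big1 ?addr0.
  by rewrite indicE mem_set// mulr1.
by move=> c hc; rewrite indicE memNset ?mulr0// => /= h; move: hc; rewrite h eqxx.
Qed.

End TestFunctions.

Lemma gaussian_coord_neq0 (R : realType) d (T : measurableType d) (P : probability T R) n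
    (X : T -> 'rV[R]_n) : gaussian_vec P X -> {ae P, forall t l, X t 0 l != 0}.
Proof.
move=> gX; apply: filter_forall => l.
have m0 : measurable ((fun t => X t 0 l) @^-1` [set 0]).
  apply: measurable_preimage => //.
  exact: measurableT_comp (@measurable_mx_coord _ (measurableTypeR R) 1 n 0 l) gX.1.
have : P ((fun t => X t 0 l) @^-1` [set 0]) = 0%E.
  rewrite (gaussian_vec_coord l gX)//.
  by have /null_content_dominatesP := @normal_prob_dominates R 0 1; apply => //; exact: lebesgue_measure_set1.
by move=> /(ae_null m0); apply: filterS => t /eqP.
Qed.

Section Subspaces.
Variables (R : realType) (r : nat).
Implicit Types S : 'M[R]_r.

Lemma sub_mul_frame_perp m (A : 'M[R]_(m, r)) S : (A <= S)%MS ->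
  A *m (frame (perp S))^T = 0.
Proof.
rewrite -(eq_frame S) => /submxP[B ->].
by rewrite -mulmxA frame_perp mulmx0.
Qed.

Lemma sub_oproj (x : 'rV[R]_r) S : (x <= S)%MS -> x *m (frame S)^T *m frame S = x.
Proof.
rewrite -(eq_frame S) => /submxP[B ->].
by rewrite -[_ *m frame S *m _]mulmxA frame_orthonormal mulmx1.
Qed.

Lemma first_missing_coordinate S : ~~ row_full S ->
  exists2 i : 'I_r, ~~ ((delta_mx 0 i : 'rV[R]_r) <= S)%MS &
    forall j : 'I_r, (j < i)%N -> ((delta_mx 0 j : 'rV[R]_r) <= S)%MS.
Proof.
move=> pS.
have [i0 hi0] : exists i : 'I_r, ~~ ((delta_mx 0 i : 'rV[R]_r) <= S)%MS.
  apply: contrapT => h; move: pS; rewrite -sub1mx => /negP; apply.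
  apply/row_subP => i; rewrite row1; apply: contrapT => /negP hi; apply: h.
  by exists i.
case: (@arg_minnP _ i0 (fun i : 'I_r => ~~ ((delta_mx 0 i : 'rV[R]_r) <= S)%MS) (fun i => i) hi0).
move=> i hi hmin; exists i => // j ji; apply: contrapT => /negP hj.
by have := hmin j hj; rewrite leqNgt ji.
Qed.

End Subspaces.

Section Staircase.
Variables (R : realType) (r : nat).
Local Notation sample := ('rV[R]_r * measurableTypeR R)%type.
Variable P : probability sample R.
Hypothesis hZ : std_gaussian (pushforward P fst).
Let g (z : 'rV[R]_r) : R := \sum_(j < r) Num.sg (\prod_(i < r | (i <= j)%N) z 0 i).
Hypothesis hg : model P g.

Let gE z : g z = \sum_(j < r) sgprod (fun i : 'I_r => (i <= j)%N) z.
Proof. by apply: eq_bigr => j _; rewrite sgr_prod. Qed.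

Lemma all_moments_sgprod Q : all_moments P (fun w : sample => sgprod Q w.1).
Proof.
apply: (@all_moments_bounded _ _ _ _ _ 1); last by move=> w; exact: normr_sgprod.
by apply: measurableT_comp (measurable_sgprod Q) measurable_fst.
Qed.

Lemma staircase_moments : all_moments P (fun w => w.2 : R).
Proof.
apply: (@all_moments_ae _ _ _ _ _ (fun w => g w.1)) => //; first exact: measurable_snd.
by under eq_fun do rewrite gE; apply: all_moments_sum => j; exact: all_moments_sgprod.
Qed.

(** One positive integral serves both exponents: [w.2] belongs to the test function of [Ybar S] for
    [lambda2], and to the integrated variable for [ilambda2]. *)
Lemma staircase_test S : ~~ row_full S ->
  exists (c : 'rV[R]_(perp_dim S)) (Q : pred 'I_r),
    (forall w : sample, sgprod Q (Zpar S w) = sgprod Q w.1) /\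
    0 < \int[P]_w (sgprod Q w.1 * w.2 * \sum_k c 0 k * Zbar S w 0 k).
Proof.
move=> /first_missing_coordinate[i iS hmin].
(* [p] is the projection of [e i] on the complement of S and [c] its coordinates there. Since [e k]
   lies in S for [k < i], [p] vanishes in those coordinates, and its coordinate [i] is its squared
   norm. *)
pose G := frame (perp S); pose e k : 'rV[R]_r := delta_mx 0 k.
pose c := e i *m G^T; pose p := c *m G.
have coordE (x : 'rV[R]_r) k : x 0 k = (x *m (e k)^T) 0 0.
  by rewrite mul_row_tr (bigD1 k)//= big1 ?addr0 => [|l lk]; rewrite mxE ?eqxx ?mulr1// (negbTE lk) mulr0.
have cE w : \sum_k c 0 k * Zbar S w 0 k = \sum_k p 0 k * w.1 0 k.
  by rewrite -!mul_row_tr ZbarE trmx_mul trmxK mulmxA.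
have pE k : p 0 k = (c *m (e k *m G^T)^T) 0 0.
  by rewrite trmx_mul trmxK mulmxA -/p -coordE.
have p0 (k : 'I_r) : (k < i)%N -> p 0 k = 0.
  by move=> ki; rewrite pE sub_mul_frame_perp ?hmin// trmx0 mulmx0 mxE.
have pi0 : 0 < p 0 i.
  rewrite pE -/c mul_row_tr lt_def sumr_ge0 ?andbT; last by move=> k _; rewrite -expr2 sqr_ge0.
  apply: contra iS; rewrite psumr_eq0 => [/allP h|k _]; last by rewrite -expr2 sqr_ge0.
  have c0 : c = 0.
    apply/rowP => k; rewrite [RHS]mxE; apply/eqP.
    by rewrite -sqrf_eq0 expr2; apply: h; exact: mem_index_enum.
  rewrite -/(e i) (frame_decomposition S (e i)) -/G -/c c0 mul0mx addr0.
  by rewrite -(eq_frame S) submxMl.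
exists c, (fun l : 'I_r => (l < i)%N); split.
  move=> w; apply: eq_bigr => l li; congr Num.sg.
  have eE := sub_oproj (hmin l li); rewrite -/(e l) in eE.
  by rewrite ZparE coordE [RHS]coordE -[in RHS]eE !trmx_mul trmxK !mulmxA.
pose Q : pred 'I_r := fun l : 'I_r => (l < i)%N.
pose h (j k : 'I_r) (z : 'rV[R]_r) := sgprod Q z * sgprod (fun l : 'I_r => (l <= j)%N) z * z 0 k.
have ah j k : all_moments P (fun w : sample => h j k w.1).
  apply: all_momentsM; last exact: all_moments_coord (gaussian_fst hZ).
  by apply: all_momentsM; exact: all_moments_sgprod.
have mh j k : measurable_fun setT (h j k).
  apply: measurable_funM; last exact: (@measurable_mx_coord _ (measurableTypeR R) 1 r 0 k).
  by apply: measurable_funM; exact: measurable_sgprod.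
have hflip a j k z : h j k (flip a z) =
    ((-1) ^+ (a < i)%N * (-1) ^+ (a <= j)%N * (-1) ^+ (k == a)) * h j k z.
  by rewrite /h !sgprod_flip coord_flip /Q; ring.
have h0 (j k : 'I_r) : (i <= k)%N -> (j, k) != (i, i) -> \int[P]_w h j k w.1 = 0.
  move=> ik jk.
  have [a ha] : exists a : 'I_r, (a < i)%N (+) (a <= j)%N (+) (k == a).
    move: ik jk; rewrite xpair_eqE leq_eqVlt => /orP[/eqP/val_inj ik|ik] jk.
      subst k; move: jk; rewrite eqxx andbT neq_ltn => /orP[ji|ij].
        by exists i; rewrite ltnn leqNgt ji eqxx.
      by exists j; rewrite ltnNge (ltnW ij) leqnn -val_eqE (ltn_eqF ij).
    have [ji|ij] := ltnP j i.
      by exists k; rewrite ltnNge (ltnW ik) leqNgt (ltn_trans ji ik) eqxx.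
    move: ij; rewrite leq_eqVlt => /orP[/eqP/val_inj ij|ij].
      by subst j; exists k; rewrite ltnNge (ltnW ik) leqNgt ik eqxx.
    have [jk'|jk'] := eqVneq j k.
      by subst k; exists i; rewrite ltnn (ltnW ij) -val_eqE (gtn_eqF ik).
    by exists j; rewrite ltnNge (ltnW ij) leqnn eq_sym (negbTE jk').
  apply: (@integral_flip_odd _ _ _ P _ (fun w : sample => w.1 : 'rV[R]_r) a (h j k)) => //.
  - exact: gaussian_fst.
  - move=> z; rewrite hflip -!signr_addb ha; ring.
  - exact: all_moments_integrable (ah j k).
have hpos : 0 < \int[P]_w h i i w.1.
  apply: Rintegral_gt0; first exact: all_moments_integrable (ah i i).
  apply: filterS (gaussian_coord_neq0 (gaussian_fst hZ)) => w z0.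
  have -> : h i i w.1 = sgprod Q w.1 ^+ 2 * `|w.1 0 i|.
    rewrite /h; have -> : sgprod (fun l : 'I_r => (l <= i)%N) w.1 = Num.sg (w.1 0 i) * sgprod Q w.1.
      rewrite [LHS](bigD1 i)//=; congr (_ * _); apply: eq_bigl => l.
      by rewrite /Q ltn_neqAle andbC.
    by rewrite normrEsg; ring.
  by rewrite sgprod_sqr// mul1r normr_gt0.
have ahs j : all_moments P (fun w : sample => \sum_k p 0 k * h j k w.1).
  by apply: all_moments_sum => k; apply: all_momentsM => //; exact: all_moments_cst.
have hE j : \int[P]_w (\sum_k p 0 k * h j k w.1) = \sum_k p 0 k * \int[P]_w h j k w.1.
  rewrite Rintegral_sum => [|k]; last by apply: integrableZR; exact: all_moments_integrable.
  by apply: eq_bigr => k _; rewrite RintegralZl//; exact: all_moments_integrable (ah j k).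
have hp j k : (j, k) != (i, i) -> p 0 k * \int[P]_w h j k w.1 = 0.
  by move=> jk; have [ki|ik] := ltnP k i; [rewrite p0// mul0r|rewrite h0// mulr0].
rewrite (@ae_eq_RintegralT _ _ _ P setT _ (fun w : sample => \sum_j \sum_k p 0 k * h j k w.1)) => //; last 3 first.
- apply: (proj1 (_ : all_moments P _)); apply: all_momentsM.
    by apply: all_momentsM; [exact: all_moments_sgprod|exact: staircase_moments].
  apply: all_moments_sum => k; apply: all_momentsM; first exact: all_moments_cst.
  exact: all_moments_coord (gaussian_Zbar hZ S).
- by apply: (proj1 (_ : all_moments P _)); apply: all_moments_sum.
- apply: filterS hg => w ->; rewrite cE gE /h [sgprod _ _ * \sum_j _]mulr_sumr mulr_suml.
  apply: eq_bigr => j _; rewrite mulr_sumr; apply: eq_bigr => k _.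
  by ring.
rewrite Rintegral_sum; last by move=> j; exact: all_moments_integrable (ahs j).
rewrite (bigD1 i)//= [X in _ + X]big1 ?addr0; last first.
  by move=> j ji; rewrite hE big1// => k _; rewrite hp// xpair_eqE (negbTE ji).
rewrite hE (bigD1 i)//= [X in _ + X]big1 ?addr0 ?mulr_gt0//.
by move=> k ki; rewrite hp// xpair_eqE (negbTE ki) andbF.
Qed.

(** The integers from [-n] to [n], a finite range for the test functions: products of signs have
    absolute value at most 1, and their product with Y at most [r]. *)
Let values n : seq R := [seq (k%:Z - n%:Z)%:~R | k <- iota 0 n.*2.+1].

Let uniq_values n : uniq (values n).
Proof. by rewrite map_inj_uniq ?iota_uniq// => j k /intr_inj/addIr[]. Qed.

Let mem_values n (x : int) : `|x| <= n%:Z -> x%:~R \in values n.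
Proof.
rewrite ler_norml => /andP[x1 x2]; apply/mapP; exists (absz (x + n%:Z)).
  by rewrite mem_iota /= add0n ltnS -lez_nat gez0_abs; lia.
by congr (_%:~R); rewrite gez0_abs; lia.
Qed.

Let normz_sgprod (Q : pred 'I_r) (z : 'rV[R]_r) : `|\prod_(l < r | Q l) sgz (z 0 l)| <= 1.
Proof.
elim/big_rec: _ => [|l x _ hx]; first by rewrite normr1.
by rewrite normrM mulr_ile1// normr_sgz lez_nat leq_b1.
Qed.

Lemma staircase_level S : ~~ row_full S -> (0 < lambda2 P S 1)%E.
Proof.
move=> pS; apply: contrapT => l0; have [c [Q [QE]]] := staircase_test pS.
have al : all_moments P (fun w => \sum_k c 0 k * Zbar S w 0 k).
  apply: all_moments_sum => k; apply: all_momentsM; first exact: all_moments_cst.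
  exact: all_moments_coord (gaussian_Zbar hZ S).
have := @integral_test_eq0 _ _ _ P _ _ (Ybar S) (fun w => \sum_k c 0 k * Zbar S w 0 k)
  (fun y : sample => sgprod Q y.1 * y.2) (values r).
under eq_Rintegral do rewrite QE.
move=> -> //; first by rewrite ltxx.
- exact: measurable_Ybar.
- apply: measurable_funM; last exact: measurable_snd.
  by apply: measurableT_comp (measurable_sgprod Q) measurable_fst.
- exact: all_moments_integrable.
- by move=> B mB; exact: lambda2_eq0_linear.
- apply: filterS hg => w /= wg; rewrite QE wg gE sgprodE.
  rewrite [X in _ * X](eq_bigr (fun j : 'I_r => (\prod_(l < r | (l <= j)%N) sgz (w.1 0 l))%:~R)) => [|j _]; last exact: sgprodE.
  rewrite -(rmorph_sum intr) -intrM; apply: mem_values; rewrite normrM.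
  apply: le_trans (_ : 1 * r%:Z <= _); last by rewrite mul1r.
  rewrite ler_pM//; apply: le_trans (ler_norm_sum _ _ _) _.
  rewrite -[leRHS]natz -[X in X%:R]card_ord -sumr_const.
  by apply: ler_sum => j _.
- exact: al.1.
Qed.

Lemma staircase_info_level S : ~~ row_full S -> (0 < ilambda2 P S 1)%E.
Proof.
move=> pS; apply: contrapT => l0; have [c [Q [QE]]] := staircase_test pS.
have al : all_moments P (fun w => w.2 * \sum_k c 0 k * Zbar S w 0 k).
  apply: all_momentsM; first exact: staircase_moments.
  apply: all_moments_sum => k; apply: all_momentsM; first exact: all_moments_cst.
  exact: all_moments_coord (gaussian_Zbar hZ S).
have := @integral_test_eq0 _ _ _ P _ _ (Zpar S) (fun w => w.2 * \sum_k c 0 k * Zbar S w 0 k)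
  (sgprod Q) (values 1).
under eq_Rintegral do rewrite QE mulrA.
move=> -> //; first by rewrite ltxx.
- exact: measurable_Zpar.
- exact: measurable_sgprod.
- exact: all_moments_integrable.
- by move=> B mB; apply: ilambda2_eq0_linear => //; exact: staircase_moments.
- by apply: aeW => w; rewrite sgprodE; exact: mem_values.
- exact: al.1.
Qed.

End Staircase.

(** * Parities *)

Section RankOne.
Context (R : realType) d (T : measurableType d) (P : probability T R).
Variables (k m : nat) (z : T -> tensor R k m) (A : tensor R k m) (eps : T -> R).
Hypothesis mz : forall t, measurable_fun setT (fun w => z w t).
Hypothesis zE : {ae P, forall w t, z w t = A t * eps w}.
Hypothesis eps1 : {ae P, forall w, eps w ^+ 2 = 1}.

(** At S = 0 a parity gives both [zeta], with [eps = Y], and [izeta], with [eps = 1], this form; the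
    two exponents thus have the same levels and spans there. *)
Lemma rank1_frobenius : 'E_P[fun w => frobenius2 (z w)]%E = (frobenius2 A)%:E.
Proof.
rewrite unlock (ae_eq_integral (cst (frobenius2 A)%:E))//.
- by have := expectation_cst P (frobenius2 A); rewrite unlock.
- by apply/measurable_EFinP; apply: measurable_sum => t; exact: measurable_funX.
- apply: filterS2 zE eps1 => w wz w1 _; congr _%:E; apply: eq_bigr => t _.
  by rewrite wz exprMn w1 mulr1.
Qed.

Lemma rank1_second_moment : (fun s : (k + k).-tuple 'I_m =>
  fine 'E_P[fun w => tensor_prod (z w) (z w) s]) = tensor_prod A A.
Proof.
apply/funext => s; rewrite unlock (ae_eq_integral (cst (tensor_prod A A s)%:E))//.
- by have := expectation_cst P (tensor_prod A A s); rewrite unlock => ->.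
- by apply/measurable_EFinP; apply: measurable_funM.
- apply: filterS2 zE eps1 => w wz w1 _; congr _%:E.
  by rewrite /tensor_prod !wz mulrACA -expr2 w1 mulr1.
Qed.

End RankOne.

(** The hypothesis says that the unfolding has trivial left kernel. *)
Lemma row_full_tensor_span (R : realType) k m (A : tensor R k.+1 m) :
  (forall a : 'rV[R]_m, (forall t, \sum_i a 0 i * A (cons_tuple i t) = 0) -> a = 0) ->
  row_full (tensor_span A).
Proof.
move=> h; rewrite /tensor_span /row_full genmxE mxrank_tr -[_ == _]/(row_free _).
rewrite -kermx_eq0; apply/rowV0P => a /sub_kermxP aA; apply: h => t.
have /rowP/(_ (enum_rank t)) := aA; rewrite !mxE => e; apply: etrans e.
by apply: eq_bigr => i _; rewrite mxE enum_rankK.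
Qed.

Section Parity.
Variables (R : realType) (r' : nat).
Local Notation r := r'.+1.
Local Notation sample := ('rV[R]_r * measurableTypeR R)%type.
Variable P : probability sample R.
Hypothesis hZ : std_gaussian (pushforward P fst).
Hypothesis hg : model P (fun z => Num.sg (\prod_(i < r) z 0 i)).

Let sigma (w : sample) : R := sgprod predT w.1.

Let am_sigma : all_moments P sigma.
Proof. exact: all_moments_sgprod. Qed.

Let am_poly d f : polyfun d f -> all_moments P (fun w => sigma w * f w.1).
Proof.
by move=> pf; apply: all_momentsM => //; exact: all_moments_polyfun (gaussian_fst hZ) pf.
Qed.

Let model_sigma : {ae P, forall w, w.2 = sigma w}.
Proof. by apply: filterS hg => w ->; rewrite sgr_prod. Qed.

Let sigma_sqr : {ae P, forall w, sigma w ^+ 2 = 1}.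
Proof.
by apply: filterS (gaussian_coord_neq0 (gaussian_fst hZ)) => w z0; exact: sgprod_sqr.
Qed.

(** The monomial over [s] collects the coordinate factors of [f]. When a constant is reached, [s]
    has fewer than r entries, so some coordinate is absent and its sign change makes the integrand
    odd. *)
Lemma parity_low_degree d f : polyfun d f -> forall s : seq 'I_r, (size s + d <= r)%N ->
  \int[P]_w (sigma w * (\prod_(j <- s) w.1 0 j * f w.1)) = 0.
Proof.
elim=> {d f} [k|k c|k i f pf IH|k f1 f2 pf1 IH1 pf2 IH2] s hs.
- by under eq_Rintegral do rewrite !mulr0; rewrite Rintegral_cst// mul0r.
- have [a as_] : exists a : 'I_r, a \notin s.
    apply: contrapT => h; have : (size (enum 'I_r) <= size s)%N.
      apply: uniq_leq_size (enum_uniq _) _ => a _.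
      by apply: contrapT => /negP ha; apply: h; exists a.
    by rewrite -cardT card_ord leqNgt; apply/negP; rewrite negbK; lia.
  pose f (z : 'rV[R]_r) := sgprod predT z * (\prod_(j <- s) z 0 j * c).
  have pc : polyfun (size s + 1) (fun z : 'rV[R]_r => \prod_(j <- s) z 0 j * c).
    by apply: polyfun_monomial; exact: polyfun_cst.
  apply: (@integral_flip_odd _ _ _ P _ (fun w : sample => w.1 : 'rV[R]_r) a f).
  + exact: gaussian_fst.
  + by apply: measurable_funM; [exact: measurable_sgprod|exact: measurable_polyfun pc].
  + by move=> z; rewrite /f sgprod_flip prod_flip (count_memPn as_) /=; ring.
  + exact: all_moments_integrable (am_poly pc).
- rewrite -(IH (i :: s)); last by rewrite /= addSn -addnS.
  by apply: eq_Rintegral => w _; rewrite big_cons; ring.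
- rewrite -[RHS]addr0 -{1}(IH1 s hs) -(IH2 s hs) -RintegralD//.
  + by apply: eq_Rintegral => w _; ring.
  + exact: all_moments_integrable (am_poly (polyfun_monomial s pf1)).
  + exact: all_moments_integrable (am_poly (polyfun_monomial s pf2)).
Qed.

(** Here the frame [G] of the whole space is some orthogonal matrix, not necessarily the identity,
    and [m] equals [r] only up to a proof. So the Hermite tensors are read in rotated
    coordinates. *)
Let S : 'M[R]_r := 0.
Local Notation m := (perp_dim S).
Local Notation G := (frame (perp S)).

Let Zpar0 w : Zpar S w = 0.
Proof.
rewrite ZparE; have -> : frame S = 0 by apply/eqP; rewrite -submx0 eq_frame sub0mx.
by rewrite mulmx0.
Qed.

Let fst_Zbar w : w.1 = Zbar S w *m G.
Proof. by rewrite {1}(fst_decomposition S w) Zpar0 add0r. Qed.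

Let perp_dimE : m = r.
Proof. by have := rank_perp S; rewrite mxrank0 addn0. Qed.

(** The tensor T_k, with Y replaced by [sigma], which is a function of Z everywhere. *)
Definition parity_tensor k : tensor R k m :=
  fun t => \int[P]_w (sigma w * hermite (Zbar S w) t).

Let am_hermite k (t : k.-tuple 'I_m) : all_moments P (fun w => sigma w * hermite (Zbar S w) t).
Proof. by apply: all_momentsM => //; exact: all_moments_hermite. Qed.

Lemma parity_tensor_eq0 k t : (k < r)%N -> @parity_tensor k t = 0.
Proof.
move=> kr; have [l pl hE] := hermite_polyfun R t.
have p : polyfun k.+1 (fun u : 'rV[R]_m => hermite u t).
  rewrite (funext hE); apply: polyfunZ; apply: polyfunD; last exact: polyfunW pl.
  by have := polyfun_prod R t; rewrite size_tuple.
have := parity_low_degree (polyfun_mulmx G^T p) (s := [::]) kr.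
rewrite /parity_tensor => h; rewrite -[RHS]h; apply: eq_Rintegral => w _.
by rewrite big_nil mul1r ZbarE.
Qed.

(** The part of the Hermite polynomial below its leading monomial has degree less than r, hence is
    orthogonal to [sigma]. *)
Lemma parity_tensorE (t : r.-tuple 'I_m) : parity_tensor t =
  (Num.sqrt r`!%:R)^-1 * \int[P]_w (sigma w * \prod_(j <- t) Zbar S w 0 j).
Proof.
have [l pl hE] := hermite_polyfun R t.
have p := polyfun_prod R t.
have pZ := polyfun_mulmx G^T p; have plZ := polyfun_mulmx G^T pl.
have e w : Zbar S w = w.1 *m G^T by exact: ZbarE.
rewrite /parity_tensor.
transitivity (\int[P]_w ((Num.sqrt r`!%:R)^-1 * (sigma w * \prod_(j <- t) (w.1 *m G^T) 0 j +
   sigma w * (\prod_(j <- [::]) w.1 0 j * l (w.1 *m G^T))))).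
  by apply: eq_Rintegral => w _; rewrite hE e big_nil; ring.
have i1 := all_moments_integrable (am_poly pZ).
have i2 : P.-integrable setT (fun w => (sigma w * (\prod_(j <- [::]) w.1 0 j * l (w.1 *m G^T)))%:E).
  by under eq_fun do rewrite big_nil mul1r; exact: all_moments_integrable (am_poly plZ).
rewrite RintegralZl//; last exact: integrableDR.
rewrite RintegralD// (parity_low_degree plZ)// addr0.
by congr (_ * _); apply: eq_Rintegral => w _; rewrite e.
Qed.

Let am_prods (s : seq 'I_r) (t : seq 'I_m) (c : 'I_m) :
  all_moments P (fun w => sigma w * (Zbar S w 0 c *
     (\prod_(j <- s) w.1 0 j * \prod_(j <- t) Zbar S w 0 j))).
Proof.
apply: all_momentsM => //; apply: all_momentsM.
  exact: all_moments_coord (gaussian_Zbar hZ S).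
apply: all_momentsM.
  exact: all_moments_polyfun (gaussian_fst hZ) (polyfun_prod R s).
exact: all_moments_polyfun (gaussian_Zbar hZ S) (polyfun_prod R t).
Qed.

(** A vector annihilating T_r along its first index makes [sigma] times the form [L] orthogonal to
    all products of [r'] rotated coordinates, hence to those of the original ones, where the
    expectation can be computed. *)
Lemma parity_tensor_inj (a : 'rV[R]_m) :
  (forall t : r'.-tuple 'I_m, \sum_i a 0 i * @parity_tensor r (cons_tuple i t) = 0) -> a = 0.
Proof.
move=> h.
pose L (w : sample) : R := \sum_i a 0 i * Zbar S w 0 i.
have amL s t : all_moments P (fun w => sigma w * (L w *
    (\prod_(j <- s) w.1 0 j * \prod_(j <- t) Zbar S w 0 j))).
  apply: all_momentsM => //; apply: all_momentsM.
    apply: all_moments_sum => i; apply: all_momentsM; first exact: all_moments_cst.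
    exact: all_moments_coord (gaussian_Zbar hZ S).
  apply: all_momentsM.
    exact: all_moments_polyfun (gaussian_fst hZ) (polyfun_prod R s).
  exact: all_moments_polyfun (gaussian_Zbar hZ S) (polyfun_prod R t).
(* The original coordinates are exchanged one at a time: each is a combination of rotated
   coordinates with coefficients from [G]. *)
have mix s t : (size s + size t = r')%N -> \int[P]_w (sigma w * (L w *
    (\prod_(j <- s) w.1 0 j * \prod_(j <- t) Zbar S w 0 j))) = 0.
  elim: s t => [|l s IH] t hs.
    have ht : size t == r' by apply/eqP.
    have c0 : (Num.sqrt r`!%:R)^-1 != 0 :> R.
      by rewrite invr_eq0 gt_eqF// sqrtr_gt0 ltr0n fact_gt0.
    apply: (mulfI c0); rewrite mulr0 -[RHS](h (Tuple ht)).
    under [RHS]eq_bigr do rewrite parity_tensorE mulrCA.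
    rewrite -mulr_sumr; congr (_ * _).
    transitivity (\int[P]_w (\sum_i a 0 i * (sigma w * (Zbar S w 0 i *
      (\prod_(j <- [::]) w.1 0 j * \prod_(j <- t) Zbar S w 0 j))))).
      apply: eq_Rintegral => w _; rewrite /L mulr_suml mulr_sumr; apply: eq_bigr => i _.
      by ring.
    rewrite Rintegral_sum; last by move=> i; apply: integrableZR; exact: all_moments_integrable (am_prods _ _ _).
    apply: eq_bigr => i _; rewrite RintegralZl//; last exact: all_moments_integrable (am_prods _ _ _).
    by congr (_ * _); apply: eq_Rintegral => w _; rewrite big_cons big_nil mul1r.
  transitivity (\int[P]_w (\sum_c G c l * (sigma w * (L w *
      (\prod_(j <- s) w.1 0 j * \prod_(j <- c :: t) Zbar S w 0 j))))).
    apply: eq_Rintegral => w _; rewrite big_cons {1}fst_Zbar mxE; move: (L w) => x.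
    rewrite !mulr_suml !mulr_sumr.
    by apply: eq_bigr => c _; rewrite big_cons; ring.
  rewrite Rintegral_sum; last by move=> i; apply: integrableZR; exact: all_moments_integrable (amL _ _).
  rewrite big1// => c _; rewrite RintegralZl//; last exact: all_moments_integrable (amL _ _).
  by rewrite IH ?mulr0//= addnS.
suff aG : a *m G = 0 by rewrite -[a]mulmx1 -(frame_orthonormal (perp S)) mulmxA aG mul0mx.
apply/rowP => i; rewrite [RHS]mxE.
(* Against the product of all coordinates other than [i], only the term [k = i] of [L] survives; it
   gives coordinate [i] of [a *m G] times the mean of the absolute value of the product of all
   coordinates. *)
pose q := enum (predC1 i).
have sq : (size q + size ([::] : seq 'I_m) = r')%N.
  by rewrite addn0 -cardE cardC1 card_ord.
have := mix q [::] sq.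
have LE w : L w = \sum_k (a *m G) 0 k * w.1 0 k.
  by rewrite /L -!mul_row_tr ZbarE trmx_mul trmxK mulmxA.
have amq k : all_moments P (fun w => sigma w * (w.1 0 k * \prod_(j <- q) w.1 0 j)).
  apply: all_momentsM => //; apply: all_momentsM; first exact: all_moments_coord (gaussian_fst hZ).
  exact: all_moments_polyfun (gaussian_fst hZ) (polyfun_prod R q).
have -> : \int[P]_w (sigma w * (L w * (\prod_(j <- q) w.1 0 j * \prod_(j <- [::]) Zbar S w 0 j))) =
    \int[P]_w (\sum_k (a *m G) 0 k * (sigma w * (w.1 0 k * \prod_(j <- q) w.1 0 j))).
  apply: eq_Rintegral => w _; rewrite LE big_nil mulr1 mulr_suml mulr_sumr.
  by apply: eq_bigr => k _; ring.
rewrite Rintegral_sum; last by move=> k; apply: integrableZR; exact: all_moments_integrable (amq k).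
have hk k : \int[P]_w ((a *m G) 0 k * (sigma w * (w.1 0 k * \prod_(j <- q) w.1 0 j))) =
    (a *m G) 0 k * \int[P]_w (sigma w * (w.1 0 k * \prod_(j <- q) w.1 0 j)).
  by rewrite RintegralZl//; exact: all_moments_integrable (amq k).
under eq_bigr do rewrite hk.
rewrite (bigD1 i)//= big1 ?addr0 => [|k ki].
  move/eqP; rewrite mulf_eq0 => /orP[/eqP //|]; rewrite gt_eqF//.
  apply: Rintegral_gt0; first exact: all_moments_integrable (amq i).
  apply: filterS (gaussian_coord_neq0 (gaussian_fst hZ)) => w z0.
  have -> : w.1 0 i * \prod_(j <- q) w.1 0 j = \prod_l w.1 0 l.
    by rewrite [RHS](bigD1 i)//= /q big_enum.
  rewrite /sigma /sgprod -big_split /=.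
  by rewrite prodr_gt0// => l _; rewrite -normrEsg normr_gt0.
rewrite [X in _ * X](_ : _ = 0) ?mulr0//.
pose f (z : 'rV[R]_r) := sgprod predT z * (\prod_(j <- k :: q) z 0 j).
transitivity (\int[P]_w f w.1).
  by apply: eq_Rintegral => w _; rewrite /f big_cons.
apply: (@integral_flip_odd _ _ _ P _ (fun w : sample => w.1 : 'rV[R]_r) i f).
- exact: gaussian_fst.
- by apply: measurable_funM; [exact: measurable_sgprod|exact: measurable_polyfun (polyfun_prod R _)].
- move=> z; rewrite /f sgprod_flip prod_flip (count_memPn _) /=; first by ring.
  by rewrite inE eq_sym (negbTE ki) /= mem_enum inE eqxx.
- exact: all_moments_integrable (am_poly (polyfun_prod R (k :: q))).
Qed.

Lemma parity_tensor_neq0 : exists t, @parity_tensor r t != 0.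
Proof.
apply: contrapT => h.
have T0 t : @parity_tensor r t = 0.
  by apply: contrapT => /eqP ht; apply: h; exists t.
have : const_mx 1 = 0 :> 'rV[R]_m.
  by apply: parity_tensor_inj => t; rewrite big1// => i _; rewrite T0 mulr0.
have i : 'I_m by rewrite perp_dimE; exact: ord0.
by move/rowP/(_ i); rewrite !mxE => /eqP; rewrite oner_eq0.
Qed.

Lemma row_full_parity_span :
  row_full (S + in_ambient (tensor_span (tensor_prod (@parity_tensor r) (@parity_tensor r))))%MS.
Proof.
set V := tensor_span _.
have fV : row_full V.
  apply: row_full_tensor_span => a h; apply: parity_tensor_inj => t1.
  have [t0 ht0] := parity_tensor_neq0.
  (* Fixing the second factor of the tensor square at a nonzero entry reduces its left kernel to
     that of T_r. *)
  apply: (mulIf ht0); rewrite mul0r -[RHS](h (cat_tuple t1 t0)) mulr_suml.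
  apply: eq_bigr => i _; rewrite -mulrA; congr (_ * _); rewrite /tensor_prod.
  have -> : cons_tuple i (cat_tuple t1 t0) = cat_tuple (cons_tuple i t1) t0 by exact: val_inj.
  rewrite (_ : [tuple _ | _ < r] = cons_tuple i t1); last first.
    by apply: eq_from_tnth => l; rewrite tnth_mktuple tnth_lshift.
  rewrite [X in _ = _ * parity_tensor X](_ : _ = t0)//.
  by apply: eq_from_tnth => l; rewrite tnth_mktuple tnth_rshift.
rewrite -sub1mx; apply: submx_trans _ (addsmxSr _ _).
rewrite /in_ambient genmxE (eqmxMfull _ fV) eq_frame sub1mx /row_full.
by rewrite -[\rank _]/m perp_dimE.
Qed.

Let am_Y : all_moments P (fun w => w.2 : R).
Proof. by apply: all_moments_ae am_sigma model_sigma; exact: measurable_snd. Qed.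

Let integral_sigma : \int[P]_w sigma w = 0.
Proof.
have := parity_low_degree (polyfun_cst _ 0 1) (s := [::]) isT.
by under eq_Rintegral do rewrite big_nil !mulr1.
Qed.

Let integral_sigma_sqr : \int[P]_w (sigma w * sigma w) = 1.
Proof.
rewrite (@ae_eq_RintegralT _ _ _ P setT _ (fun=> 1)) => //.
- exact: Rintegral_probability_cst.
- by apply: measurable_funM; exact: am_sigma.1.
Qed.

(** As Z_S = 0 and Y is 1 or -1 almost surely, the indicator of an event of [Ybar S] is an affine
    function of Y. *)
Let integral_Ybar (B : set sample) : measurable B -> exists al be : R,
  forall X, all_moments P X -> \int[P]_(w in Ybar S @^-1` B) X w =
    al * \int[P]_w X w + be * \int[P]_w (sigma w * X w).
Proof.
move=> mB; pose b y : R := \1_B ((0, y) : sample).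
exists ((b 1 + b (-1)) / 2), ((b 1 - b (-1)) / 2) => X amX.
have mYB := measurable_preimage (measurable_Ybar S) mB.
have i1 := all_moments_integrable amX.
have i2 := all_moments_integrable (all_momentsM am_sigma amX).
rewrite -!RintegralZl// -RintegralD//; try exact: integrableZR.
rewrite Rintegral_mkcond; apply: ae_eq_RintegralT => //.
- by rewrite patch_indic; apply: measurable_funM; [exact: amX.1|exact: measurable_indic].
- by apply: measurable_funD; apply: measurable_funM => //; [exact: amX.1|apply: measurable_funM; [exact: am_sigma.1|exact: amX.1]].
apply: filterS2 model_sigma sigma_sqr => w wY w1; rewrite patch_indic /=.
have -> : \1_(Ybar S @^-1` B) w = b (sigma w) :> R.
  by rewrite /b !indicE in_preimage /Ybar Zpar0 wY.
by move/eqP: w1; rewrite sqrf_eq1 => /orP[/eqP ->|/eqP ->]; field.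
Qed.

(** Conditioning on a centred sign Y gives the affine function [E h + E[Y h] Y], and the constant
    term is zero because Hermite tensors of positive order have mean zero. *)
Lemma parity_zeta k (t : k.-tuple 'I_m) : (0 < k)%N ->
  {ae P, forall w, zeta P (Ybar S w) t = parity_tensor t * w.2}.
Proof.
move=> k0; have ah := all_moments_hermite hZ t.
have aT : all_moments P (fun w => parity_tensor t * w.2).
  by apply: all_momentsM => //; exact: all_moments_cst.
apply: (@cexp_ae _ _ _ P _ _ (fun w => hermite (Zbar S w) t) (Ybar S) (fun y => parity_tensor t * y.2)).
- exact: measurable_Ybar.
- exact: all_moments_integrable.
split.
- by apply: measurable_funM => //; exact: measurable_snd.
- exact: all_moments_integrable aT.
move=> B mB; have mYB := measurable_preimage (measurable_Ybar S) mB.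
have fin X : all_moments P X -> (\int[P]_(w in Ybar S @^-1` B) (X w)%:E)%E =
    (\int[P]_(w in Ybar S @^-1` B) X w)%:E.
  move=> aX; rewrite fineK//; apply: integrable_fin_num => //.
  exact: integrableS (all_moments_integrable aX).
rewrite !fin//; congr _%:E; have [al [be hB]] := integral_Ybar mB.
rewrite !hB// (integral_hermite t (gaussian_Zbar hZ S))// mulr0 add0r.
have am1 := all_moments_integrable am_sigma.
have am2 := all_moments_integrable (all_momentsM am_sigma am_sigma).
have -> : \int[P]_w (parity_tensor t * w.2) = 0.
  rewrite (@ae_eq_RintegralT _ _ _ P setT _ (fun w => parity_tensor t * sigma w)) => //.
  - by rewrite RintegralZl// integral_sigma mulr0.
  - exact: aT.1.
  - by apply: measurable_funM => //; exact: am_sigma.1.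
  - by apply: filterS model_sigma => w ->.
rewrite mulr0 add0r; congr (_ * _).
rewrite (@ae_eq_RintegralT _ _ _ P setT _ (fun w => parity_tensor t * (sigma w * sigma w))) => //.
- by rewrite RintegralZl// integral_sigma_sqr mulr1.
- by apply: measurable_funM; [exact: am_sigma.1|exact: aT.1].
- by apply: measurable_funM => //; apply: measurable_funM; exact: am_sigma.1.
- by apply: filterS model_sigma => w h /=; rewrite h; ring.
Qed.

(** Conditioning on the constant Z_S = 0 is taking the mean. The factor 1 is the [eps] of the
    rank-one form. *)
Lemma parity_izeta k (t : k.-tuple 'I_m) :
  {ae P, forall w, izeta P (Zpar S w) t = parity_tensor t * 1}.
Proof.
have ah := all_moments_Y_hermite hZ am_Y t.
have iT : P.-integrable setT (fun w => (parity_tensor t * 1)%:E).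
  exact: all_moments_integrable (all_moments_cst _ _).
apply: (@cexp_ae _ _ _ P _ _ (fun w => w.2 * hermite (Zbar S w) t) (Zpar S) (fun=> parity_tensor t * 1)).
- exact: measurable_Zpar.
- exact: all_moments_integrable ah.
split => // B mB.
have [B0|B0] := pselect (B 0); last first.
  have -> : Zpar S @^-1` B = set0.
    by rewrite -subset0 => w /=; rewrite Zpar0.
  by rewrite !integral_set0.
have -> : Zpar S @^-1` B = setT by apply/seteqP; split=> // w _; rewrite /= Zpar0.
have iY := all_moments_integrable ah.
rewrite -[LHS]fineK ?integrable_fin_num// -[RHS]fineK ?integrable_fin_num//; congr _%:E.
apply: etrans (Rintegral_probability_cst P _) _; rewrite mulr1.
apply: ae_eq_RintegralT => //; [exact: (am_hermite t).1|exact: ah.1|].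
by apply: filterS model_sigma => w ->.
Qed.

Let one_step_leap lam spn :
  (forall k, (0 < k)%N -> lam S k = (frobenius2 (@parity_tensor k))%:E) ->
  spn S r = in_ambient (tensor_span (tensor_prod (@parity_tensor r) (@parity_tensor r))) ->
  leap_exponent lam spn r.
Proof.
move=> lamE spnE.
exists 1%N, (fun n => if n is 0 then S else S + spn S r)%MS, (fun=> r); split; last first.
  by rewrite big_nat1.
split => //.
- by case=> // _; rewrite /row_full mxrank0.
- case=> // _; split=> //.
    rewrite lamE// lte_fin lt_def sumr_ge0 ?andbT => [|t _]; last exact: sqr_ge0.
    have [t ht] := parity_tensor_neq0; apply: contra ht.
    rewrite psumr_eq0 => [/allP/(_ t)|? _]; last exact: sqr_ge0.
    by rewrite mem_index_enum sqrf_eq0; apply.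
  move=> j j1; rewrite lamE// leqNgt => lj; apply/negP => jr; move: lj.
  rewrite [frobenius2 _]big1 ?ltxx// => t _.
  by rewrite parity_tensor_eq0// expr0n.
- by case.
- by rewrite /= spnE row_full_parity_span.
Qed.

Lemma parity_gen : gen_leap_exponent P r.
Proof.
have Y1 : {ae P, forall w, (w.2 : R) ^+ 2 = 1}.
  by apply: filterS2 model_sigma sigma_sqr => w ->.
have zE k : (0 < k)%N -> {ae P, forall w (t : k.-tuple 'I_m),
    zeta P (Ybar S w) t = parity_tensor t * w.2}.
  by move=> k0; apply: filter_forall => t; exact: parity_zeta.
apply: one_step_leap => [k k0|].
  by apply: (rank1_frobenius _ (zE k k0) Y1); exact: measurable_zeta.
congr (in_ambient (tensor_span _)).
by apply: (rank1_second_moment _ (zE r isT) Y1); exact: measurable_zeta.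
Qed.

Lemma parity_info : info_leap_exponent P r.
Proof.
have Y1 : {ae P, forall w : sample, (1 : R) ^+ 2 = 1} by apply: aeW => w; rewrite expr1n.
have zE k : {ae P, forall w (t : k.-tuple 'I_m),
    izeta P (Zpar S w) t = parity_tensor t * 1}.
  by apply: filter_forall => t; exact: parity_izeta.
apply: one_step_leap => [k k0|].
  by apply: (rank1_frobenius _ (zE k) Y1); exact: measurable_izeta.
congr (in_ambient (tensor_span _)).
by apply: (rank1_second_moment _ (zE r) Y1); exact: measurable_izeta.
Qed.

End Parity.

Theorem proposition4 (R : realType) (r : nat) (hr : (1 <= r)%N)
    (P : probability ('rV[R]_r * measurableTypeR R)%type R)
    (hZ : std_gaussian (pushforward P fst))
    (hdim : intrinsic_dimension P) :
  (* (i) Gaussian parity *)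
  (model P (fun z => Num.sg (\prod_(i < r) z 0 i)) ->
    gen_leap_exponent P r /\ info_leap_exponent P r) /\
  (* (ii) staircase parity *)
  (model P (fun z => \sum_(j < r) Num.sg (\prod_(i < r | (i <= j)%N) z 0 i)) ->
    exists k l : nat, [/\ gen_leap_exponent P k, info_leap_exponent P l,
      (k <= l)%N & l = 1%N]) /\
  (* (iii) intersections of half-spaces *)
  (forall (M : nat) (v : 'I_M -> 'rV[R]_r) (alpha : 'I_M -> R), (1 <= M)%N ->
    model P (fun z =>
      2 * \prod_(j < M) (alpha j < (v j *m z^T) 0 0)%R%:R - 1) ->
    exists k : nat, gen_leap_exponent P k /\ (k <= 2)%N) /\
  (* (iv) polynomials *)
  (forall q : mpoly.mpoly r R,
    model P (fun z => mpoly.meval (fun i => z 0 i) q) ->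
    exists k : nat, gen_leap_exponent P k /\ (k <= 2)%N).
Proof.
case: r hr P hZ hdim => [//|r'] _ P hZ hdim; split; [|split; [|split]].
- by move=> hg; split; [exact: parity_gen|exact: parity_info].
- move=> hg.
  have [S pS|k genk k1] := @gen_leap_le _ _ P hZ 1.
    by exists 1%N; split => //; exact: staircase_level.
  have [S pS|l infol l1] := @info_leap_le _ _ P hZ 1 (staircase_moments hg).
    by exists 1%N; split => //; exact: staircase_info_level.
  (* As [r] is positive, the decomposition has at least one step, and levels start at 1; this turns
     the bound by 1 into an equality. *)
  have l0 := leap_exponent_gt0 (ltn0Sn r') infol.
  have lE : l = 1%N by apply/eqP; rewrite eqn_leq l1.
  by exists k, l; split; rewrite // lE.
- move=> M v alpha _ hf.
  have [S pS|k genk k2] := @gen_leap_le _ _ P hZ 2; last by exists k.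
  exact: halfspaces_level hf _ pS.
- move=> q hf; have [d pq] := polyfun_meval q.
  have [S pS|k genk k2] := @gen_leap_le _ _ P hZ 2; last by exists k.
  by exists 2%N; split => //; exact: polynomial_level pq hf _ pS.
Qed.
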